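(* Assume that $f$, $\gamma$, and $g$ are piecewise continuous. Then the Hessian matrix of $\mathcal L_\tau(u_{n,\tau};\mathbf f)$ with respect to the nonlinear parameters $\mathbf r$ is given by $$\nabla^2_{\mathbf r}\mathcal L_\tau(u_{n,\tau};\mathbf f)=\left(D(\hat{\mathbf c})\otimes I_3\right)\mathcal H(\mathbf r)\left(D(\hat{\mathbf c})\otimes I_3\right)+\hat{\mathcal H}(\mathbf c,\mathbf r)\left(D(\hat{\mathbf c})\otimes I_3\right),$$ where $\mathcal H(\mathbf r)=\sum_{S=I,B}\mathcal H_S(\mathbf r)$, $\hat{\mathcal H}(\mathbf c,\mathbf r)=\sum_{S=I,B}\hat{\mathcal H}_S(\mathbf c,\mathbf r)$, and $$\mathcal H_S(\mathbf r)=\int_{\Omega_S}\mathbf G_S(\mathbf x;\mathbf r)\,\mathbf G_S(\mathbf x;\mathbf r)^T\,d\mathbf x,\qquad \hat{\mathcal H}_S(\mathbf c,\mathbf r)=\int_{\Omega_S}R_S(\mathbf x;\mathbf c,\mathbf r)\,\nabla_{\mathbf r}\mathbf G_S(\mathbf x;\mathbf r)^T\,d\mathbf x .$$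
   Context: Setting. $\Omega\subset\mathbb{R}^2$ is a bounded open domain with boundary $\Gamma$ and unit outward normal $\boldsymbol n$; $\boldsymbol\beta\in C^1(\bar\Omega)^2$ with $|\boldsymbol\beta(\mathbf x)|=1$ in $\Omega$; $\gamma$ is the reaction coefficient; $\Gamma_-=\{\mathbf x\in\Gamma:\boldsymbol\beta\cdot\boldsymbol n<0\}$ is the inflow boundary; $f\in L^2(\Omega)$, $g\in L^2(\Gamma_-)$, $\mathbf f=(f,g)$. Domain decomposition. $\tilde\Omega_B\subset\Omega$ is a (thin) strip region with $\Gamma_-\subseteq\partial\tilde\Omega_B$; $\Omega_I=\Omega\setminus\tilde\Omega_B$; for a given small $\epsilon>0$, $\Omega_B=\tilde\Omega_B\setminus\{\mathbf x\in\tilde\Omega_B:\operatorname{dist}(\mathbf x,\Gamma_-)\le\epsilon\}$. In $\Omega_I$, $\tau$ is a small positive constant; for $\mathbf x\in\tilde\Omega_B$, $\tau=\tau(\mathbf x)>0$ is chosen so that $\mathbf x-\tau\boldsymbol\beta(\mathbf x)\in\Gamma_-$, and $g_\tau(\mathbf x)=g(\mathbf x-\tau\boldsymbol\beta(\mathbf x))$. For $\mathbf x\in\Omega_I$, $D_{\boldsymbol\beta,\tau}v(\mathbf x)=\frac{v(\mathbf x)-v(\mathbf x-\tau\boldsymbol\beta(\mathbf x))}{\tau}$, applied componentwise to vector- and matrix-valued functions of $\mathbf x$. The functional is $$\mathcal L_\tau(v;\mathbf f)=\tfrac12\|D_{\boldsymbol\beta,\tau}v+\gamma v-f\|_{0,\Omega_I}^2+\tfrac12\|(\tau^{-1}+\gamma)v-\tau^{-1}g_\tau-f\|_{0,\Omega_B}^2,$$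 with $\|\cdot\|_{0,S}$ the $L^2(S)$ norm. Network. $\mathbf y=(1,x_1,x_2)^T$; $\mathbf r=(\mathbf r_1,\dots,\mathbf r_n)$, identified with a vector in $\mathbb{R}^{3n}$, $\mathbf r_i=(b_i,\omega_{i1},\omega_{i2})^T$, $\boldsymbol\omega_i=(\omega_{i1},\omega_{i2})^T$, $|\boldsymbol\omega_i|=1$; $\mathbf c=(c_0,\dots,c_n)^T$, $\hat{\mathbf c}=(c_1,\dots,c_n)^T$, $D(\hat{\mathbf c})=\operatorname{diag}(c_1,\dots,c_n)$; $I_3$ is the $3\times3$ identity; $\otimes$ is the Kronecker product. With $\sigma(t)=\max\{0,t\}$, $\sigma_0=1$, $\sigma_i(\mathbf x)=\sigma(\mathbf r_i\cdot\mathbf y)$, the network function is $u_{n,\tau}(\mathbf x)=\sum_{i=0}^n c_i\sigma_i(\mathbf x)$, regarded as a function of $(\mathbf c,\mathbf r)$. $H$ is the Heaviside function ($H(0)=1/2$), $H_i(\mathbf x)=H(\mathbf r_i\cdot\mathbf y)$, $\mathbf H(\mathbf x;\mathbf r)=(H_1,\dots,H_n)^T$. The residuals are $R_I=(D_{\boldsymbol\beta,\tau}+\gamma)u_{n,\tau}-f$ and $R_B=(\tau^{-1}+\gamma)u_{n,\tau}-\tau^{-1}g_\tau-f$, and $$\mathbf G_I=(D_{\boldsymbol\beta,\tau}+\gamma)(\mathbf H\otimes\mathbf y),\qquad \mathbf G_B=(\tau^{-1}+\gamma)\,\mathbf H\otimes\mathbf y.$$ Derivatives. Derivatives in $\mathbf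 r$ are in the weak sense with $\sigma'=H$ and $H'=\delta$ (Dirac delta). With $\Lambda(\mathbf x;\mathbf r)=\operatorname{diag}(\delta(\mathbf r_1\cdot\mathbf y),\dots,\delta(\mathbf r_n\cdot\mathbf y))$, $$\nabla_{\mathbf r}\mathbf G_I^T=(D_{\boldsymbol\beta,\tau}+\gamma)(\Lambda\otimes\mathbf y\mathbf y^T),\qquad \nabla_{\mathbf r}\mathbf G_B^T=(\tau^{-1}+\gamma)(\Lambda\otimes\mathbf y\mathbf y^T),$$ where $D_{\boldsymbol\beta,\tau}$ acts on all $\mathbf x$-dependent factors (including $\mathbf y$). The delta function is the limit $\delta(t)=\lim_{s\to0^+}d_s(t)$, with $d_s=\frac1{2s}$ on $(-s,s)$ and $0$ otherwise, and integrals involving $\delta$ are the corresponding limits; for piecewise continuous $k$, $\int_\Omega k(\mathbf x)\,\delta(\mathbf r_i\cdot\mathbf y)\,d\mathbf x$ is the line integral of $k$ along $\mathbf l_{\mathbf r_i}=\{\mathbf x\in\Omega:\mathbf r_i\cdot\mathbf y=0\}$, and by convention $\int_\Omega k\,H(\mathbf r_i\cdot\mathbf y)\delta(\mathbf r_i\cdot\mathbf y)\,d\mathbf x=\frac12\int_\Omega k\,\delta(\mathbf r_i\cdot\mathbf y)\,d\mathbf x$.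
   Formalization: Added regularity: the boundaries of Ω, the strip and Ω_B have finite length; the strip, f and γ are measurable; x−τ(x)β(x) pulls piecewise continuous functions on Γ_- back to piecewise continuous ones on Ω_B. Without it the delta integrals or the functional can be undefined. *)

(* Defs.v *)
From HB Require Import structures.
From mathcomp Require Import all_boot all_order all_algebra.
From mathcomp Require Export mxtens.
From mathcomp Require Export all_classical all_reals all_analysis.
Export numFieldNormedType.Exports.

Set Implicit Arguments.
Unset Strict Implicit.
Unset Printing Implicit Defensive.

Import Order.TTheory GRing.Theory Num.Theory.

Local Open Scope classical_set_scope.
Local Open Scope ring_scope.

(* The library norm on [R * R] is the sup norm; it induces the usual topology,
   and the Euclidean length is [enorm]. *)
Notation plane R := (R * R)%type.

Section Plane.
Context {R : realType}.
Implicit Types (Omega S A : set (plane R)) (x p q nu : plane R).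

Definition dot p q : R := p.1 * q.1 + p.2 * q.2.

Definition enorm p : R := Num.sqrt (dot p p).

Definition area : set (plane R) -> \bar R :=
  (@lebesgue_measure R \x @lebesgue_measure R)%E.

(* [+oo] when [A] is empty. *)
Definition edistance x A : \bar R := ereal_inf [set (enorm (x - p))%:E | p in A].

Definition boundary S : set (plane R) := closure S `\` interior S.

(* [nu] is the unit outward normal of [Omega] at [x]: near [x], the set agrees
   with the half-plane [dot (y - x) nu < 0] up to an arbitrarily thin cone. It
   need not exist at exceptional boundary points such as corners. *)
Definition outward_normal Omega x nu : Prop :=
  enorm nu = 1 /\
  forall e : R, 0 < e -> \forall y \near x,
    (dot (y - x) nu < - (e * enorm (y - x)) -> Omega y) /\
    (e * enorm (y - x) < dot (y - x) nu -> ~ Omega y).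

Definition inflow Omega (beta : plane R -> plane R) : set (plane R) :=
  [set x | boundary Omega x /\
           exists2 nu, outward_normal Omega x nu & dot (beta x) nu < 0].

(* beta is C^1 inside, and beta and its derivatives extend continuously to the
   closure. *)
Definition C1_closure Omega (beta : plane R -> plane R) : Prop :=
  [/\ {within closure Omega, continuous beta},
      forall x, Omega x -> differentiable beta x &
      forall v : plane R, exists2 B : plane R -> plane R,
        {within closure Omega, continuous B} &
        forall x, Omega x -> 'D_v beta x = B x].

(* Contained in finitely many curves of finite length (a rectifiable curve is
   Lipschitz in its arc-length parametrization). *)
Definition rectifiable A : Prop :=
  exists (m : nat) (C : 'I_m -> R -> plane R),
    (forall i, exists k : R, k.-lipschitz_(`[0, 1]%classic) (C i)) /\
    A `<=` \bigcup_i (C i @` `[0, 1]%classic).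

(* [S] is cut into finitely many pieces, on each of which [k] is the
   restriction of a function continuous up to the boundary of the piece; the
   interfaces between the pieces are [thin]. *)
Definition piecewise_continuous (thin : set (plane R) -> Prop) S
    (k : plane R -> R) : Prop :=
  exists (m : nat) (P : 'I_m -> set (plane R)) (kappa : 'I_m -> plane R -> R),
    S = \bigcup_i P i /\
    forall i, [/\ thin (S `&` closure (P i) `&` closure (S `\` P i)),
                  {within closure (P i), continuous (kappa i)} &
                  forall x, P i x -> k x = kappa i x].

(* On a two-dimensional region the interfaces are curves. *)
Definition region_pc S (k : plane R -> R) : Prop :=
  measurable_fun S k /\ piecewise_continuous rectifiable S k.

(* On a part of a boundary curve they are finitely many points. *)
Definition curve_pc S (k : plane R -> R) : Prop :=
  piecewise_continuous (fun A => finite_set A) S k.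

End Plane.

Section Activation.
Context {R : realType}.

Definition relu (t : R) : R := Num.max 0 t.

Definition heaviside (t : R) : R :=
  if t < 0 then 0 else if t == 0 then 2^-1 else 1.

Definition delta_approx (s t : R) : R :=
  if (- s < t) && (t < s) then (2 * s)^-1 else 0.

End Activation.

(* Parameters [r = (r_1, ..., r_n)] are stacked in a column of size [n * 3];
   component [k] of [r_i] sits at [mxtens_index (i, k)], the indexing used by
   the Kronecker product [*t]. *)
Section Network.
Context {R : realType} {n : nat}.
Implicit Types (c : 'cV[R]_n.+1) (r : 'cV[R]_(n * 3)) (x : plane R).

Definition yvec x : 'cV[R]_3 := \col_k [:: 1; x.1; x.2]`_k.

Definition neuron r (i : 'I_n) : 'cV[R]_3 := \col_k r (mxtens_index (i, k)) 0.

Definition omega r (i : 'I_n) : plane R :=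
  (neuron r i (inord 1) 0, neuron r i (inord 2) 0).

Definition preact r (i : 'I_n) x : R := ((neuron r i)^T *m yvec x) 0 0.

Definition network c r x : R^o :=
  c ord0 0 + \sum_(i < n) c (lift ord0 i) 0 * relu (preact r i x).

Definition Dhat c : 'M[R]_n := diag_mx (\row_i c (lift ord0 i) 0).

Definition Hvec r x : 'cV[R]_n := \col_i heaviside (preact r i x).

(* [Lambda] with the Dirac delta replaced by its approximation [d_s]. *)
Definition Lambda (s : R) r x : 'M[R]_n :=
  diag_mx (\row_i delta_approx s (preact r i x)).

End Network.

Section LeastSquares.
Context {R : realType}.
Variables (OmegaI OmegaB : set (plane R)).
Variables (beta : plane R -> plane R) (gamma f g : plane R -> R).
Variables (tau : R) (tauB : plane R -> R).
Implicit Types x : plane R.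

Definition back_diff {V : lmodType R} (v : plane R -> V) x : V :=
  tau^-1 *: (v x - v (x - tau *: beta x)).

(* The operators D_{beta,tau} + gamma and tau^-1 + gamma. *)
Definition opI {V : lmodType R} (v : plane R -> V) x : V :=
  back_diff v x + gamma x *: v x.

Definition opB {V : lmodType R} (v : plane R -> V) x : V :=
  ((tauB x)^-1 + gamma x) *: v x.

Definition resI (v : plane R -> R^o) x : R := opI v x - f x.

Definition resB (v : plane R -> R^o) x : R :=
  opB v x - (tauB x)^-1 * g (x - tauB x *: beta x) - f x.

Definition loss (v : plane R -> R^o) : R :=
  2^-1 * (\int[area]_(x in OmegaI) (resI v x ^+ 2)) +
  2^-1 * (\int[area]_(x in OmegaB) (resB v x ^+ 2)).

Definition mx_int {p q} (S : set (plane R)) (F : plane R -> 'M[R]_(p, q)) :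
  'M[R]_(p, q) := \matrix_(a, b) \int[area]_(x in S) F x a b.

Context {n : nat}.
Implicit Types (c : 'cV[R]_n.+1) (r : 'cV[R]_(n * 3)).

Definition GI r x : 'cV[R]_(n * 3) := opI (fun x => Hvec r x *t yvec x) x.

Definition GB r x : 'cV[R]_(n * 3) := opB (fun x => Hvec r x *t yvec x) x.

(* grad_r G_S^T with delta replaced by d_s. *)
Definition gradGI (s : R) r x : 'M[R]_(n * 3) :=
  opI (fun x => Lambda s r x *t (yvec x *m (yvec x)^T)) x.

Definition gradGB (s : R) r x : 'M[R]_(n * 3) :=
  opB (fun x => Lambda s r x *t (yvec x *m (yvec x)^T)) x.

Definition HmatI r : 'M[R]_(n * 3) :=
  mx_int OmegaI (fun x => GI r x *m (GI r x)^T).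

Definition HmatB r : 'M[R]_(n * 3) :=
  mx_int OmegaB (fun x => GB r x *m (GB r x)^T).

Definition HhatI_approx c r (s : R) : 'M[R]_(n * 3) :=
  mx_int OmegaI (fun x => resI (network c r) x *: gradGI s r x).

Definition HhatB_approx c r (s : R) : 'M[R]_(n * 3) :=
  mx_int OmegaB (fun x => resB (network c r) x *: gradGB s r x).

(* Integrals involving delta are the limits s -> 0+ of those with d_s. *)
Definition HhatI c r : 'M[R]_(n * 3) :=
  \matrix_(a, b) lim (HhatI_approx c r s a b @[s --> 0^'+]).

Definition HhatB c r : 'M[R]_(n * 3) :=
  \matrix_(a, b) lim (HhatB_approx c r s a b @[s --> 0^'+]).

Definition Hhat_exists c r : Prop := forall a b,
  cvg (HhatI_approx c r s a b @[s --> 0^'+]) /\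
  cvg (HhatB_approx c r s a b @[s --> 0^'+]).

Definition hessian_formula c r : 'M[R]_(n * 3) :=
  (Dhat c *t (1%:M : 'M[R]_3)) *m (HmatI r + HmatB r) *m (Dhat c *t (1%:M : 'M[R]_3)) +
  (HhatI c r + HhatB c r) *m (Dhat c *t (1%:M : 'M[R]_3)).

End LeastSquares.

Section WeakHessian.
Context {R : realType} {N : nat}.
Implicit Types (U : set 'cV[R]_N) (L : 'cV[R]_N -> R) (M : 'cV[R]_N -> 'M[R]_N).

Definition grad L (r : 'cV[R]_N) : 'cV[R]_N :=
  \col_a 'D_(delta_mx a 0) (L : 'cV[R]_N -> R^o) r.

(* C^1 functions with compact support inside [A]. *)
Definition test_function (A : set R) (phi : R -> R) : Prop :=
  [/\ forall t, derivable phi t 1, continuous (phi^`())%classic &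
      exists K : set R, [/\ compact K, K `<=` A &
                            forall t, ~ K t -> phi t = 0]].

(* L has a classical gradient in [U], and M is the derivative of this gradient
   in the sense of distributions, along every line. *)
Definition weak_hessian U L M : Prop :=
  (forall r, U r -> differentiable (L : 'cV[R]_N -> R^o) r) /\
  forall (r v : 'cV[R]_N) (phi : R -> R),
    test_function [set t | U (r + t *: v)] phi ->
    forall a,
      \int[@lebesgue_measure R]_t (grad L (r + t *: v) a 0 * phi^`()%classic t) =
      - \int[@lebesgue_measure R]_t ((M (r + t *: v) *m v) a 0 * phi t).

(* A distributional derivative only determines almost all values. The value at
   a given point is the one selected by H' = lim d_s: for t <> s, -s one has
   d_s t = (H (t + s) - H (t - s)) / (2 s), so the derivative of the gradient is
   the limit of its central difference quotients. It is the classical Hessian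
   wherever the gradient is differentiable. *)
Definition central_hessian L (r : 'cV[R]_N) (A : 'M[R]_N) : Prop :=
  forall (v : 'cV[R]_N) a,
    (2 * s)^-1 * (grad L (r + s *: v) a 0 - grad L (r - s *: v) a 0)
      @[s --> 0^'+] --> (A *m v) a 0.

End WeakHessian.

(* Main.v *)
Require Import Defs.
From mathcomp Require Import all_boot all_order all_algebra.
Import Order.TTheory GRing.Theory Num.Theory.
Local Open Scope classical_set_scope.
Local Open Scope ring_scope.
From HB Require Import structures.
From mathcomp Require Import all_classical all_reals all_analysis measurable_realfun.
From mathcomp Require Import ring lra.

(** Both discrete operators have the form [v |-> sum_l alpha_l * (v \o psi_l)]
    with two channels, [psi_l x] being [x] or [x - tau * beta x]. Each half of
    the loss is thus half the integral of the square of a residual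
    [sum_l alpha_l * (network \o psi_l) - F], where the parameters enter only
    through [relu (preact r i (psi_l x))], and [preact] is linear in [r].

    First order. The Taylor remainder of [relu] at [p] with increment [d]
    vanishes unless [|p| <= |d|], and is at most [|d|]. So the remainder of the
    loss is controlled by the area of the layers [|preact r i (psi_l x)| <= t].
    For small [tau] the function [h = preact r i \o psi_l] has one partial
    derivative bounded away from [0] ([steep_preact]): along a line in that
    direction a layer has length [O(t)] between two interfaces, and the number
    of interface crossings on the line is integrable because the interfaces are
    rectifiable (a Banach indicatrix, [rectifiable_indicatrix]). Hence a layer
    has area [O(t)] ([layer_band]), the loss is differentiable
    ([energy_taylor]) and its gradient is locally Lipschitz
    ([energy_diff_lipschitz]).

    Second order. Up to [O(s)], the central difference quotient of the gradient
    is the integral of the product of two first derivatives of the residual,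
    plus [(2 s)^-1] times the integral of the residual against the jumps
    [heaviside (h + s w) - heaviside (h - s w)] ([central_error]). The jump of
    the Heaviside function and the approximate delta are two instances of the
    same kind of kernel ([jump_kernel]): it is [1] or [-1] where [|h| < s |w|],
    according to the sign of [w], and [0] where [|h| > s |w|]. On a segment with
    a single transversal zero of [h], the rescaled integral of
    [q * K (h, s w)] tends to [q w / |h'|] at the zero, which depends on the
    product [q w] only ([jump_limit]). Integrating over the lines (Fubini and
    dominated convergence, [layer_limit]) shows that the integrals with the
    approximate delta converge, and that they have the same limit as the jump
    term. This is the central Hessian formula ([central_limit],
    [region_matrix]).

    Distributional derivative. In the integral of the gradient against a
    derivative of a test function, replace that derivative by central
    quotients, move these to the gradient by translation invariance, and pass
    to the limit under the Lipschitz bound ([weak_derivative]). *)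

Set Implicit Arguments.
Unset Strict Implicit.
Unset Printing Implicit Defensive.

(** * Measurability in the plane *)

(** The plane as a product of Borel lines, which is the form that the Fubini
    theorems expect. *)
Notation mplane R := (measurableTypeR R * measurableTypeR R)%type.

Section PlaneMeasure.
Context {R : realType}.

Definition area_meas : {measure set mplane R -> \bar R} :=
  [the {measure set mplane R -> \bar R} of (@lebesgue_measure R \x @lebesgue_measure R)%E].

(** The product sigma-algebra is generated by rectangles, and an open set is the
    union of the countably many rational squares that it contains. *)
Lemma open_plane_measurable (U : set (plane R)) : open U -> measurable (U : set (mplane R)).
Proof.
move=> oU.
pose B (a b c : rat) : set (mplane R) := (ball (ratr a : R) (ratr c) : set (measurableTypeR R)) `*` (ball (ratr b : R) (ratr c)).
have -> : U = \bigcup_a \bigcup_b \bigcup_(c in [set c | B a b c `<=` U]) B a b c.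
  apply/seteqP; split=> [x Ux|x [a _] [b _] [c /= sub]]; last exact: sub.
  have /nbhs_ballP[e /= e0 be] : nbhs x U by exact: open_nbhs_nbhs.
  have [c /[!in_itv]/= /andP[c0 ce]] := @rat_in_itvoo R 0 (e / 2) (divr_gt0 e0 (ltr0Sn _ 1)).
  have [a /[!in_itv]/= /andP[a0 ae]] : exists q, ratr q \in `]x.1 - ratr c, x.1 + ratr c[%R.
    by apply: rat_in_itvoo; lra.
  have [b /[!in_itv]/= /andP[b0 b_e]] : exists q, ratr q \in `]x.2 - ratr c, x.2 + ratr c[%R.
    by apply: rat_in_itvoo; lra.
  exists a => //; exists b => //; exists c => /=.
    move=> y [/=]; rewrite /ball /= => y1 y2; apply: be; split; rewrite /ball /=.
      by move: y1; rewrite !ltr_norml => /andP[? ?]; lra.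
    by move: y2; rewrite !ltr_norml => /andP[? ?]; lra.
  by split; rewrite /ball /= ltr_norml; lra.
apply: bigcupT_measurable_rat => a; apply: bigcupT_measurable_rat => b.
rewrite bigcup_mkcond; apply: bigcupT_measurable_rat => c.
by case: ifP => _ //; apply: measurableX; exact: measurable_ball.
Qed.

Lemma open_measurable_fun (O : set (plane R)) (f : plane R -> R) :
  open O -> {in O, continuous f} -> measurable_fun (O : set (mplane R)) f.
Proof.
move=> oO cf mO Y mY.
have : measurable_fun (O : set (mplane R)) f; last by move/(_ mO Y mY).
apply: (measurability _ (RGenOpens.measurableE R)) => _ [_ [a [b -> <-]]].
rewrite -[_ `&` _]/((O `&` f @^-1` `]a, b[) : set (mplane R)).
apply: open_plane_measurable; rewrite openE => x [Ox fx].
apply: filterI; first exact: open_nbhs_nbhs.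
have /cf/(_ (`]a, b[%classic)) : x \in O by exact: mem_set.
by apply; apply: open_nbhs_nbhs; split => //; exact: itv_open.
Qed.

End PlaneMeasure.

(** * Functions on axis-parallel segments that avoid an exceptional set *)

Section Segments.
Context {R : realType}.
Implicit Types (A B E S P : set (plane R)) (k : plane R -> R).

(** A point of the line at offset [y]: horizontal when [j] holds, vertical
    otherwise. Which direction is useful depends on the neuron. *)
Definition pt (j : bool) (x y : R) : plane R := if j then (x, y) else (y, x).

Lemma pt_continuous j y : continuous (pt j ^~ y).
Proof.
case: j => x /=; [apply: (@cvg_pair _ _ _ (nbhs x) (nbhs x) (nbhs y)); [exact: cvg_id|exact: cvg_cst] |
apply: (@cvg_pair _ _ _ (nbhs x) (nbhs y) (nbhs x)); [exact: cvg_cst|exact: cvg_id]].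
Qed.

(** Composition with [clip a b] extends a function from a segment to the whole
    line without losing continuity. *)
Definition clip (a b x : R) := Num.max a (Num.min x b).

Lemma clip_continuous a b : continuous (clip a b).
Proof.
move=> x; apply: (@continuous_max R R (cst a) (fun x => Num.min x b)).
  exact: cvg_cst.
by apply: (@continuous_min R R id (cst b)); [exact: cvg_id|exact: cvg_cst].
Qed.

Lemma clip_in a b x : a <= b -> a <= clip a b x <= b.
Proof. by move=> ab; rewrite /clip le_max lexx /= ge_max ab ge_min lexx orbT. Qed.

Lemma clip_id a b x : a <= x <= b -> clip a b x = x.
Proof. by case/andP => ax xb; rewrite /clip (min_idPl xb) (max_idPr ax). Qed.

Definition on_seg A j (a b y : R) := forall x, a < x < b -> A (pt j x y).

(** An interval is connected. *)
Lemma interval_dichotomy (a b : R) (Q : set R) :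
  (forall x, a < x < b -> ~ (closure Q x /\ closure (~` Q) x)) ->
  (forall x, a < x < b -> Q x) \/ (forall x, a < x < b -> ~ Q x).
Proof.
move=> h; apply: contrapT => /not_orP[/existsNP[x /not_implyP[xab nQx]] /existsNP[z /not_implyP[zab /contrapT Qz]]].
have /connectedP/(_ (fun t : bool => if t then `]a, b[%classic `\` Q else `]a, b[%classic `&` Q)) :
    connected (`]a, b[%classic : set R).
  by apply/connected_intervalP; exact: interval_is_interval.
apply; split => [[]||].
- by exists x; split => //=; rewrite in_itv.
- by exists z; split => //=; rewrite in_itv.
- by rewrite setUIDK.
- split; apply/seteqP; split => // t.
    move=> [cQ [/= tI nQ]]; apply: (h t); first by move: tI; rewrite in_itv.
    split; first by apply: closureS cQ; exact: subIsetr.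
    exact: subset_closure.
  move=> [[/= tI Qt] cQ]; apply: (h t); first by move: tI; rewrite in_itv.
  split; first exact: subset_closure.
  by apply: closureS cQ => u [_].
Qed.

(** The interfaces of [S] are hidden in [E]. *)
Definition cuts E S := forall j a b y, a < b -> on_seg (~` E) j a b y ->
  on_seg S j a b y \/ on_seg (~` S) j a b y.

Lemma closure_pt (Q : set R) A j y x :
  closure Q x -> (forall t, Q t -> A (pt j t y)) -> closure A (pt j x y).
Proof.
move=> cQ QA V /(pt_continuous (j := j) (y := y)) /cQ[t [Qt Vt]].
by exists (pt j t y); split => //; exact: QA.
Qed.

(** On a segment that avoids the boundary of [S], the trace of [S] and the trace
    of its complement are both relatively closed. *)
Lemma cuts_boundary E S : boundary S `<=` E -> cuts E S.
Proof.
move=> SE j a b y ab nE.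
apply: (@interval_dichotomy a b (fun x => S (pt j x y))) => x xab [c1 c2].
apply: (nE x xab); apply: SE; split; first exact: (closure_pt c1).
move=> iS; have : closure (~` S) (pt j x y) by exact: (closure_pt c2).
by move/(_ _ iS) => [z []].
Qed.

Lemma cutsC E S : cuts E S -> cuts E (~` S).
Proof.
move=> c j a b y ab /(c _ _ _ _ ab)[h|h]; [right|left] => // x xab.
by apply; exact: h.
Qed.

Lemma cutsI E S S' : cuts E S -> cuts E S' -> cuts E (S `&` S').
Proof.
move=> c c' j a b y ab nE; have [h|h] := c _ _ _ _ ab nE; last first.
  by right => x /h nS [].
have [h'|h'] := c' _ _ _ _ ab nE; last by right => x /h' nS [].
by left => x xab; split; [exact: h|exact: h'].
Qed.

(** What piecewise continuity gives on segments: away from the interfaces the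
    function extends continuously to the closed segment. *)
Definition tame S E k := forall j a b y, a < b ->
  on_seg (~` E) j a b y -> on_seg S j a b y ->
  exists2 kp : R -> R, continuous kp & forall x, a < x < b -> k (pt j x y) = kp x.

Lemma tame_sub S S' E E' k :
  S' `<=` S -> E `<=` E' -> tame S E k -> tame S' E' k.
Proof.
move=> SS EE t j a b y ab nE hS; apply: t => // x xab.
  by move/EE; exact: nE.
by apply: SS; exact: hS.
Qed.

Lemma eq_tame S E k k' : (forall x, S x -> k x = k' x) -> tame S E k -> tame S E k'.
Proof.
move=> kk t j a b y ab nE hS; have [kp ckp kE] := t _ _ _ _ ab nE hS.
by exists kp => // x xab; rewrite -kk ?kE//; exact: hS.
Qed.

Lemma tame_cst S E c : tame S E (fun=> c).
Proof. by move=> j a b y ab _ _; exists (fun=> c) => // x; exact: cvg_cst. Qed.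

Lemma tameD S E k k' : tame S E k -> tame S E k' -> tame S E (fun x => k x + k' x).
Proof.
move=> t t' j a b y ab nE hS; have [kp ckp kE] := t _ _ _ _ ab nE hS.
have [kp' ckp' kE'] := t' _ _ _ _ ab nE hS.
exists (fun x => kp x + kp' x); last by move=> x xab; rewrite kE ?kE'.
by move=> x; apply: cvgD; [exact: ckp|exact: ckp'].
Qed.

Lemma tameM S E k k' : tame S E k -> tame S E k' -> tame S E (fun x => k x * k' x).
Proof.
move=> t t' j a b y ab nE hS; have [kp ckp kE] := t _ _ _ _ ab nE hS.
have [kp' ckp' kE'] := t' _ _ _ _ ab nE hS.
exists (fun x => kp x * kp' x); last by move=> x xab; rewrite kE ?kE'.
by move=> x; apply: cvgM; [exact: ckp|exact: ckp'].
Qed.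

Lemma tame_comp S E k (phi : R -> R) :
  continuous phi -> tame S E k -> tame S E (fun x => phi (k x)).
Proof.
move=> cphi t j a b y ab nE hS; have [kp ckp kE] := t _ _ _ _ ab nE hS.
exists (phi \o kp); last by move=> x xab; rewrite kE.
by move=> x; apply: continuous_comp; [exact: ckp|exact: cphi].
Qed.

Lemma tameN S E k : tame S E k -> tame S E (fun x => - k x).
Proof. by apply: (tame_comp (phi := -%R)); exact: opp_continuous. Qed.

Lemma tame_sum S E (I : Type) (s : seq I) (k : I -> plane R -> R) :
  (forall i, tame S E (k i)) -> tame S E (fun x => \sum_(i <- s) k i x).
Proof.
move=> t; elim: s => [|i s IH].
  by apply: (eq_tame (k := fun=> 0)); [move=> x _; rewrite big_nil|exact: tame_cst].
apply: (eq_tame (k := fun x => k i x + \sum_(i <- s) k i x)); last exact: tameD.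
by move=> x _; rewrite big_cons.
Qed.

(** A curve that stays in [A] sees only the continuity within [A]. *)
Lemma within_comp (T T' : topologicalType) (A : set T) (f : T -> T') (g : R -> T) :
  {within A, continuous f} -> continuous g -> (forall x, A (g x)) ->
  continuous (f \o g).
Proof.
move=> /subspace_continuousP cf cg Ag x; have H := cf (g x) (Ag x).
apply: (cvg_comp _ _ _ H) => U; rewrite /within /= => /(cg x) h.
have h' : nbhs x [set t | A (g t) -> U (g t)] by [].
by apply: (filterS _ h') => t; apply; exact: Ag.
Qed.

(** Move [c] slightly towards the midpoint. *)
Lemma closure_itv (a b c : R) : a < b -> a <= c <= b -> closure (`]a, b[%classic : set R) c.
Proof.
move=> ab /andP[ac cb] V /nbhs_ballP[e /= e0 eV].
pose d := Num.min (1 / 2) (e / (2 * (b - a))).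
have ba : 0 < b - a by lra.
have d0 : 0 < d by rewrite lt_min divr_gt0//= divr_gt0// mulr_gt0.
have d1 : d <= 1 / 2 by rewrite ge_min lexx.
have d2 : d * (b - a) <= e / 2.
  have : d <= e / (2 * (b - a)) by rewrite ge_min lexx orbT.
  by rewrite ler_pdivlMr ?mulr_gt0// => ?; lra.
exists (c + d * ((a + b) / 2 - c)); split.
  by rewrite /= in_itv /=; apply/andP; split; nra.
by apply: eV; rewrite /ball /= ltr_norml; apply/andP; split; nra.
Qed.

Lemma closure_seg A j a b y : a < b -> on_seg A j a b y ->
  forall x, closure A (pt j (clip a b x) y).
Proof.
move=> ab h x; apply: (@closure_pt `]a, b[%classic); last first.
  by move=> t /=; rewrite in_itv; exact: h.
by apply: closure_itv => //; exact/clip_in/ltW.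
Qed.

(** The clipped segment stays in the closure of [S]. *)
Lemma tame_within S E (f : plane R -> R) :
  {within closure S, continuous f} -> tame S E f.
Proof.
move=> cf j a b y ab _ hS; exists (f \o (fun x => pt j (clip a b x) y)).
  apply: within_comp cf _ _; last exact: closure_seg.
  by move=> x; apply: (continuous_comp (f := clip a b) (g := pt j ^~ y)); [exact: clip_continuous|exact: pt_continuous].
by move=> x /andP[? ?] /=; rewrite clip_id// !ltW.
Qed.

(** A segment that avoids the interfaces stays in the piece of its midpoint,
    because it can leave no piece. *)
Lemma tame_pieces S E k m (P : 'I_m -> set (plane R)) (kappa : 'I_m -> plane R -> R) :
  S = \bigcup_i P i ->
  (forall i, [/\ S `&` closure (P i) `&` closure (S `\` P i) `<=` E,
     {within closure (P i), continuous (kappa i)} & forall x, P i x -> k x = kappa i x]) ->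
  tame S E k.
Proof.
move=> SE hP j a b y ab nE hS.
pose z := (a + b) / 2; have zab : a < z < b by rewrite /z; lra.
have := hS _ zab; rewrite SE => -[i _ Piz].
have [thin ck kE] := hP i.
have [|hi|] := @interval_dichotomy a b (fun x => a < x < b -> P i (pt j x y)); last first.
- by move=> /(_ z zab); case.
- have hi' : on_seg (P i) j a b y by move=> x xab; exact: hi.
  have [kp ckp kpE] := tame_within (E := E) ck ab nE hi'.
  by exists kp => // x xab; rewrite kE ?kpE//; exact: hi'.
- move=> x xab [c1 c2]; apply: (nE _ xab); apply: thin; split; first split.
  - exact: hS.
  - move=> V /(pt_continuous (j := j) (y := y)) nV.
    have nI : nbhs x [set t | a < t < b] by apply: near_in_itvoo; rewrite in_itv.
    have nV' : nbhs x ((pt j ^~ y) @^-1` V) by [].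
    have [t [h [Vt tab]]] := c1 _ (filterI nV' nI); exists (pt j t y); split => //.
    exact: h.
  - apply: (closure_pt c2) => t /= /not_implyP[tab nP]; split => //; exact: hS.
Qed.

End Segments.

(** * Rectifiable exceptional sets *)

Section Rectifiable.
Context {R : realType}.
Implicit Types (A B : set (plane R)).

Lemma rectifiable_sub A B : A `<=` B -> rectifiable B -> rectifiable A.
Proof.
by move=> AB [m [C [hC BC]]]; exists m, C; split => //; exact: subset_trans BC.
Qed.

Lemma rectifiable0 : rectifiable (set0 : set (plane R)).
Proof. by exists 0, (fun _ _ => 0); split => [[]|]. Qed.

Lemma rectifiableU A B : rectifiable A -> rectifiable B -> rectifiable (A `|` B).
Proof.
move=> [m [C [hC AC]]] [m' [C' [hC' BC]]].
exists (m + m')%N, (fun i => match fintype.split i with inl i => C i | inr i => C' i end); split.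
  by move=> i; case: (fintype.split i) => ?.
move=> x [/AC[i _ Cx]|/BC[i _ Cx]].
  by exists (lshift m' i) => //; rewrite (unsplitK (inl i)).
by exists (rshift m i) => //; rewrite (unsplitK (inr i)).
Qed.

Lemma rectifiable_bigcup m (A : 'I_m -> set (plane R)) :
  (forall i, rectifiable (A i)) -> rectifiable (\bigcup_i A i).
Proof.
elim: m A => [A _|m IH A rA].
  by apply: rectifiable_sub rectifiable0 => x [[]].
apply: rectifiable_sub (rectifiableU (rA ord0) (IH (fun i => A (lift ord0 i)) _)) => //.
move=> x [i _ Ax]; case: (unliftP ord0 i) Ax => [i' ->|->] Ax; last by left.
by right; exists i'.
Qed.

Lemma tame_piecewise (S : set (plane R)) k :
  piecewise_continuous rectifiable S k -> exists2 E, rectifiable E & tame S E k.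
Proof.
move=> [m [P [kappa [SE hP]]]].
exists (\bigcup_i (S `&` closure (P i) `&` closure (S `\` P i))).
  by apply: rectifiable_bigcup => i; have [] := hP i.
apply: (tame_pieces (kappa := kappa) SE) => i; have [_ ? ?] := hP i; split => //.
by move=> x ?; exists i.
Qed.

End Rectifiable.

(** * Banach indicatrix of a rectifiable set *)

Section Indicatrix.
Context {R : realType}.
Local Notation leb := (@lebesgue_measure R).
Implicit Types (c : R -> R) (A : set (plane R)).

(** The coordinate that is constant on the line of direction [j]. *)
Definition offset (j : bool) (x : plane R) : R := if j then x.2 else x.1.

Lemma choice_fun (X Y : Type) (P : X -> Y -> Prop) :
  (forall x, exists y, P x y) -> exists f : X -> Y, forall x, P x (f x).
Proof. by move=> /choice[f hf]; exists f. Qed.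

(** Used with the subdivision of the parameter interval of a curve into [N + 1]
    arcs. *)
Lemma grid_point (N : nat) (t : R) : 0 <= t <= 1 ->
  exists p : 'I_N.+1, `|t - p%:R / N.+1%:R| <= N.+1%:R^-1.
Proof.
move=> /andP[t0 t1]; have N0 : 0 < N.+1%:R :> R by rewrite ltr0n.
have [t1'|t1'] := ltP t 1.
  have tN : 0 <= t * N.+1%:R by rewrite mulr_ge0// ltW.
  have /andP[l1 l2] := truncn_itv tN.
  have pN : (Num.trunc (t * N.+1%:R) < N.+1)%N.
    rewrite -(ltr_nat R); apply: le_lt_trans l1 _.
    by rewrite gtr_pMl.
  exists (Ordinal pN) => /=; set q := Num.trunc _ in l1 l2 *.
  have -> : t - q%:R / N.+1%:R = (t * N.+1%:R - q%:R) / N.+1%:R.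
    by rewrite mulrBl mulfK ?gt_eqF.
  rewrite normrM (@ger0_norm _ (N.+1%:R^-1)) ?invr_ge0 ?ltW//.
  rewrite -[ltRHS]mul1r ltr_pM2r ?invr_gt0//.
  by rewrite ltr_norml; rewrite -natr1 in l2; apply/andP; split; lra.
exists ord_max; have -> : t = 1 by lra.
have -> : 1 - (@ord_max N)%:R / N.+1%:R = N.+1%:R^-1 :> R.
  have N1 : N.+1%:R != 0 :> R by rewrite gt_eqF.
  by rewrite -[X in X - _](divff N1) -mulrBl /= -{1}natr1 addrC addKr mul1r.
have : 0 <= (N.+1%:R^-1 : R) by rewrite invr_ge0 ltW.
by move/ger0_norm ->.
Qed.

(** The number of subdivision points [p / (N + 1)] whose arc may meet the line of
    offset [y]: an arc of length [1 / (N + 1)] moves the offset by at most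
    [L / (N + 1)]. *)
Definition cover_count c (L : R) (N : nat) (y : R) : R :=
  \sum_(p < N.+1) \1_(`[c (p%:R / N.+1%:R) - L / N.+1%:R,
                       c (p%:R / N.+1%:R) + L / N.+1%:R]%classic) y.

(** Parameters that are further than [2 / (N + 1)] apart have different nearest
    subdivision points. *)
Lemma cover_count_ge c (L : R) N (ts : seq R) y : 0 <= L ->
  (forall t u, 0 <= t <= 1 -> 0 <= u <= 1 -> `|c t - c u| <= L * `|t - u|) ->
  uniq ts -> (forall t, t \in ts -> 0 <= t <= 1 /\ c t = y) ->
  (forall t u, t \in ts -> u \in ts -> t != u -> 2 / N.+1%:R < `|t - u|) ->
  (size ts)%:R <= cover_count c L N y.
Proof.
move=> L0 lip uts hts sep.
have N0 : 0 < N.+1%:R :> R by rewrite ltr0n.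
have /choice_fun[p hp] : forall t : R, exists p : 'I_N.+1, 0 <= t <= 1 -> `|t - p%:R / N.+1%:R| <= N.+1%:R^-1.
  move=> t; have [/grid_point-/(_ N)[p hp]|nt] := boolP (0 <= t <= 1).
    by exists p.
  by exists ord0.
have ups : uniq (map p ts).
  rewrite map_inj_in_uniq// => t u tts uts' ptu; apply/eqP; apply: contraT => /(sep _ _ tts uts').
  have [t01 _] := hts _ tts; have [u01 _] := hts _ uts'.
  move: (hp _ t01) (hp _ u01); rewrite ptu; set a := _ / _; set d := N.+1%:R^-1 => h1 h2.
  rewrite ltNge (_ : `|t - u| <= 2 * d)//.
  have -> : t - u = (t - a) - (u - a) by ring.
  by apply: le_trans (ler_normB _ _) _; lra.
have <- : size (map p ts) = size ts by rewrite size_map.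
rewrite -(card_uniqP ups) -sum1_card natr_sum /cover_count [X in X <= _]big_mkcond /=.
apply: ler_sum => q _; case: ifPn => [|_]; last by rewrite indicE.
move=> /mapP[t tts ->]; have [t01 <-] := hts _ tts.
have q01 : 0 <= ((p t)%:R / N.+1%:R : R) <= 1.
  by rewrite divr_ge0//= ler_pdivrMr// mul1r ler_nat ltnW.
have := lip _ _ t01 q01; have := hp _ t01; set a := _%:R / _ => h1 h2.
rewrite indicE mem_set//= in_itv /=.
have : `|c t - c a| <= L / N.+1%:R by apply: le_trans h2 _; exact: ler_wpM2l.
rewrite ler_norml; move: (L / N.+1%:R) => d' /andP[? ?]; apply/andP; split; lra.
Qed.

Lemma positive_lower_bound (s : seq R) : (forall x, x \in s -> 0 < x) ->
  exists2 d : R, 0 < d & forall x, x \in s -> d <= x.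
Proof.
elim: s => [_|a s IH h]; first by exists 1.
have [x xs|d d0 hd] := IH; first by apply: h; rewrite inE xs orbT.
exists (Num.min a d); first by rewrite lt_min d0 h// mem_head.
by move=> x; rewrite inE ge_min => /predU1P[->|/hd ->]; rewrite ?lexx ?orbT.
Qed.

Lemma uniform_gap (s : seq R) : exists2 d : R, 0 < d &
  forall t u, t \in s -> u \in s -> t != u -> d <= `|t - u|.
Proof.
have [x|d d0 hd] := @positive_lower_bound [seq x <- [seq `|t - u| | t <- s, u <- s] | 0 < x].
  by rewrite mem_filter => /andP[].
exists d => // t u ts us tu; apply: hd; rewrite mem_filter normr_gt0 subr_eq0 tu /=.
by apply/allpairsP; exists (t, u).
Qed.

Lemma ge_limn_einf (u : (\bar R)^nat) (a : \bar R) (N : nat) :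
  (forall n, (N <= n)%N -> (a <= u n)%E) -> (a <= limn_einf u)%E.
Proof.
move=> h; rewrite limn_einf_lim (cvg_lim _ (@cvg_einfs_sup _ u))//.
apply: le_trans (ereal_sup_ubound (ex_intro2 _ _ N I erefl)).
by apply: le_ereal_inf_tmp => _ [n /= Nn <-]; exact: h.
Qed.

Lemma measurable_cover_count c L N : measurable_fun setT (cover_count c L N : measurableTypeR R -> R).
Proof.
apply: measurable_sum => p; apply: measurable_indic; exact: measurable_itv.
Qed.

Lemma leb_itvcc (a b : R) : a <= b -> leb (`[a, b]%classic : set R) = (b - a)%:E.
Proof.
move=> ab; rewrite lebesgue_measure_itv /= lte_fin; case: ifPn => // h.
by congr EFin; move: h; rewrite -leNgt => h; lra.
Qed.

(** Every one of the [N + 1] terms contributes [2 L / (N + 1)]. *)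
Lemma integral_cover_count c (L : R) N : 0 <= L ->
  (\int[leb]_y (cover_count c L N y)%:E = (2 * L)%:E)%E.
Proof.
move=> L0; have N0 : 0 < N.+1%:R :> R by rewrite ltr0n.
under eq_integral do rewrite /cover_count -sumEFin.
rewrite ge0_integral_sum//; last first.
  move=> p; apply/measurable_EFinP; apply: measurable_indic; exact: measurable_itv.
rewrite (eq_bigr (fun _ => (2 * L / N.+1%:R)%:E)); last first.
  move=> p _; rewrite integral_indic//.
  have : 0 <= L / N.+1%:R by rewrite divr_ge0// ltW.
  rewrite -mulrA setIT; move: (L / N.+1%:R) => d d0.
  by apply: etrans (leb_itvcc _) _; [lra|congr EFin; ring].
by rewrite sumEFin sumr_const card_ord -[_ *+ N.+1]mulr_natr divfK ?gt_eqF.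
Qed.

(** The crossing counts of finer and finer subdivisions eventually dominate any
    finite number of crossings, while their integrals stay equal to [2 L]; by
    the Fatou lemma their inferior limit is integrable. *)
Lemma curve_indicatrix (c : R -> R) (L : R) : 0 <= L ->
  (forall t u, 0 <= t <= 1 -> 0 <= u <= 1 -> `|c t - c u| <= L * `|t - u|) ->
  exists D : measurableTypeR R -> \bar R, [/\ measurable_fun setT D, forall y, (0 <= D y)%E,
    (\int[leb]_y D y < +oo)%E &
    forall y (ts : seq R), uniq ts -> (forall t, t \in ts -> 0 <= t <= 1 /\ c t = y) ->
     (((size ts)%:R)%:E <= D y)%E].
Proof.
move=> L0 lip; exists (fun y => limn_einf (fun N => (cover_count c L N y)%:E)).
have mc N : measurable_fun setT (fun y : measurableTypeR R => (cover_count c L N y)%:E).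
  by apply/measurable_EFinP; exact: measurable_cover_count.
have c0 N y : (0 <= (cover_count c L N y)%:E)%E.
  by rewrite lee_fin; apply: sumr_ge0 => p _; rewrite indicE.
split.
- rewrite /limn_einf; apply: measurableT_comp => //.
  apply: measurable_fun_limn_esup => N; exact: measurableT_comp.
- by move=> y; apply: (@ge_limn_einf _ _ 0) => n _; exact: c0.
- apply: le_lt_trans (fatou _ _ _ _) _ => //.
  rewrite (_ : (fun n => _) = cst (2 * L)%:E); last first.
    by apply/funext => N; rewrite integral_cover_count.
  by rewrite limn_einf_lim (cvg_lim _ (cvg_einfs (cvg_cst _)))// ltry.
- move=> y ts uts hts; have [d d0 hd] := uniform_gap ts.
  have [N hN] : exists N : nat, 2 / d < N%:R.
    by exists (Num.trunc (2 / d)).+1; exact: truncnS_gt.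
  apply: (@ge_limn_einf _ _ N) => n Nn; rewrite lee_fin.
  apply: cover_count_ge => // t u tts uts' tu; apply: lt_le_trans (hd _ _ tts uts' tu).
  rewrite ltr_pdivrMr ?ltr0n// mulrC -ltr_pdivrMr//; apply: lt_le_trans hN _.
  by rewrite ler_nat ltnW.
Qed.

(** Sum of the indicatrices of the finitely many curves; every point of the line
    is charged to one curve and one parameter. *)
Lemma rectifiable_indicatrix A j : rectifiable A ->
  exists D : measurableTypeR R -> \bar R, [/\ measurable_fun setT D, forall y, (0 <= D y)%E,
    (\int[leb]_y D y < +oo)%E &
    forall y (l : seq R), uniq l -> (forall x, x \in l -> A (pt j x y)) ->
     (((size l)%:R)%:E <= D y)%E].
Proof.
move=> [m [C [hC AC]]].
have /choice_fun[D hD] : forall i, exists D : measurableTypeR R -> \bar R, [/\ measurable_fun setT D, forall y, (0 <= D y)%E,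
    (\int[leb]_y D y < +oo)%E &
    forall y (ts : seq R), uniq ts -> (forall t, t \in ts -> 0 <= t <= 1 /\ offset j (C i t) = y) ->
     (((size ts)%:R)%:E <= D y)%E].
  move=> i; have [k lip] := hC i.
  have lip' t u : 0 <= t <= 1 -> 0 <= u <= 1 -> `|offset j (C i t) - offset j (C i u)| <= k * `|t - u|.
    move=> ht hu; have := lip (t, u); rewrite /= !in_itv /= => /(_ (conj ht hu)).
    apply: le_trans; rewrite /offset; case: j; rewrite [X in _ <= X]prod_normE le_max lexx ?orbT//.
  apply: (@curve_indicatrix (fun t => offset j (C i t)) k) => //.
  have := lip' 0 1; rewrite lexx ler01 sub0r normrN normr1 mulr1 => h.
  by have := h isT; rewrite lexx => /(_ isT); apply: le_trans; exact: normr_ge0.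
exists (fun y => \sum_(i < m) D i y)%E.
have mD i : measurable_fun setT (D i) by have [] := hD i.
have D0 i y : (0 <= D i y)%E by have [_ + _ _] := hD i; exact.
split.
- exact: emeasurable_sum.
- by move=> y; apply: sume_ge0 => i _; exact: D0.
- rewrite ge0_integral_sum//; apply: lte_sum_pinfty => i _.
  by have [] := hD i.
- move=> y l ul hl.
  have /choice_fun[it hit] : forall x, exists it : 'I_m.+1 * R, x \in l -> exists i : 'I_m,
      [/\ nat_of_ord it.1 = i, 0 <= it.2 <= 1 & C i it.2 = pt j x y].
    move=> x; have [xl|] := boolP (x \in l); last by exists (ord0, 0).
    have [i _ [t /= t01 Ct]] := AC _ (hl _ xl).
    exists (widen_ord (leqnSn m) i, t) => _; by exists i; split.
  pose li (i : 'I_m) := [seq x <- l | nat_of_ord (it x).1 == i].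
  have -> : size l = (\sum_(i < m) size (li i))%N.
    rewrite /li; under eq_bigr do rewrite size_filter -sum1_count.
    rewrite (exchange_big_dep predT)//= -sum1_size; apply: eq_big_seq => x xl.
    have [i [iE _ _]] := hit _ xl.
    by rewrite (big_pred1 i)// => i' /=; rewrite iE eq_sym.
  rewrite natr_sum -sumEFin; apply: lee_sum => i _.
  have [_ _ _] := hD i => /(_ y [seq (it x).2 | x <- li i]); rewrite size_map; apply.
    rewrite map_inj_in_uniq ?filter_uniq// => x x'; rewrite !mem_filter => /andP[/eqP ix xl] /andP[/eqP ix' xl'].
    have [i1 [i1E _ C1]] := hit _ xl; have [i2 [i2E _ C2]] := hit _ xl' => tt.
    have i12 : i1 = i2 by apply: val_inj; rewrite /= -i1E -i2E ix ix'.
    by move: C1 C2; rewrite i12 tt => ->; case: (j) => -[].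
  move=> t /mapP[x]; rewrite mem_filter => /andP[/eqP ix xl] ->.
  have [i1 [i1E h C1]] := hit _ xl; split => //.
  have <- : i1 = i by apply: val_inj; rewrite /= -i1E ix.
  by rewrite C1 /offset /pt; case: (j).
Qed.

End Indicatrix.

(** * Integrals of bounded functions *)

Section IntegralTools.
Context d (T : measurableType d) (R : realType) (mu : {measure set T -> \bar R}).
Implicit Types (D : set T) (f g : T -> R).

Lemma bounded_integrable D f (C : R) : measurable D -> (mu D < +oo)%E ->
  measurable_fun D f -> (forall x, D x -> `|f x| <= C) -> mu.-integrable D (EFin \o f).
Proof.
move=> mD fD mf bf; apply: measurable_bounded_integrable => //.
exists C; split; first exact: num_real.
by move=> x Cx y /bf h; apply: le_trans h _; exact: ltW.
Qed.

Lemma Rintegral_abs_le D f g : measurable D -> measurable_fun D f ->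
  mu.-integrable D (EFin \o g) -> (forall x, D x -> `|f x| <= g x) ->
  `|\int[mu]_(x in D) f x| <= \int[mu]_(x in D) g x.
Proof.
move=> mD mf ig fg.
have if_ : mu.-integrable D (EFin \o f).
  apply: le_integrable ig => //; first exact/measurable_EFinP.
  by move=> x Dx /=; rewrite lee_fin; apply: le_trans (fg _ Dx) (ler_norm _).
apply: le_trans (le_normr_Rintegral mD if_) _.
apply: le_Rintegral => //; apply: le_integrable if_ => //.
  by apply/measurable_EFinP; exact: measurableT_comp.
by move=> x Dx /=; rewrite normr_id.
Qed.

End IntegralTools.

(** * Transversal zeros on a line *)

Section OneDim.
Context {R : realType}.
Local Notation leb := (@lebesgue_measure R).

(** The epsilon form in which the limits at [0] from the right are established. *)
Lemma cvg_right0 (F : R -> R) (l : R) :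
  (forall e, 0 < e -> exists2 s0, 0 < s0 & forall s, 0 < s < s0 -> `|l - F s| <= e) ->
  F s @[s --> 0^'+] --> l.
Proof.
move=> h; apply/cvgrPdist_le => e e0; have [s0 s00 hs] := h e e0.
exists s0 => //= s; rewrite /ball /= sub0r normrN => ss0 s_gt0.
by apply: hs; rewrite s_gt0 -(gtr0_norm s_gt0).
Qed.

(** The common features of [heaviside (h + u) - heaviside (h - u)] and of the
    rescaled approximate delta. The values on [|h| = |u|] are left free, since
    the two differ there. *)
Definition jump_kernel (K : R -> R -> R) := [/\ forall h u, `|K h u| <= 1,
  forall h u, `|h| < u -> K h u = 1, forall h u, `|h| < - u -> K h u = -1,
  forall h u, `|u| < `|h| -> K h u = 0 &
  measurable_fun [set: mplane R] (fun z => K z.1 z.2)].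

Lemma measurable_fun_kernel d (T : measurableType d) (K : R -> R -> R) (D : set T) (f g : T -> R) :
  jump_kernel K -> measurable_fun D f -> measurable_fun D g ->
  measurable_fun D (fun x => K (f x) (g x)).
Proof.
move=> [_ _ _ _ mK] mf mg mD.
have mf' := (measurable_restrictT f mD).1 mf; have mg' := (measurable_restrictT g mD).1 mg.
have mfg : measurable_fun setT (fun x => ((f \_ D) x, (g \_ D) x) : mplane R).
  exact: (@measurable_fun_pair _ _ _ T (measurableTypeR R) (measurableTypeR R)).
have mc : measurable_fun setT ((fun z : mplane R => K z.1 z.2) \o (fun x => ((f \_ D) x, (g \_ D) x) : mplane R)).
  exact: measurableT_comp mK mfg.
move: mD; apply: (eq_measurable_fun _ _ (measurable_funTS mc)) => x xD /=.
by rewrite !patchE xD.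
Qed.

Lemma EVT_norm (f : R -> R) (a b : R) : a <= b -> continuous f ->
  (exists2 c, a <= c <= b & forall x, a <= x <= b -> `|f x| <= `|f c|) /\
  (exists2 c, a <= c <= b & forall x, a <= x <= b -> `|f c| <= `|f x|).
Proof.
move=> ab cf; have cn : {within `[a, b], continuous (fun x => `|f x|)}.
  by apply: continuous_subspaceT => x; apply: continuous_comp; [exact: cf|exact: norm_continuous].
by split; [have [c cab h] := EVT_max ab cn|have [c cab h] := EVT_min ab cn];
  exists c; move=> // x xab; apply: h; rewrite in_itv.
Qed.

Lemma itv_finite (a b : R) : (leb `]a, b[%classic < +oo)%E.
Proof. by rewrite lebesgue_measure_itv /=; case: ifP => _; rewrite ltry. Qed.

Definition centered_itv (c r : R) : set R := `[c - r, c + r]%classic.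

Lemma ivP c r x : centered_itv c r x <-> `|x - c| <= r.
Proof. by rewrite /centered_itv /= in_itv /= ler_norml; split => /andP[? ?]; apply/andP; split; lra. Qed.

(** Turns an indicator into a truth value, on which one can compute. *)
Lemma indic_iv c r x : \1_(centered_itv c r) x = (`|x - c| <= r)%R%:R :> R.
Proof.
rewrite indicE; case: (leP `|x - c| r) => h.
  by rewrite mem_set//; apply/ivP.
by rewrite memNset// => /ivP; rewrite leNgt h.
Qed.

Lemma itv_integrable (a b : R) (f : R -> R) (C : R) : measurable_fun `]a, b[%classic f ->
  (forall x, a < x < b -> `|f x| <= C) ->
  leb.-integrable `]a, b[%classic (EFin \o f).
Proof.
move=> mf hf; apply: (@bounded_integrable _ _ _ _ _ _ C) => //; first exact: itv_finite.
Qed.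

Lemma integrable_iv (a b c r : R) :
  leb.-integrable `]a, b[%classic (EFin \o (\1_(centered_itv c r) : R -> R)).
Proof.
apply: (@itv_integrable _ _ _ 1).
  by apply: measurable_indic; exact: measurable_itv.
by move=> x _; rewrite indicE; case: (_ \in _); rewrite ?normr1 ?normr0.
Qed.

Lemma leb_iv c r : 0 <= r -> (leb (centered_itv c r) = (2 * r)%:E)%E.
Proof. by move=> r0; rewrite leb_itvcc; [congr EFin; ring|lra]. Qed.

Lemma Rintegral_iv_le a b c r : 0 <= r ->
  \int[leb]_(x in `]a, b[%classic) (\1_(centered_itv c r) x) <= 2 * r.
Proof.
move=> r0; rewrite /Rintegral integral_indic//; last exact: measurable_itv.
have h := leb_iv c r0.
have l : (leb (centered_itv c r `&` `]a, b[) <= (2 * r)%:E)%E.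
  rewrite -h; apply: le_measure; rewrite ?inE//; [|exact: measurable_itv].
  by apply: measurableI => //; exact: measurable_itv.
rewrite -[leRHS]/(fine (2 * r)%:E); apply: fine_le => //.
by rewrite ge0_fin_numE//; apply: le_lt_trans l _; rewrite ltry.
Qed.

Section Crossing.
Variables (a b m : R) (h dh : R -> R).
Hypotheses (ab : a < b) (m0 : 0 < m) (ch : continuous h) (cdh : continuous dh).
Hypothesis hd : forall x, a < x < b -> is_derive x 1 h (dh x).
Hypothesis hm : forall x, m <= `|dh x|.

Lemma mean_slope x y : a <= x -> x <= y -> y <= b ->
  exists2 c, x <= c <= y & h y - h x = dh c * (y - x).
Proof.
move=> ax xy yb; have [||c] := @MVT_segment R h dh x y xy.
- move=> t; rewrite in_itv /= => /andP[xt ty]; apply: hd; apply/andP; split; lra.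
- exact: continuous_subspaceT.
by rewrite in_itv /= => ? ?; exists c.
Qed.

Lemma mean_slope2 x z : a <= x <= b -> a <= z <= b ->
  exists2 c, `|c - z| <= `|x - z| & h x - h z = dh c * (x - z).
Proof.
move=> /andP[ax xb] /andP[az zb]; have [xz|zx] := leP x z.
  have [c /andP[xc cz] E] := mean_slope ax xz zb; exists c; last by rewrite -opprB E; ring.
  by rewrite !ler0_norm; lra.
have [c /andP[zc cx] E] := mean_slope az (ltW zx) xb; exists c => //.
by rewrite !ger0_norm; lra.
Qed.

(** By the mean value theorem; so [h] has at most one zero on the segment. *)
Lemma expanding x z : a <= x <= b -> a <= z <= b -> m * `|x - z| <= `|h x - h z|.
Proof.
move=> hx hz; have [c _ ->] := mean_slope2 hx hz.
by rewrite normrM ler_wpM2r.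
Qed.

(** The layer [|h| <= t] has diameter at most [2 t / m], hence lies in an interval
    of length [4 t / m] around any of its points. *)
Lemma band_bound (G : R -> R) (C t : R) : 0 <= C -> 0 <= t ->
  measurable_fun `]a, b[%classic G ->
  (forall x, a < x < b -> `|G x| <= C) -> (forall x, a < x < b -> t < `|h x| -> G x = 0) ->
  `|\int[leb]_(x in `]a, b[%classic) G x| <= C * (4 * t / m).
Proof.
move=> C0 t0 mG GC G0.
have [[z zab hz]|none] := pselect (exists2 z, a < z < b & `|h z| <= t); last first.
  rewrite (_ : \int[_]_(x in _) _ = 0) ?normr0.
    by rewrite mulr_ge0// divr_ge0 ?(ltW m0)// mulr_ge0.
  rewrite (@eq_Rintegral _ _ _ _ _ (fun=> 0)); last first.
    move=> x; rewrite inE /= in_itv /= => xab; apply: G0 => //; rewrite ltNge.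
    by apply/negP => hx; apply: none; exists x.
  by rewrite Rintegral_cst// mul0r.
have tm0 : 0 <= 2 * t / m by rewrite divr_ge0 ?(ltW m0)// mulr_ge0.
apply: (@le_trans _ _ (\int[leb]_(x in `]a, b[%classic) (C * \1_(centered_itv z (2 * t / m)) x))).
  apply: Rintegral_abs_le => //.
    apply: (@itv_integrable _ _ _ C).
      by apply: measurable_funM => //; apply: measurable_indic; exact: measurable_itv.
    by move=> x _; rewrite indic_iv normrM (ger0_norm C0); case: (`|x - z| <= _); rewrite /= ?normr1 ?normr0 ?mulr1 ?mulr0.
  move=> x; rewrite /= in_itv /= => xab; rewrite indic_iv; case: (leP `|x - z| (2 * t / m)) => hx.
    by rewrite mulr1; exact: GC.
  rewrite mulr0 G0 ?normr0//.
  have ex : m * `|x - z| <= `|h x - h z|.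
    by apply: expanding; apply/andP; split; lra.
  have : 2 * t < m * `|x - z| by rewrite [m * _]mulrC -ltr_pdivrMr.
  have := ler_normB (h x) (h z); lra.
rewrite RintegralZl//; last exact: integrable_iv.
apply: ler_wpM2l => //; apply: le_trans (Rintegral_iv_le _ _ _ tm0) _.
by rewrite -mulrA; lra.
Qed.

(** Near the zero [z] one has [h x ~ h' z * (x - z)] and [w x ~ w z], so that
    [K (h x) (s * w x)] should be the sign of [w z] on the interval of radius
    [s |w z| / |h' z|] around [z] and [0] outside. With [eta] the modulus of
    continuity at scale [s * rho], it can fail only in two bands around the
    endpoints, whose width is of order [eta * s]. *)
Lemma near_zero_estimate (K : R -> R -> R) (q w : R -> R) (z eta rho s x : R) :
  jump_kernel K -> a <= z <= b -> h z = 0 -> 0 < eta -> 0 < s ->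
  (forall c, `|c - z| <= s * rho -> `|dh c - dh z| <= eta) ->
  (`|x - z| <= s * rho -> `|w x - w z| <= eta /\ `|q x - q z| <= eta) ->
  `|w x| <= m * rho -> `|w z| <= m * rho -> a < x < b ->
  `|q x * K (h x) (s * w x) - q z * Num.sg (w z) * \1_(centered_itv z (s * `|w z| / `|dh z|)) x|
  <= eta * \1_(centered_itv z (s * rho)) x + 2 * `|q z| *
     (\1_(centered_itv (z + s * `|w z| / `|dh z|) (s * (eta * (rho + 1) / `|dh z|))) x +
      \1_(centered_itv (z - s * `|w z| / `|dh z|) (s * (eta * (rho + 1) / `|dh z|))) x).
Proof.
move=> [K1 Kp Kn K0 mK] zab hz e0 s0 hdh hwq wx wz xab.
have P0 : 0 < `|dh z| by exact: lt_le_trans m0 (hm z).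
set P : R := `|dh z| in P0 *; set W : R := `|w z| in wz *; set sig := s * W / P; set kap := s * (eta * (rho + 1) / P).
have W0 : 0 <= W by exact: normr_ge0.
have xab' : a <= x <= b by lra.
have ex : m * `|x - z| <= `|h x| by have := expanding xab' (_ : a <= z <= b); rewrite hz subr0; apply.
have Psig : P * sig = s * W by rewrite /sig mulrC divfK ?gt_eqF.
have Pkap : P * kap = s * (eta * (rho + 1)) by rewrite /kap mulrC -!mulrA mulVf ?mulr1// gt_eqF.
have sigrho : sig <= s * rho.
  rewrite /sig ler_pdivrMr// -mulrA ler_pM2l//; apply: (le_trans wz).
  rewrite mulrC; apply: ler_wpM2l; last exact: hm.
  by rewrite -(pmulr_rge0 _ m0); exact: le_trans W0 wz.
have rho0 : 0 <= rho by rewrite -(pmulr_rge0 _ m0); exact: le_trans W0 wz.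
have ind0 c r : 0 <= \1_(centered_itv c r) x :> R by rewrite indicE.
(* Far from the zero, [|h x|] exceeds [s |w x|] and both terms vanish. *)
have [far|near] := ltP (s * rho) `|x - z|.
  rewrite K0; last first.
    rewrite normrM (gtr0_norm s0); apply: lt_le_trans ex.
    apply: (@le_lt_trans _ _ (s * (m * rho))); first by rewrite ler_pM2l.
    by rewrite mulrCA ltr_pM2l.
  have -> : \1_(centered_itv z sig) x = 0 :> R by rewrite indic_iv leNgt (le_lt_trans sigrho far).
  rewrite !mulr0 subrr normr0.
  by rewrite addr_ge0 ?mulr_ge0 ?addr_ge0 ?(ltW e0).
have [hw hq] := hwq near.
rewrite (indic_iv z (s * rho)) near mulr1.
have -> : q x * K (h x) (s * w x) - q z * Num.sg (w z) * \1_(centered_itv z sig) x =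
  (q x - q z) * K (h x) (s * w x) + q z * (K (h x) (s * w x) - Num.sg (w z) * \1_(centered_itv z sig) x) by ring.
apply: le_trans (ler_normD _ _) _; apply: lerD.
  by rewrite normrM -[leRHS]mulr1; apply: ler_pM.
rewrite normrM [2 * _]mulrC -mulrA; apply: ler_wpM2l => //.
set d : R := `|x - z| in ex near *.
have d0 : 0 <= d by exact: normr_ge0.
have two : `|K (h x) (s * w x) - Num.sg (w z) * \1_(centered_itv z sig) x| <= 2.
  apply: le_trans (ler_normB _ _) _; have -> : 2 = 1 + 1 :> R by ring.
  apply: lerD => //; rewrite normrM normr_sg indicE.
  rewrite normr_nat -natrM -[leRHS]/(1%:R) ler_nat.
  by case: (w z != 0); case: (_ \in _).
have hd1 : `| `|h x| - P * d| <= eta * (s * rho).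
  have [c cz hE] := mean_slope2 xab' zab.
  move: hE; rewrite hz subr0 => ->; rewrite normrM -/d -mulrBl normrM (ger0_norm d0).
  apply: ler_pM => //; apply: le_trans (ler_dist_dist _ _) _; apply: hdh.
  by apply: le_trans cz near.
have hw1 : `| `|s * w x| - s * W| <= s * eta.
  rewrite normrM (gtr0_norm s0) -mulrBr normrM (gtr0_norm s0) ler_pM2l//.
  by apply: le_trans (ler_dist_dist _ _) hw.
(* [sig] is the radius of the model interval, [kap] the half-width of the two
   bands where the kernel is not determined. *)
case: (leP `|d - sig| kap) => [inband|off].
  suff : 1 <= \1_(centered_itv (z + sig) kap) x + \1_(centered_itv (z - sig) kap) x :> R by lra.
  rewrite !indic_iv.
  have [zx|xz] := leP z x.
    have -> : `|x - (z + sig)| <= kap.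
      rewrite (_ : x - (z + sig) = x - z - sig); last by ring.
      by move: inband; rewrite /d (@ger0_norm _ (x - z)) ?subr_ge0.
    by rewrite lerDl ler0n.
  have -> : `|x - (z - sig)| <= kap.
    rewrite -normrN (_ : - (x - (z - sig)) = - (x - z) - sig); last by ring.
    by move: inband; rewrite /d (@ltr0_norm _ (x - z)) ?subr_lt0.
  by rewrite lerDr ler0n.
suff -> : K (h x) (s * w x) = Num.sg (w z) * \1_(centered_itv z sig) x.
  by rewrite subrr normr0 mulr_ge0// addr_ge0.
rewrite indic_iv -/d.
case/ler_normlP: hd1 => hd1 hd2; case/ler_normlP: hw1 => hw1 hw2.
have [dsig|sigd] := leP d sig; last first.
  rewrite mulr0 K0//.
  have off' : kap < d - sig by move: off; rewrite gtr0_norm// subr_gt0.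
  have : P * kap < P * (d - sig) by rewrite ltr_pM2l.
  rewrite Pkap mulrBr Psig; lra.
rewrite mulr1.
have off' : kap < sig - d by move: off; rewrite ler0_norm ?opprB// subr_le0.
have lt1 : P * kap < P * (sig - d) by rewrite ltr_pM2l.
rewrite Pkap mulrBr Psig in lt1.
have hlt : `|h x| < `|s * w x| by lra.
have Weta : eta < W.
  rewrite -(ltr_pM2l s0); have := mulr_ge0 (ltW P0) d0.
  have := mulr_ge0 (ltW s0) (mulr_ge0 (ltW e0) rho0).
  lra.
move: hw; rewrite ler_norml => /andP[hwa hwb].
case: (ltrgtP (w z) 0) => wz0.
- have WE : W = - w z by rewrite /W ltr0_norm.
  have sw : s * w x < 0 by rewrite pmulr_rlt0//; lra.
  by rewrite ltr0_sg// Kn// -(ltr0_norm sw).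
- have WE : W = w z by rewrite /W gtr0_norm.
  have sw : 0 < s * w x by rewrite pmulr_rgt0//; lra.
  by rewrite gtr0_sg// Kp// -(gtr0_norm sw).
- by move: Weta; rewrite /W wz0 normr0; lra.
Qed.

(** Half of the interval is lost when [z] is an endpoint of the segment. *)
Lemma model_integral (z sig : R) : a <= z <= b -> 0 <= sig ->
  (z < b -> sig < b - z) -> (a < z -> sig < z - a) ->
  \int[leb]_(x in `]a, b[%classic) (\1_(centered_itv z sig) x) =
  sig * ((z < b)%R%:R + (a < z)%R%:R).
Proof.
move=> /andP[az zb] s0 hb ha.
rewrite /Rintegral integral_indic//; last exact: measurable_itv.
have [azz|za] := ltP a z; have [zbb|bz] := ltP z b.
- rewrite (_ : centered_itv z sig `&` _ = centered_itv z sig).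
    by apply: (etrans (congr1 fine (leb_iv z s0))) => /=; ring.
  apply/setIidl => x; rewrite /centered_itv /= !in_itv /=; move: (ha azz) (hb zbb) => ? ? /andP[? ?].
  by apply/andP; split; lra.
- have zE : z = b by lra.
  rewrite (_ : centered_itv z sig `&` _ = `[z - sig, z[%classic).
    apply: (etrans (congr1 fine (lebesgue_measure_itv _))); rewrite /= lte_fin; case: ifPn => [_|]; first by rewrite -EFinB /=; ring.
    by rewrite -leNgt => ?; have -> : sig = 0; [lra|rewrite mul0r].
  apply/seteqP; split => x; rewrite /centered_itv /= !in_itv /=; move: (ha azz) => ?.
    by move=> [/andP[? ?] /andP[? ?]]; apply/andP; split; lra.
  by move=> /andP[? ?]; split; apply/andP; split; lra.
- have zE : z = a by lra.
  rewrite (_ : centered_itv z sig `&` _ = `]z, z + sig]%classic).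
    apply: (etrans (congr1 fine (lebesgue_measure_itv _))); rewrite /= lte_fin; case: ifPn => [_|]; first by rewrite -EFinB /=; ring.
    by rewrite -leNgt => ?; have -> : sig = 0; [lra|rewrite mul0r].
  apply/seteqP; split => x; rewrite /centered_itv /= !in_itv /=; move: (hb zbb) => ?.
    by move=> [/andP[? ?] /andP[? ?]]; apply/andP; split; lra.
  by move=> /andP[? ?]; split; apply/andP; split; lra.
- by move: (lt_le_trans ab (le_trans bz za)); rewrite ltxx.
Qed.

(** Integrate [near_zero_estimate]: both error terms have integral [O(eta * s)],
    and [eta] is arbitrary. *)
Lemma jump_limit_zero (K : R -> R -> R) (q w : R -> R) (z : R) :
  continuous q -> continuous w -> jump_kernel K -> a <= z <= b -> h z = 0 ->
  (2 * s)^-1 * \int[leb]_(x in `]a, b[%classic) (q x * K (h x) (s * w x))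
    @[s --> 0^'+] --> q z * w z / (2 * `|dh z|) * ((z < b)%R%:R + (a < z)%R%:R).
Proof.
move=> cq cw jK zab hz.
have [[cw0 _ wmax] _] := EVT_norm (ltW ab) cw; have [[cq0 _ qmax] _] := EVT_norm (ltW ab) cq.
pose rho := `|w cw0| / m.
have mrho : m * rho = `|w cw0| by rewrite /rho mulrC divfK// gt_eqF.
have rho0 : 0 <= rho by rewrite divr_ge0// ltW.
have wle x : a <= x <= b -> `|w x| <= m * rho.
  by move=> xab; rewrite mrho; apply: wmax.
have P0 : 0 < `|dh z| by exact: lt_le_trans m0 (hm z).
apply: cvg_right0 => e e0.
(* The errors add up to [eta * (C - 1)]. *)
pose C := rho + 4 * `|q z| * (rho + 1) / `|dh z| + 1.
have C0 : 0 < C.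
  by rewrite /C ltr_wpDl// addr_ge0// divr_ge0 ?(ltW P0)// !mulr_ge0// addr_ge0.
pose eta := e / C; have eta0 : 0 < eta by rewrite divr_gt0.
have near_cont (f : R -> R) : continuous f -> exists2 d, 0 < d & forall x, `|x - z| < d -> `|f x - f z| <= eta.
  move=> /(_ z)/cvgrPdist_le/(_ eta eta0)[d /= d0 hd']; exists d => // x xz.
  by rewrite distrC; apply: hd'; rewrite /ball /= distrC.
have [d1 d10 hd1] := near_cont _ cdh; have [d2 d20 hd2] := near_cont _ cw.
have [d3 d30 hd3] := near_cont _ cq.
have [g g0 [gb ga]] : exists2 g, 0 < g & (z < b -> g <= b - z) /\ (a < z -> g <= z - a).
  exists (Num.min (if z < b then b - z else 1) (if a < z then z - a else 1)).
    by rewrite lt_min; apply/andP; split; case: ifP => ?; rewrite ?subr_gt0.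
  by split => [->|->]; rewrite ge_min lexx ?orbT.
pose d := Num.min (Num.min d1 d2) (Num.min d3 g).
have d0 : 0 < d by rewrite !lt_min d10 d20 d30 g0.
have r10 : 0 < rho + 1 by rewrite ltr_wpDl.
exists (d / (rho + 1)); first exact: divr_gt0.
move=> s /andP[s0]; rewrite ltr_pdivlMr// => sd.
have srho : s * rho < d by rewrite mulrDr mulr1 in sd; lra.
have srho0 : 0 <= s * rho by rewrite mulr_ge0// ltW.
have [dd1 dd2 dd3 dg] : [/\ d <= d1, d <= d2, d <= d3 & d <= g].
  by split; rewrite !ge_min lexx ?orbT.
set sig := s * `|w z| / `|dh z|.
have sig0 : 0 <= sig by rewrite !mulr_ge0 ?invr_ge0 ?(ltW P0) ?(ltW s0).
have sigrho : sig <= s * rho.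
  rewrite /sig ler_pdivrMr// -mulrA ler_pM2l//; apply: (le_trans (wle _ zab)).
  by rewrite mulrC; apply: ler_wpM2l => //; exact: hm.
have mI : measurable_fun `]a, b[%classic (fun x => q x * K (h x) (s * w x)).
  apply: measurable_funM.
    by apply: measurable_funTS; exact: continuous_measurable_fun.
  apply: (measurable_fun_kernel jK); apply: measurable_funTS; first exact: continuous_measurable_fun.
  by apply: measurable_funM => //; exact: continuous_measurable_fun.
have mM : measurable_fun `]a, b[%classic (fun x => q z * Num.sg (w z) * \1_(centered_itv z sig) x).
  by apply: measurable_funM => //; apply: measurable_indic; exact: measurable_itv.
have iI : leb.-integrable `]a, b[%classic (EFin \o (fun x => q x * K (h x) (s * w x))).
  apply: (@itv_integrable _ _ _ `|q cq0|) => // x xab; rewrite normrM -[leRHS]mulr1.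
  apply: ler_pM => //; first by apply: qmax; lra.
  by case: jK.
have iM : leb.-integrable `]a, b[%classic (EFin \o (fun x => q z * Num.sg (w z) * \1_(centered_itv z sig) x)).
  apply: (@itv_integrable _ _ _ `|q z * Num.sg (w z)|) => // x _.
  by rewrite normrM indic_iv normr_nat; case: (`|x - z| <= sig); rewrite ?mulr1 ?mulr0.
set kap := s * (eta * (rho + 1) / `|dh z|).
have kap0 : 0 <= kap.
  apply: mulr_ge0; first exact: ltW.
  by apply: divr_ge0; [apply: mulr_ge0; exact: ltW|exact: ltW].
have key : `|\int[leb]_(x in `]a, b[%classic) (q x * K (h x) (s * w x)) -
   \int[leb]_(x in `]a, b[%classic) (q z * Num.sg (w z) * \1_(centered_itv z sig) x)| <=
   eta * (2 * (s * rho)) + 2 * `|q z| * (2 * kap + 2 * kap).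
  rewrite -RintegralB//.
  pose B x := eta * \1_(centered_itv z (s * rho)) x + 2 * `|q z| * (\1_(centered_itv (z + sig) kap) x + \1_(centered_itv (z - sig) kap) x) : R.
  have i1 := integrable_iv a b z (s * rho).
  have i2 := integrable_iv a b (z + sig) kap.
  have i3 := integrable_iv a b (z - sig) kap.
  have mab : measurable (`]a, b[%classic : set (measurableTypeR R)) by exact: measurable_itv.
  have iD (u v : R -> R) : leb.-integrable `]a, b[%classic (EFin \o u) ->
      leb.-integrable `]a, b[%classic (EFin \o v) ->
      leb.-integrable `]a, b[%classic (EFin \o (fun x => u x + v x)).
    by move=> hu hv; exact: (integrableD mab hu hv).
  have iZ (k : R) (u : R -> R) : leb.-integrable `]a, b[%classic (EFin \o u) ->
      leb.-integrable `]a, b[%classic (EFin \o (fun x => k * u x)).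
    by move=> hu; exact: (integrableZl mab k hu).
  have i4 : leb.-integrable `]a, b[%classic
      (EFin \o (fun x => \1_(centered_itv (z + sig) kap) x + \1_(centered_itv (z - sig) kap) x : R)).
    exact: iD i2 i3.
  have i5 : leb.-integrable `]a, b[%classic (EFin \o (fun x => eta * \1_(centered_itv z (s * rho)) x)).
    exact: iZ i1.
  have i6 : leb.-integrable `]a, b[%classic
      (EFin \o (fun x => 2 * `|q z| * (\1_(centered_itv (z + sig) kap) x + \1_(centered_itv (z - sig) kap) x))).
    exact: iZ i4.
  have iB : leb.-integrable `]a, b[%classic (EFin \o B) by exact: iD i5 i6.
  apply: (@le_trans _ _ (\int[leb]_(x in `]a, b[%classic) B x)).
    apply: Rintegral_abs_le => //; first exact: measurable_funB.
    move=> x; rewrite /= in_itv /= => xab; apply: near_zero_estimate => //.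
    - by move=> c hc; apply: hd1; lra.
    - by move=> hx; split; [apply: hd2|apply: hd3]; lra.
    - by apply: wle; lra.
    - exact: wle.
  rewrite /B RintegralD//.
  rewrite !RintegralZl// RintegralD//; apply: lerD.
    by apply: ler_wpM2l; [exact: ltW|exact: Rintegral_iv_le].
  by apply: ler_wpM2l; [exact: mulr_ge0|apply: lerD; exact: Rintegral_iv_le].
move: key; rewrite RintegralZl//; last exact: integrable_iv.
rewrite model_integral//; last 2 first.
- by move=> /gb ?; lra.
- by move=> /ga ?; lra.
set I := \int[_]_(x in _) _; pose N : R := (z < b)%R%:R + (a < z)%R%:R; rewrite -/N => key.
have -> : q z * w z / (2 * `|dh z|) * N = (2 * s)^-1 * (q z * Num.sg (w z) * (sig * N)).
  rewrite {1}(numEsg (w z)) /sig; field.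
  by rewrite !gt_eqF.
rewrite -mulrBr normrM gtr0_norm ?invr_gt0 ?mulr_gt0// distrC mulrC ler_pdivrMr ?mulr_gt0//.
apply: le_trans key _.
have -> : eta * (2 * (s * rho)) + 2 * `|q z| * (2 * kap + 2 * kap) = eta * (C - 1) * (2 * s).
  by rewrite /kap /C; field; rewrite gt_eqF.
rewrite ler_pM2r ?mulr_gt0//; rewrite /eta mulrBr mulr1 divfK ?gt_eqF//.
by rewrite gerBl ltW.
Qed.

(** Only the product [q * w] survives in the limit, neither the kernel nor the
    factors. This is why the jumps of the Heaviside function and the delta
    function give the same Hessian. *)
Lemma jump_limit : exists L : (R -> R) -> R, forall (K : R -> R -> R) (q w : R -> R),
  continuous q -> continuous w -> jump_kernel K ->
  (2 * s)^-1 * \int[leb]_(x in `]a, b[%classic) (q x * K (h x) (s * w x))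
    @[s --> 0^'+] --> L (fun x => q x * w x).
Proof.
have [[z zab hz]|none] := pselect (exists2 z, a <= z <= b & h z = 0).
  exists (fun p => p z / (2 * `|dh z|) * ((z < b)%R%:R + (a < z)%R%:R)) => K q w cq cw jK.
  exact: jump_limit_zero.
exists (fun=> 0) => K q w cq cw jK.
have [[cw0 _ wmax] _] := EVT_norm (ltW ab) cw; have [_ [c0 c0ab hmin]] := EVT_norm (ltW ab) ch.
have d0 : 0 < `|h c0|.
  by rewrite normr_gt0; apply/eqP => hc; apply: none; exists c0.
have W1 : 0 < `|w cw0| + 1 by rewrite ltr_wpDl.
apply: cvg_right0 => e e0; exists (`|h c0| / (`|w cw0| + 1)); first exact: divr_gt0.
move=> s /andP[s0]; rewrite ltr_pdivlMr// mulrDr mulr1 => hs.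
rewrite (@eq_Rintegral _ _ _ _ _ (fun=> 0)).
  by rewrite Rintegral_cst// mul0r mulr0 subrr normr0 ltW.
move=> x; rewrite inE /= in_itv /= => xab; have [_ _ _ K0 _] := jK.
have xI : a <= x <= b by lra.
rewrite K0 ?mulr0//; apply: lt_le_trans (hmin _ xI); rewrite normrM gtr0_norm//.
apply: (@le_lt_trans _ _ (s * `|w cw0|)); last lra.
by rewrite ler_pM2l//; exact: wmax.
Qed.

End Crossing.
End OneDim.

(** * Slicing a planar integral *)

Section Slices.
Context {R : realType}.
Local Notation leb := (@lebesgue_measure R).
Implicit Types (S E : set (plane R)) (F : mplane R -> R).

(** Two continuous functions that agree inside agree at the endpoints; the limit
    may sit at an endpoint of the segment. *)
Lemma eq_closed_itv (a b : R) (f g : R -> R) : a < b -> continuous f -> continuous g ->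
  (forall x, a < x < b -> f x = g x) -> forall x, a <= x <= b -> f x = g x.
Proof.
move=> ab cf cg fg c cab; apply: contrapT => /eqP; rewrite -subr_eq0 => nz.
have cd : (f x - g x) @[x --> c] --> f c - g c by apply: cvgB; [exact: cf|exact: cg].
have n0 : 0 < `|f c - g c| by rewrite normr_gt0.
move/cvgrPdist_lt: cd => /(_ _ n0) cd; have [x [/= xab]] := closure_itv ab cab cd.
by move: xab; rewrite in_itv /= => /fg ->; rewrite subrr subr0 ltxx.
Qed.

Lemma Rintegral_split (a b c : R) (G : R -> R) : a < c -> c < b ->
  leb.-integrable `]a, b[%classic (EFin \o G) ->
  \int[leb]_(x in `]a, b[%classic) G x =
  \int[leb]_(x in `]a, c[%classic) G x + \int[leb]_(x in `]c, b[%classic) G x.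
Proof.
move=> ac cb iG; rewrite -(Rintegral_itvB (x := c) iG); last 2 first.
- by rewrite bnd_simp ltW.
- by rewrite bnd_simp.
rewrite -Rintegral_itv_bndo_bndc; last first.
  apply: integrableS iG => //; apply: subset_itvl; by rewrite bnd_simp ltW.
by rewrite addrCA subrr addr0.
Qed.

Lemma integrable_sub_itv (a b a' b' : R) (G : R -> R) : a <= a' -> b' <= b ->
  leb.-integrable `]a, b[%classic (EFin \o G) ->
  leb.-integrable `]a', b'[%classic (EFin \o G).
Proof.
move=> aa bb; apply: integrableS => // x /=; rewrite !in_itv /= => /andP[? ?].
by apply/andP; split; lra.
Qed.

(** A bound on the segments between consecutive points of [Q] costs one factor
    per segment. The points of [Q] are the interface crossings of a line. *)
Lemma chain_bound (Q : set R) (G : R -> R) (C a b : R) (l : seq R) :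
  a < b -> leb.-integrable `]a, b[%classic (EFin \o G) ->
  (forall a' b', a <= a' -> a' < b' -> b' <= b -> (forall x, a' < x < b' -> ~ Q x) ->
    `|\int[leb]_(x in `]a', b'[%classic) G x| <= C) ->
  path <%R a l -> all (fun x => x < b) l -> (forall x, a < x < b -> Q x -> x \in l) ->
  `|\int[leb]_(x in `]a, b[%classic) G x| <= C * (size l).+1%:R.
Proof.
elim: l a => [|c l IH] a ab iG hC /=.
  by move=> _ _ hl; rewrite mulr1; apply: hC => // x xab Qx; have := hl x xab Qx.
move=> /andP[ac pl] /andP[cb al] hl.
rewrite (Rintegral_split ac cb iG); apply: le_trans (ler_normD _ _) _.
rewrite -natr1 mulrDr mulr1 addrC; apply: lerD.
  apply: IH => //; first by apply: integrable_sub_itv iG => //; exact: ltW.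
    move=> a' b' ca' ab' bb' hQ; apply: hC => //; lra.
  move=> x /andP[cx xb] Qx; have : x \in c :: l by apply: hl => //; apply/andP; split; lra.
  by rewrite inE => /predU1P[xc|//]; move: cx; rewrite xc ltxx.
apply: hC => //; first exact: ltW.
move=> x /andP[ax xc] Qx; have : x \in c :: l by apply: hl => //; apply/andP; split; lra.
rewrite inE => /predU1P[xc'|xl]; first by move: xc; rewrite xc' ltxx.
have /allP/(_ _ xl) : all (<%R c) l by apply: order_path_min pl; exact: lt_trans.
by move=> cx; move: (lt_trans cx xc); rewrite ltxx.
Qed.

(** The same subdivision as in [chain_bound], for limits that are common to a
    class [P] of integrands. *)
Lemma chain_limit (Q : set R) (P : set (R -> R -> R)) (a b : R) (l : seq R) :
  a < b -> (forall G s, P G -> leb.-integrable `]a, b[%classic (EFin \o G s)) ->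
  (forall a' b', a <= a' -> a' < b' -> b' <= b -> (forall x, a' < x < b' -> ~ Q x) ->
    exists v : R, forall G, P G ->
      \int[leb]_(x in `]a', b'[%classic) G s x @[s --> 0^'+] --> v) ->
  path <%R a l -> all (fun x => x < b) l -> (forall x, a < x < b -> Q x -> x \in l) ->
  exists v : R, forall G, P G ->
      \int[leb]_(x in `]a, b[%classic) G s x @[s --> 0^'+] --> v.
Proof.
elim: l a => [|c l IH] a ab iG hC /=.
  by move=> _ _ hl; apply: hC => // x xab Qx; have := hl x xab Qx.
move=> /andP[ac pl] /andP[cb al] hl.
have [|||||v hv] := IH c cb.
- by move=> G s /iG-/(_ s); apply: integrable_sub_itv => //; exact: ltW.
- by move=> a' b' ca' ab' bb' hQ; apply: hC => //; lra.
- by [].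
- by [].
- move=> x /andP[cx xb] Qx; have : x \in c :: l by apply: hl => //; apply/andP; split; lra.
  by rewrite inE => /predU1P[xc|//]; move: cx; rewrite xc ltxx.
have [||||v' hv'] := hC a c.
- by [].
- by [].
- exact: ltW.
- move=> x /andP[ax xc] Qx; have : x \in c :: l by apply: hl => //; apply/andP; split; lra.
  rewrite inE => /predU1P[xc'|xl]; first by move: xc; rewrite xc' ltxx.
  have /allP/(_ _ xl) : all (<%R c) l by apply: order_path_min pl; exact: lt_trans.
  by move=> cx; move: (lt_trans cx xc); rewrite ltxx.
exists (v' + v) => G PG.
under eq_fun do rewrite (Rintegral_split ac cb (iG _ _ PG)).
by apply: cvgD; [exact: hv'|exact: hv].
Qed.

(** A set all of whose finite subsets have at most [N] elements can be listed in
    increasing order. *)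
Lemma finite_enum (Q : set R) (N : nat) :
  (forall l : seq R, uniq l -> (forall x, x \in l -> Q x) -> (size l <= N)%N) ->
  exists l, [/\ sorted <%R l, (size l <= N)%N & forall x, x \in l <-> Q x].
Proof.
move=> hN.
suff [l [ul lQ Ql]] : exists l, [/\ uniq l, forall x, x \in l -> Q x & forall x, Q x -> x \in l].
  exists (sort <=%R l); split; first by rewrite sort_lt_sorted.
    by rewrite size_sort; exact: hN.
  by move=> x; rewrite mem_sort; split; [exact: lQ|exact: Ql].
apply: contrapT => none.
suff [l [ul lQ sl]] : exists l, [/\ uniq l, forall x, x \in l -> Q x & size l = N.+1].
  by have := hN l ul lQ; rewrite sl ltnn.
elim: (N.+1) => [|k [l [ul lQ sl]]]; first by exists [::].
have [x [Qx xl]] : exists x, Q x /\ x \notin l.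
  apply: contrapT => nx; apply: none; exists l; split => // x Qx.
  by apply/negPn/negP => xl; apply: nx; exists x.
exists (x :: l); split => /=; [by rewrite xl|by move=> y; rewrite inE => /predU1P[->|/lQ]|by rewrite sl].
Qed.

Definition in_box (M : R) (p : plane R) := `|p.1| < M /\ `|p.2| < M.

(** The integral over the chord of the box; outside of the box the functions in
    use vanish. *)
Definition slice j (M : R) F (y : R) : R :=
  \int[leb]_(x in `](- M), M[%classic) F (pt j x y).

Lemma pt_in_box j M x y : in_box M (pt j x y) <-> `|x| < M /\ `|y| < M.
Proof. by case: j; rewrite /in_box /=; split => -[]. Qed.

Section BoxFun.
Variables (M C : R) (F : mplane R -> R).
Hypotheses (mF : measurable_fun setT F) (FC : forall p, `|F p| <= C).
Hypothesis F0 : forall p, ~ in_box M p -> F p = 0.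

Lemma measurable_slice_fun j y : measurable_fun setT (fun x : measurableTypeR R => F (pt j x y)).
Proof. by case: j; [exact: (measurable_fun_pair1 y mF)|exact: (measurable_fun_pair2 y mF)]. Qed.

Lemma integrable_slice j y a b :
  leb.-integrable `]a, b[%classic (EFin \o (fun x => F (pt j x y))).
Proof.
by apply: (@itv_integrable _ _ _ _ C) => //; apply: measurable_funTS; exact: measurable_slice_fun.
Qed.

Lemma integrable_box : area_meas.-integrable setT (EFin \o F).
Proof.
pose I : set (measurableTypeR R) := `](- M), M[%classic.
have mI : measurable I by exact: measurable_itv.
have -> : EFin \o F = (EFin \o F) \_ (I `*` I).
  apply/funext => p; rewrite patchE; case: ifPn => //; rewrite notin_setE => nI /=.
  rewrite F0// => -[h1 h2]; apply: nI; split; rewrite /I /= in_itv /= -ltr_norml//.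
apply/integrable_restrict => //; first exact: measurableX.
rewrite setTI; apply: (@bounded_integrable _ _ _ _ _ _ C) => //.
- exact: measurableX.
- rewrite /area_meas /= product_measure1E//.
  by rewrite lte_mul_pinfty// ?itv_finite// ge0_fin_numE// itv_finite.
- exact: measurable_funTS.
Qed.

Lemma slice_eq j y : (\int[leb]_x (F (pt j x y))%:E)%E = (slice j M F y)%:E.
Proof.
rewrite /slice /Rintegral fineK; last first.
  by apply: integrable_fin_num => //; exact: integrable_slice.
rewrite [RHS]integral_mkcond; apply: eq_integral => x _; rewrite patchE; case: ifPn => //.
rewrite notin_setE /= in_itv /= => nI; rewrite F0// pt_in_box => -[h1 h2]; apply: nI.
by rewrite -ltr_norml.
Qed.

Lemma slice_out j y : M <= `|y| -> slice j M F y = 0.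
Proof.
move=> My; rewrite /slice (@eq_Rintegral _ _ _ _ _ (fun=> 0)) ?Rintegral_cst ?mul0r//.
by move=> x _; apply: F0; rewrite pt_in_box => -[_]; rewrite ltNge My.
Qed.

Lemma measurable_slice j : measurable_fun setT (fun y : measurableTypeR R => (slice j M F y)%:E).
Proof.
under eq_fun do rewrite -slice_eq.
have := integrable_box; case: j.
  by move=> /measurable_fubini_G.
by move=> /measurable_fubini_F.
Qed.

Lemma integral_slice j : (\int[area_meas]_p (F p)%:E = \int[leb]_y (slice j M F y)%:E)%E.
Proof.
under [RHS]eq_integral do rewrite -slice_eq.
have := integrable_box; case: j => iF.
  by rewrite -(integral21_prod_meas1 iF).
by rewrite -(integral12_prod_meas1 iF).
Qed.

End BoxFun.

(** Fubini and dominated convergence. The domination may fail on the null set of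
    lines where [g] is infinite. *)
Lemma slice_cvg j M (F : nat -> mplane R -> R) (g lam : measurableTypeR R -> \bar R) :
  (forall n, measurable_fun setT (F n)) -> (forall n, exists C, forall p, `|F n p| <= C) ->
  (forall n p, ~ in_box M p -> F n p = 0) ->
  measurable_fun setT lam -> leb.-integrable setT g ->
  (forall y, g y \is a fin_num -> (slice j M (F n) y)%:E @[n --> \oo] --> lam y) ->
  (forall n y, g y \is a fin_num -> (`|slice j M (F n) y|%:E <= g y)%E) ->
  \int[area_meas]_p (F n p) @[n --> \oo] --> fine (\int[leb]_y lam y)%E.
Proof.
move=> mF bF F0 mlam ig lim dom.
have ae := integrable_ae measurableT ig.
have [] := @dominated_convergence _ _ _ (leb) setT measurableT
  (fun n y => (slice j M (F n) y)%:E) lam g _ mlam _ ig _.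
- by move=> n; have [C FC] := bF n; exact: (measurable_slice (mF n) FC (F0 n)).
- by apply: filterS ae => y /(_ I) fy _; exact: lim.
- by apply: filterS ae => y /(_ I) fy n _; exact: dom.
move=> ilam _ cv; have fl := integrable_fin_num measurableT ilam.
have /fine_cvgP[_] : (\int[area_meas]_p (F n p)%:E)%E @[n --> \oo] --> (fine (\int[leb]_y lam y)%E)%:E.
  rewrite fineK//; under eq_fun => n.
    have [C FC] := bF n.
    rewrite (integral_slice (mF n) FC (F0 n) j); over.
  exact: cv.
by [].
Qed.

End Slices.

(** * Jumps of the Heaviside function and the approximate delta *)

Section Kernels.
Context {R : realType}.

(** The change of [H (preact)] in a central difference. *)
Definition heaviside_jump (h u : R) : R := heaviside (h + u) - heaviside (h - u).

Lemma heaviside_gt0 (t : R) : 0 < t -> heaviside t = 1.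
Proof. by move=> t0; rewrite /heaviside ltNge (ltW t0) /= gt_eqF. Qed.

Lemma heaviside_lt0 (t : R) : t < 0 -> heaviside t = 0.
Proof. by move=> t0; rewrite /heaviside t0. Qed.

Lemma heaviside_itv (t : R) : 0 <= heaviside t <= 1.
Proof. by rewrite /heaviside; case: ifP => _; [|case: ifP => _]; apply/andP; split; lra. Qed.

Lemma measurable_heaviside : measurable_fun [set: measurableTypeR R] (@heaviside R).
Proof.
apply: measurable_fun_ifT => //; first exact: measurable_fun_ltr.
by apply: measurable_fun_ifT => //; exact: measurable_fun_eqr.
Qed.

Lemma heaviside_jump_kernel : jump_kernel heaviside_jump.
Proof.
rewrite /heaviside_jump; split.
- move=> h u; have /andP[? ?] := heaviside_itv (h + u); have /andP[? ?] := heaviside_itv (h - u).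
  by rewrite ler_norml; apply/andP; split; lra.
- by move=> h u; rewrite ltr_norml => /andP[? ?]; rewrite heaviside_gt0 ?heaviside_lt0 ?subr0//; lra.
- by move=> h u; rewrite ltr_norml => /andP[? ?]; rewrite heaviside_lt0 ?heaviside_gt0 ?sub0r//; lra.
- move=> h u; case: (ltP h 0) => h0.
    by rewrite (ltr0_norm h0) ltr_norml => /andP[? ?]; rewrite !heaviside_lt0 ?subrr//; lra.
  by rewrite (ger0_norm h0) ltr_norml => /andP[? ?]; rewrite !heaviside_gt0 ?subrr//; lra.
- apply: measurable_funB; apply: (measurableT_comp measurable_heaviside).
    exact: measurable_funD.
  exact: measurable_funB.
Qed.

(** The approximate delta without its factor [(2 s)^-1], extended to negative
    [u] by oddness so as to be a jump kernel. *)
Definition delta_jump (h u : R) : R :=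
  (if (- u < h) && (h < u) then 1 else 0) - (if (u < h) && (h < - u) then 1 else 0).

Lemma delta_jump_kernel : jump_kernel delta_jump.
Proof.
rewrite /delta_jump; split.
- by move=> h u; do 2 case: ifP => _; rewrite ?subrr ?subr0 ?sub0r ?normrN ?normr0 ?normr1.
- move=> h u; rewrite ltr_norml => /andP[h1 h2]; rewrite h1 h2 /=.
  by case: ifP => [/andP[? ?]|_]; [lra|rewrite subr0].
- move=> h u; rewrite ltr_norml opprK => /andP[h1 h2]; rewrite h1 h2 /=.
  by case: ifP => [/andP[? ?]|_]; [lra|rewrite sub0r].
- move=> h u; rewrite ltr_normr => hu; case: ifP => [/andP[h1 h2]|_].
    have : `|u| < `|u|; last by rewrite ltxx.
    have := ler_norm u => ?. case/orP: hu => ?; lra.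
  case: ifP => [/andP[h1 h2]|_]; last by rewrite subrr.
  have : `|u| < `|u|; last by rewrite ltxx.
  have := ler_norm (- u); rewrite normrN => ?. case/orP: hu => ?; lra.
- have m1 : measurable_fun [set: mplane R] (fun z : mplane R => z.1 : R) by exact: measurable_fst.
  have m2 : measurable_fun [set: mplane R] (fun z : mplane R => z.2 : R) by exact: measurable_snd.
  have m3 : measurable_fun [set: mplane R] (fun z : mplane R => - z.2 : R) by exact: measurable_funN.
  by apply: measurable_funB; apply: measurable_fun_ifT => //; apply: measurable_and; exact: measurable_fun_ltr.
Qed.

Lemma delta_jumpE (s h : R) : 0 < s -> delta_approx s h = (2 * s)^-1 * delta_jump h s.
Proof.
move=> s0; rewrite /delta_approx /delta_jump; case: ifP => [/andP[? ?]|_]; case: ifP => [/andP[? ?]|_]; lra.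
Qed.

End Kernels.

(** * Thin layers in a planar region *)

Section Layers.
Context {R : realType}.
Local Notation leb := (@lebesgue_measure R).
Implicit Types (S E : set (plane R)) (q w h : plane R -> R).

(** These functions are integrable on sets of finite area and form an algebra. *)
Definition bounded_meas S (f : plane R -> R) :=
  measurable_fun (S : set (mplane R)) f /\ exists C : R, forall x, S x -> `|f x| <= C.

(** On segments in direction [j] the function [h] is continuously differentiable
    up to the endpoints, with slope at least [m] in absolute value. *)
Definition steep S E (j : bool) (m : R) h := forall a b y, a < b ->
  on_seg (~` E) j a b y -> on_seg S j a b y ->
  exists hk dk : R -> R, [/\ continuous hk, continuous dk,
    forall x, a < x < b -> h (pt j x y) = hk x,
    forall x, a < x < b -> is_derive x 1 hk (dk x) & forall x, m <= `|dk x|].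

Lemma clip_extension (a b : R) (f : R -> R) : a < b -> continuous f ->
  continuous (f \o clip a b) /\ forall x, a < x < b -> (f \o clip a b) x = f x.
Proof.
move=> ab cf; split.
  by move=> x; apply: continuous_comp; [exact: clip_continuous|exact: cf].
by move=> x /andP[ax xb] /=; rewrite clip_id// !ltW.
Qed.

Section OneLayer.
Variables (S E : set (plane R)) (j : bool) (m M : R) (h : plane R -> R).
Hypotheses (mS : measurable (S : set (mplane R))) (SM : forall p, S p -> in_box M p).
Hypotheses (cS : cuts E S) (m0 : 0 < m) (sh : steep S E j m h).
Hypothesis mh : measurable_fun (S : set (mplane R)) h.

Lemma restrict_measurable (g : plane R -> R) : measurable_fun (S : set (mplane R)) g ->
  measurable_fun [set: mplane R] (g \_ S).
Proof. by move=> /(measurable_restrictT g mS). Qed.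

Lemma restrict_bounded (g : plane R -> R) (C : R) : 0 <= C ->
  (forall p, S p -> `|g p| <= C) -> forall p, `|(g \_ S) p| <= C.
Proof.
move=> C0 gC p; rewrite patchE; case: ifPn => [|_]; last by rewrite normr0.
by rewrite inE; exact: gC.
Qed.

Lemma restrict_box (g : plane R -> R) p : ~ in_box M p -> (g \_ S) p = 0.
Proof.
by move=> np; rewrite patchE; case: ifPn => //; rewrite inE => /SM.
Qed.

Lemma restrict_outside (g : plane R -> R) a b y : on_seg (~` S) j a b y ->
  \int[leb]_(x in `]a, b[%classic) (g \_ S) (pt j x y) = 0.
Proof.
move=> nS; rewrite (@eq_Rintegral _ _ _ _ _ (fun=> 0)) ?Rintegral_cst ?mul0r//.
move=> x; rewrite inE /= in_itv /= => xab; rewrite patchE memNset//; exact: nS.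
Qed.

Lemma restrict_inside (g : plane R -> R) (k : R -> R) a b y : on_seg S j a b y ->
  (forall x, a < x < b -> g (pt j x y) = k x) ->
  \int[leb]_(x in `]a, b[%classic) (g \_ S) (pt j x y) =
  \int[leb]_(x in `]a, b[%classic) k x.
Proof.
move=> hS gk; apply: eq_Rintegral => x; rewrite inE /= in_itv /= => xab.
by rewrite patchE mem_set ?gk//; exact: hS.
Qed.

(** A segment that avoids [E] is inside or outside of [S]; inside, [band_bound]
    applies. *)
Lemma seg_band (g : plane R -> R) (C t a b y : R) : 0 <= C -> 0 <= t ->
  measurable_fun (S : set (mplane R)) g -> (forall p, S p -> `|g p| <= C) ->
  (forall p, S p -> t < `|h p| -> g p = 0) ->
  a < b -> on_seg (~` E) j a b y ->
  `|\int[leb]_(x in `]a, b[%classic) (g \_ S) (pt j x y)| <= C * (4 * t / m).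
Proof.
move=> C0 t0 mg gC g0 ab nE; have [hS|nS] := cS ab nE; last first.
  by rewrite restrict_outside// normr0 mulr_ge0// divr_ge0 ?mulr_ge0// ltW.
have [hk [dk [ch cd hE hd hm]]] := sh ab nE hS.
apply: (@band_bound _ a b m hk dk) => //.
- apply: measurable_funTS; exact: (measurable_slice_fun (restrict_measurable mg)).
- by move=> x _; exact: restrict_bounded.
- by move=> x xab; rewrite -hE// patchE mem_set; [exact/g0/hS|exact: hS].
Qed.

(** The rescaled kernel integrands whose limits have to agree, for a given
    product [p = q * w]. *)
Definition admissible (p : plane R -> R) : set (R -> plane R -> R) := [set G | exists q w K,
  [/\ jump_kernel K, bounded_meas S q, bounded_meas S w, tame S E q & tame S E w] /\
  (forall x, S x -> q x * w x = p x) /\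
  G = fun s x => (2 * s)^-1 * (q x * K (h x) (s * w x))].

(** The value [L] of [jump_limit] depends on [q * w] on the closed segment, and
    [q * w = p] extends there by continuity. *)
Lemma seg_limit p a b y : tame S E p -> a < b -> on_seg (~` E) j a b y ->
  exists v : R, forall G, admissible p G ->
   \int[leb]_(x in `]a, b[%classic) (G s \_ S) (pt j x y) @[s --> 0^'+] --> v.
Proof.
move=> tp ab nE; have [hS|nS] := cS ab nE; last first.
  exists 0 => G _; under eq_fun do rewrite restrict_outside//.
  exact: cvg_cst.
have [hk [dk [ch cd hE hd hm]]] := sh ab nE hS.
have [L hL] := jump_limit ab m0 ch cd hd hm.
have [pk cpk pE] := tp _ _ _ _ ab nE hS.
exists (L (pk \o clip a b)) => G [q [w [K [[jK bq bw tq tw] [qw ->]]]]].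
have [qk cqk qE] := tq _ _ _ _ ab nE hS; have [wk cwk wE] := tw _ _ _ _ ab nE hS.
have [cqk' qkE] := clip_extension ab cqk; have [cwk' wkE] := clip_extension ab cwk.
have <- : (fun x => (qk \o clip a b) x * (wk \o clip a b) x) = pk \o clip a b.
  apply/funext => x /=.
  apply: (@eq_closed_itv _ a b (fun x => qk x * wk x) pk) => //; last exact/clip_in/ltW.
    by move=> z; apply: cvgM; [exact: cqk|exact: cwk].
  by move=> z zab; rewrite -qE// -wE// qw ?pE//; exact: hS.
have lim := hL K _ _ cqk' cwk' jK.
rewrite (_ : (fun s => _) = fun s => (2 * s)^-1 * \int[leb]_(x in `]a, b[%classic)
  ((qk \o clip a b) x * K (hk x) (s * (wk \o clip a b) x)))//.
apply/funext => s; rewrite -RintegralZl//; last first.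
  have [[cq0 _ qmax] _] := EVT_norm (ltW ab) cqk'.
  apply: (@itv_integrable _ _ _ _ `|(qk \o clip a b) cq0|).
    apply: measurable_funM; first by apply: measurable_funTS; exact: continuous_measurable_fun.
    apply: (measurable_fun_kernel jK); apply: measurable_funTS; first exact: continuous_measurable_fun.
    by apply: measurable_funM => //; exact: continuous_measurable_fun.
  move=> x /andP[ax xb]; rewrite normrM -[leRHS]mulr1; apply: ler_pM => //.
    by apply: qmax; rewrite !ltW.
  by case: jK.
apply: restrict_inside => // x xab.
by rewrite qkE// wkE// qE// wE// hE.
Qed.

Lemma admissible_measurable p G s : admissible p G -> measurable_fun (S : set (mplane R)) (G s).
Proof.
move=> [q [w [K [[jK [mq _] [mw _] _ _] [_ ->]]]]].
apply: measurable_funM => //; apply: measurable_funM => //.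
by apply: (measurable_fun_kernel jK) => //; exact: measurable_funM.
Qed.

Lemma admissible_bounded p G s : admissible p G ->
  exists2 C : R, 0 <= C & forall x, S x -> `|G s x| <= C.
Proof.
move=> [q [w [K [[jK [_ [C hC]] _ _ _] [_ ->]]]]].
exists (`|(2 * s)^-1| * `|C|); first exact: mulr_ge0.
move=> x Sx; rewrite normrM ler_wpM2l// normrM -[leRHS]mulr1 ler_pM//.
  by apply: le_trans (hC _ Sx) (ler_norm _).
by case: jK.
Qed.

(** The height [C'] of the integrand is of order [1 / s] and the layer that
    carries it has width [t] of order [s]; their product does not depend on
    [s]. *)
Lemma admissible_band p G : admissible p G -> exists2 C : R, 0 <= C & forall s, 0 < s ->
  exists C' t : R, [/\ 0 <= C', 0 <= t, forall x, S x -> `|G s x| <= C',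
    forall x, S x -> t < `|h x| -> G s x = 0 & C' * (4 * t / m) = C].
Proof.
move=> [q [w [K [[jK [_ [C hC]] [_ [W hW]] _ _] [_ ->]]]]].
exists (2 * `|C| * `|W| / m); first by rewrite divr_ge0 ?mulr_ge0// ltW.
move=> s s0; exists ((2 * s)^-1 * `|C|), (s * `|W|).
have s20 : 0 <= (2 * s)^-1 by rewrite invr_ge0 mulr_ge0// ltW.
split.
- exact: mulr_ge0.
- by apply: mulr_ge0 => //; exact: ltW.
- move=> x Sx; rewrite normrM (ger0_norm s20) ler_wpM2l// normrM -[leRHS]mulr1 ler_pM//.
    by apply: le_trans (hC _ Sx) (ler_norm _).
  by case: jK.
- move=> x Sx hx; have [_ _ _ K0 _] := jK; rewrite K0 ?mulr0//.
  apply: le_lt_trans hx; rewrite normrM gtr0_norm// ler_pM2l//.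
  by apply: le_trans (hW _ Sx) (ler_norm _).
- by field; rewrite !gt_eqF.
Qed.

Section WithIndicatrix.
Variable D : measurableTypeR R -> \bar R.
Hypotheses (mD : measurable_fun setT D) (D0 : forall y, (0 <= D y)%E).
Hypothesis iD : (\int[leb]_y D y < +oo)%E.
Hypothesis hD : forall y (l : seq R), uniq l -> (forall x, x \in l -> E (pt j x y)) ->
  (((size l)%:R)%:E <= D y)%E.

Lemma slice_points y : D y \is a fin_num -> 0 < M -> exists l : seq R,
  [/\ path <%R (- M) l, all (fun x => x < M) l, (((size l)%:R)%:E <= D y)%E &
      forall x, - M < x < M -> E (pt j x y) -> x \in l].
Proof.
move=> fD M0; have [|l [sl ls lQ]] := @finite_enum R [set x | - M < x < M /\ E (pt j x y)]
    (Num.trunc (fine (D y))).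
  move=> l ul lE; have := hD ul (fun x xl => (lE x xl).2).
  rewrite -[D y]fineK// lee_fin => szD; rewrite truncn_ge_nat//.
  exact: (fine_ge0 (D0 y)).
exists l; split.
- by rewrite path_sortedE; [apply/andP; split => //; apply/allP => x /lQ[/andP[]]|exact: lt_trans].
- by apply/allP => x /lQ[/andP[]].
- by apply: hD; [exact: (lt_sorted_uniq sl)|move=> x /lQ[]].
- by move=> x xM Ex; apply/lQ.
Qed.

(** A line crosses [E] at most [D y] times, which leaves at most [D y + 1]
    segments. *)
Lemma slice_band (g : plane R -> R) (C t y : R) : 0 < M -> 0 <= C -> 0 <= t ->
  measurable_fun (S : set (mplane R)) g -> (forall p, S p -> `|g p| <= C) ->
  (forall p, S p -> t < `|h p| -> g p = 0) -> D y \is a fin_num ->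
  (`|slice j M (g \_ S) y|%:E <= (C * (4 * t / m))%:E * (D y + (\1_(`](- M), M[%classic) y)%:E))%E.
Proof.
move=> M0 C0 t0 mg gC g0 fD.
have A0 : 0 <= C * (4 * t / m) by rewrite mulr_ge0// divr_ge0 ?mulr_ge0// ltW.
have [yM|yM] := ltP `|y| M; last first.
  rewrite (slice_out (@restrict_box g))// normr0 mule_ge0 ?adde_ge0 ?lee_fin//.
have [l [pl al sl hl]] := slice_points fD M0.
rewrite indicE mem_set; last by rewrite /= in_itv /= -ltr_norml.
apply: (@le_trans _ _ ((C * (4 * t / m))%:E * ((size l)%:R + 1)%:E)%E); last first.
  by rewrite lee_wpmul2l ?lee_fin// EFinD leeD2r.
rewrite -EFinM lee_fin natr1; apply: (@chain_bound _ [set x | E (pt j x y)]) => //.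
- by lra.
- by apply: (integrable_slice (restrict_measurable mg) (restrict_bounded C0 gC)).
- by move=> a b aM ab bM nE; exact: seg_band.
Qed.

Lemma slice_limit p y :
  0 < M -> tame S E p -> D y \is a fin_num -> exists v : R, forall G, admissible p G ->
   slice j M (G s \_ S) y @[s --> 0^'+] --> v.
Proof.
move=> M0 tp fD; have [yM|yM] := ltP `|y| M; last first.
  exists 0 => G _; under eq_fun do rewrite (slice_out (@restrict_box _))//.
  exact: cvg_cst.
have [l [pl al sl hl]] := slice_points fD M0.
have [|||v hv] := @chain_limit _ [set x | E (pt j x y)]
   [set H | exists2 G, admissible p G & H = fun s x => (G s \_ S) (pt j x y)] (- M) M l _ _ _ pl al hl.
- by lra.
- move=> H s [G aG ->]; have [C C0 hC] := admissible_bounded s aG.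
  exact: (integrable_slice (restrict_measurable (admissible_measurable s aG)) (restrict_bounded C0 hC)).
- move=> a b aM ab bM nE; have [v hv] := seg_limit tp ab nE.
  by exists v => H [G aG ->]; exact: hv.
by exists v => G aG; apply: hv; exists G.
Qed.

Lemma integrable_dominating (A : R) : 0 <= A ->
  leb.-integrable setT
    (fun y : measurableTypeR R => A%:E * (D y + (\1_(`](- M), M[%classic) y)%:E))%E.
Proof.
move=> A0; apply: integrableZl => //; apply: integrableD => //.
  apply/integrableP; split => //; under eq_integral do rewrite gee0_abs//.
  exact: iD.
apply/integrableP; split.
  by apply/measurable_EFinP; apply: measurable_indic; exact: measurable_itv.
under eq_integral do rewrite gee0_abs ?lee_fin ?indicE//.
under eq_integral do rewrite -indicE.
by rewrite integral_indic// setIT; exact: itv_finite.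
Qed.

(** Integrate [slice_band] over the lines. *)
Lemma band_area (g : plane R -> R) (C t : R) : 0 < M -> 0 <= C -> 0 <= t ->
  measurable_fun (S : set (mplane R)) g -> (forall p, S p -> `|g p| <= C) ->
  (forall p, S p -> t < `|h p| -> g p = 0) ->
  `|\int[area_meas]_(x in S) g x| <= C * (4 * t / m) *
    fine (\int[leb]_y (D y + (\1_(`](- M), M[%classic) y)%:E))%E.
Proof.
move=> M0 C0 t0 mg gC g0.
have A0 : 0 <= C * (4 * t / m) by rewrite mulr_ge0// divr_ge0 ?mulr_ge0// ltW.
have mg' := restrict_measurable mg; have gC' := restrict_bounded C0 gC.
have g0' := @restrict_box g.
have i1 : leb.-integrable setT
    (fun y : measurableTypeR R => (D y + (\1_(`](- M), M[%classic) y)%:E))%E.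
  by have := integrable_dominating ler01; under eq_fun do rewrite mul1e.
have iA := integrable_dominating A0.
rewrite Rintegral_mkcond -lee_fin EFinM fineK; last exact: integrable_fin_num.
have ig := integrable_box mg' gC' g0'.
rewrite EFin_normr_Rintegral//.
rewrite (_ : (\int[area_meas]_x ((g \_ S) x)%:E)%E = (\int[leb]_y (slice j M (g \_ S) y)%:E)%E); last exact: integral_slice mg' gC' g0' j.
have ms := measurable_slice mg' gC' g0' j.
apply: le_trans (le_abse_integral _ _ _) _ => //.
rewrite -integralZl//; apply: ae_ge0_le_integral => //.
- exact: measurableT_comp.
- by move=> y _; apply: mule_ge0; rewrite ?lee_fin// adde_ge0// lee_fin indicE.
- exact: measurable_int iA.
- have := integrable_ae measurableT i1; apply: filterS => y /(_ I); rewrite fin_numD => /andP[fD _] _.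
  exact: slice_band.
Qed.

Lemma layer_limit_aux p : 0 < M -> bounded_meas S p -> tame S E p ->
  exists v : R, forall G, admissible p G -> \int[area_meas]_(x in S) G s x @[s --> 0^'+] --> v.
Proof.
move=> M0 bp tp.
pose G0 s x : R := (2 * s)^-1 * (p x * heaviside_jump (h x) (s * 1)).
have aG0 : admissible p G0.
  exists p, (fun=> 1), heaviside_jump; split; last by split => // x _; rewrite mulr1.
  split => //; [exact: heaviside_jump_kernel| |exact: tame_cst].
  by split; [exact: measurable_cst|exists 1 => x _; rewrite normr1].
(* A measurable version of the limit on the lines, computed with one reference
   integrand along one sequence; it is the limit for every admissible integrand. *)
pose lam y := limn_esup (fun n => (slice j M (G0 (n.+1%:R^-1) \_ S) y)%:E).
have mslice G s : admissible p G -> measurable_fun setT (fun y : measurableTypeR R => (slice j M (G s \_ S) y)%:E).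
  move=> aG; have [C C0 hC] := admissible_bounded s aG.
  exact: (measurable_slice (restrict_measurable (admissible_measurable s aG)) (restrict_bounded C0 hC) (@restrict_box _)).
exists (fine (\int[leb]_y lam y)%E) => G aG.
apply/cvg_at_rightP => u [u0 ucv].
have [C C0 hC] := admissible_band aG.
have C1 : 0 < C + 1 by lra.
have fin y : ((C + 1)%:E * (D y + (\1_(`](- M), M[%classic) y)%:E))%E \is a fin_num -> D y \is a fin_num.
  move: (D0 y); case: (D y) => // _.
  by rewrite addye// mulry gtr0_sg// mul1e.
under eq_fun do rewrite Rintegral_mkcond.
apply: (slice_cvg _ _ _ _ (integrable_dominating (ltW C1))).
- by move=> n; exact: (restrict_measurable (admissible_measurable _ aG)).
- move=> n; have [C' C'0 hC'] := admissible_bounded (u n) aG.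
  by exists C'; exact: restrict_bounded.
- by move=> n x; exact: restrict_box.
- by apply: measurable_fun_limn_esup => n; exact: mslice.
- move=> y /fin fD; have [v hv] := slice_limit M0 tp fD.
  have lamE : lam y = v%:E.
    have cv0 : (slice j M (G0 (n.+1%:R^-1) \_ S) y)%:E @[n --> \oo] --> v%:E.
      apply: cvg_EFin; first exact: nearW.
      have /cvg_at_rightP/(_ (fun n => n.+1%:R^-1)) := hv _ aG0; apply; split.
        by move=> n; rewrite invr_gt0.
      exact: cvg_harmonic.
    by rewrite /lam is_cvg_limn_esupE; [exact/cvg_lim|apply/cvg_ex; exists v%:E].
  rewrite lamE; apply: cvg_EFin; first exact: nearW.
  by have /cvg_at_rightP/(_ u) := hv _ aG; apply.
- move=> n y /fin fD; have [C' [t [C'0 t0 b1 b2 CE]]] := hC _ (u0 n).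
  apply: le_trans (slice_band M0 C'0 t0 (admissible_measurable _ aG) b1 b2 fD) _.
  rewrite CE; apply: lee_wpmul2r; last by rewrite lee_fin lerDl.
  by rewrite adde_ge0// lee_fin indicE.
Qed.

End WithIndicatrix.

(** The limit is the same for all kernels and all factorisations of [p]. *)
Theorem layer_limit p : rectifiable E -> 0 < M -> bounded_meas S p -> tame S E p ->
  exists v : R, forall q w K, jump_kernel K -> bounded_meas S q -> bounded_meas S w -> tame S E q -> tame S E w ->
   (forall x, S x -> q x * w x = p x) ->
   \int[area_meas]_(x in S) ((2 * s)^-1 * (q x * K (h x) (s * w x))) @[s --> 0^'+] --> v.
Proof.
move=> rE M0 bp tp; have [D [mD D0 iD hD]] := rectifiable_indicatrix j rE.
have [v hv] := layer_limit_aux mD D0 iD hD M0 bp tp.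
exists v => q w K jK bq bw tq tw qw.
by apply: (hv (fun s x => (2 * s)^-1 * (q x * K (h x) (s * w x)))); exists q, w, K.
Qed.

End OneLayer.

(** The area of a layer of half-width [t] is at most a constant times [t / m],
    with a constant that depends neither on [h] nor on [m]. *)
Theorem layer_band S E (M : R) : measurable (S : set (mplane R)) ->
  (forall x, S x -> in_box M x) -> cuts E S -> rectifiable E -> 0 < M ->
  exists2 A : R, 0 <= A & forall j m h (g : plane R -> R) (C t : R), 0 < m -> steep S E j m h ->
    0 <= C -> 0 <= t -> measurable_fun (S : set (mplane R)) g ->
    (forall x, S x -> `|g x| <= C) -> (forall x, S x -> t < `|h x| -> g x = 0) ->
    `|\int[area_meas]_(x in S) g x| <= C * (4 * t / m) * A.
Proof.
move=> mS SM cS rE M0.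
have [D1 [mD1 D10 iD1 hD1]] := rectifiable_indicatrix true rE.
have [D2 [mD2 D20 iD2 hD2]] := rectifiable_indicatrix false rE.
pose A (D : measurableTypeR R -> \bar R) := fine (\int[leb]_y (D y + (\1_(`](- M), M[%classic) y)%:E))%E.
have A0 D : (forall y, (0 <= D y)%E) -> 0 <= A D.
  by move=> D0; apply: fine_ge0; apply: integral_ge0 => y _; rewrite adde_ge0// lee_fin indicE.
exists (A D1 + A D2); first by rewrite addr_ge0// A0.
move=> j m h g C t m0 sh C0 t0 mg gC g0.
have P0 : 0 <= C * (4 * t / m) by rewrite mulr_ge0// divr_ge0 ?mulr_ge0// ltW.
rewrite mulrDr; case: j sh => sh.
  apply: (@le_trans _ _ (C * (4 * t / m) * A D1)); first by apply: (@band_area S E true m M h).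
  by rewrite lerDl mulr_ge0// A0.
apply: (@le_trans _ _ (C * (4 * t / m) * A D2)); first by apply: (@band_area S E false m M h).
by rewrite lerDr mulr_ge0// A0.
Qed.

End Layers.

(** * Bounded measurable integrands *)

Section BoundedMeasurable.
Context {R : realType}.
Variable S : set (plane R).
Implicit Types f g : plane R -> R.

Lemma bm_cst (k : R) : bounded_meas S (fun=> k).
Proof. by split; [exact: measurable_cst|exists `|k|]. Qed.

Lemma bmD f g : bounded_meas S f -> bounded_meas S g -> bounded_meas S (fun x => f x + g x).
Proof.
move=> [mf [C hC]] [mg [C' hC']]; split; first exact: measurable_funD.
by exists (C + C') => x Sx; apply: le_trans (ler_normD _ _) _; exact: lerD (hC _ Sx) (hC' _ Sx).
Qed.

Lemma bmM f g : bounded_meas S f -> bounded_meas S g -> bounded_meas S (fun x => f x * g x).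
Proof.
move=> [mf [C hC]] [mg [C' hC']]; split; first exact: measurable_funM.
by exists (C * C') => x Sx; rewrite normrM; apply: ler_pM (hC _ Sx) (hC' _ Sx).
Qed.

Lemma bmZ k f : bounded_meas S f -> bounded_meas S (fun x => k * f x).
Proof. exact/bmM/bm_cst. Qed.

Lemma bmB f g : bounded_meas S f -> bounded_meas S g -> bounded_meas S (fun x => f x - g x).
Proof.
move=> bf bg; have := bmD bf (bmZ (-1) bg).
by under [X in bounded_meas S X]eq_fun do rewrite mulN1r.
Qed.

Lemma bm_sum (I : Type) (s : seq I) (f : I -> plane R -> R) :
  (forall i, bounded_meas S (f i)) -> bounded_meas S (fun x => \sum_(i <- s) f i x).
Proof.
move=> bf; elim: s => [|i s IH].
  by under eq_fun do rewrite big_nil; exact: bm_cst.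
by under eq_fun do rewrite big_cons; exact: bmD.
Qed.

Lemma bm_comp f (phi : R -> R) (C : R) :
  bounded_meas S f -> measurable_fun [set: measurableTypeR R] phi ->
  (forall t, `|phi t| <= `|t| + C) -> bounded_meas S (fun x => phi (f x)).
Proof.
move=> [mf [D hD]] mphi hphi; split; first exact: measurableT_comp mphi mf.
exists (D + C) => x Sx; apply: le_trans (hphi _) _; rewrite lerD2r; exact: hD.
Qed.

Lemma bm_norm f : bounded_meas S f -> bounded_meas S (fun x => `|f x|).
Proof. by move=> bf; apply: (bm_comp (C := 0) bf) => // t; rewrite normr_id addr0. Qed.

Hypotheses (mS : measurable (S : set (mplane R))) (fS : (area_meas (S : set (mplane R)) < +oo)%E).

Lemma bm_integrable f : bounded_meas S f -> area_meas.-integrable (S : set (mplane R)) (EFin \o f).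
Proof. by move=> [mf [C hC]]; exact: (bounded_integrable mS fS mf hC). Qed.

Definition Int f : R := \int[area_meas]_(x in S) f x.

Lemma IntD f g : bounded_meas S f -> bounded_meas S g -> Int (fun x => f x + g x) = Int f + Int g.
Proof. by move=> bf bg; apply: RintegralD => //; exact: bm_integrable. Qed.

Lemma IntB f g : bounded_meas S f -> bounded_meas S g -> Int (fun x => f x - g x) = Int f - Int g.
Proof. by move=> bf bg; apply: RintegralB => //; exact: bm_integrable. Qed.

Lemma IntZ k f : bounded_meas S f -> Int (fun x => k * f x) = k * Int f.
Proof. by move=> bf; apply: RintegralZl => //; exact: bm_integrable. Qed.

Lemma eq_Int f g : (forall x, S x -> f x = g x) -> Int f = Int g.
Proof. by move=> fg; apply: eq_Rintegral => x; rewrite inE; exact: fg. Qed.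

Lemma Int_sum (I : Type) (s : seq I) (f : I -> plane R -> R) :
  (forall i, bounded_meas S (f i)) -> Int (fun x => \sum_(i <- s) f i x) = \sum_(i <- s) Int (f i).
Proof.
move=> bf; elim: s => [|i s IH].
  rewrite big_nil (@eq_Int _ (fun=> 0)) ?/Int ?Rintegral_cst ?mul0r//.
  by move=> x _; rewrite big_nil.
rewrite big_cons -IH -IntD//; last exact: bm_sum.
by apply: eq_Int => x _; rewrite big_cons.
Qed.

Lemma Int_abs_le f g :
  bounded_meas S f -> bounded_meas S g -> (forall x, S x -> `|f x| <= g x) -> `|Int f| <= Int g.
Proof.
by move=> [mf _] bg fg; apply: Rintegral_abs_le => //; exact: bm_integrable.
Qed.

Lemma Int_cst k : Int (fun=> k) = k * fine (area_meas (S : set (mplane R))).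
Proof. exact: Rintegral_cst. Qed.

End BoundedMeasurable.

(** * Taylor remainder of the activation *)

Section Activations.
Context {R : realType}.
Implicit Types p d t : R.

(** A shift by [d] can be noticed only within distance [|d|] of the jump. *)
Lemma heaviside_shift p d : `|heaviside (p + d) - heaviside p| <= (`|p| <= `|d|)%R%:R.
Proof.
case: (leP `|p| `|d|) => pd /=.
  have /andP[? ?] := heaviside_itv (p + d); have /andP[? ?] := heaviside_itv p.
  by rewrite ler_norml; apply/andP; split; lra.
have := ler_norm d; have := ler_norm (- d); rewrite normrN => d1 d2.
case: (ltP p 0) => p0.
  by rewrite (ltr0_norm p0) in pd; rewrite !heaviside_lt0 ?subrr ?normr0//; lra.
by rewrite (ger0_norm p0) in pd; rewrite !heaviside_gt0 ?subrr ?normr0//; lra.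
Qed.

Lemma relu_ge0 t : 0 <= t -> relu t = t.
Proof. by move=> t0; rewrite /relu; apply/max_idPr. Qed.

Lemma relu_le0 t : t <= 0 -> relu t = 0.
Proof. by move=> t0; rewrite /relu; apply/max_idPl. Qed.

Lemma relu_lip p d : `|relu (p + d) - relu p| <= `|d|.
Proof.
have := ler_norm d; have := ler_norm (- d); rewrite normrN => d1 d2.
by rewrite ler_norml; case: (leP p 0) => p0; case: (leP (p + d) 0) => q0;
  rewrite ?(relu_le0 p0) ?(relu_le0 q0) ?(relu_ge0 (ltW p0)) ?(relu_ge0 (ltW q0)); apply/andP; split; lra.
Qed.

(** The activation is affine on either side of [0]. *)
Lemma relu_taylor p d : `|relu (p + d) - relu p - heaviside p * d| <= `|d| * (`|p| <= `|d|)%R%:R.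
Proof.
have := ler_norm d; have := ler_norm (- d); rewrite normrN => d1 d2.
case: (leP `|p| `|d|) => pd /=; last first.
  rewrite mulr0; case: (ltP p 0) => p0.
    rewrite (ltr0_norm p0) in pd.
    by rewrite heaviside_lt0// mul0r !relu_le0 ?subrr ?normr0//; lra.
  rewrite (ger0_norm p0) in pd.
  rewrite heaviside_gt0; last lra.
  rewrite mul1r !relu_ge0; [|lra|lra].
  by rewrite (_ : p + d - p - d = 0) ?normr0//; ring.
rewrite mulr1; have /andP[h0 h1] := heaviside_itv p.
rewrite ler_norml; case: (ltgtP p 0) => p0.
- rewrite heaviside_lt0// mul0r subr0 (relu_le0 (ltW p0)) subr0.
  case: (leP (p + d) 0) => q0; rewrite ?(relu_le0 q0) ?(relu_ge0 (ltW q0)); apply/andP; split; lra.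
- rewrite heaviside_gt0// mul1r (relu_ge0 (ltW p0)); rewrite (gtr0_norm p0) in pd.
  case: (leP (p + d) 0) => q0; rewrite ?(relu_le0 q0) ?(relu_ge0 (ltW q0)); apply/andP; split; lra.
- rewrite p0 add0r (relu_ge0 (lexx 0)) subr0.
  have -> : heaviside 0 = 2^-1 :> R by rewrite /heaviside ltxx eqxx.
  case: (leP d 0) => q0; rewrite ?(relu_le0 q0) ?(relu_ge0 (ltW q0)); apply/andP; split; lra.
Qed.

Lemma measurable_relu : measurable_fun [set: measurableTypeR R] (@relu R).
Proof. exact: measurable_maxr. Qed.

Lemma continuous_relu : continuous (@relu R).
Proof.
move=> x; apply: (@continuous_max R R (cst 0) id); [exact: cvg_cst|exact: cvg_id].
Qed.

Lemma norm_relu t : `|relu t| <= `|t|.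
Proof.
case: (leP t 0) => t0; first by rewrite relu_le0// normr0.
by rewrite relu_ge0// ltW.
Qed.

End Activations.

(** * Dependence of the network on its parameters *)

Section Preactivation.
Context {R : realType} {n : nat}.
Implicit Types (r v : 'cV[R]_(n * 3)) (x : plane R) (i : 'I_n).

Definition weight_max r i : R := Num.max `|(omega r i).1| `|(omega r i).2|.

Lemma omax_gt0 r i : omega r i <> 0 -> 0 < weight_max r i.
Proof.
move=> w0; rewrite /weight_max lt_max !normr_gt0; apply: contrapT => /negP.
by rewrite negb_or !negbK => /andP[/eqP w1 /eqP w2]; apply: w0; rewrite [omega _ _]surjective_pairing w1 w2.
Qed.

Lemma neuronD r v i : neuron (r + v) i = neuron r i + neuron v i.
Proof. by apply/colP => k; rewrite !mxE. Qed.

Lemma neuronZ s r i : neuron (s *: r) i = s *: neuron r i.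
Proof. by apply/colP => k; rewrite !mxE. Qed.

Lemma preactD r v i x : preact (r + v) i x = preact r i x + preact v i x.
Proof. by rewrite /preact neuronD linearD mulmxDl mxE. Qed.

Lemma preactZ s r i x : preact (s *: r) i x = s * preact r i x.
Proof. by rewrite /preact neuronZ linearZ -scalemxAl mxE. Qed.

Lemma preactN r i x : preact (- r) i x = - preact r i x.
Proof. by rewrite -scaleN1r preactZ mulN1r. Qed.

Lemma preactE r i x : preact r i x =
  neuron r i (inord 0) 0 + (omega r i).1 * x.1 + (omega r i).2 * x.2.
Proof.
rewrite /preact mxE (bigD1 (inord 0)) //= (bigD1 (inord 1)) /=; last first.
  by rewrite -val_eqE /= !inordK.
rewrite (bigD1 (inord 2)) /=; last by rewrite -!val_eqE /= !inordK.
rewrite big1 ?addr0 => [|[k k3]]; last first.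
  by rewrite -!val_eqE /= !inordK//; case: k k3 => [|[|[|]]].
by rewrite /omega /= !mxE !inordK//= mulr1 addrA.
Qed.

Lemma le_mx_norm p q (A : 'M[R]_(p, q)) (a : 'I_p) (b : 'I_q) : `|A a b| <= `|A|.
Proof.
have -> : `|A| = mx_norm A by []. rewrite mx_normrE.
by apply: (le_trans _ (@le_bigmax _ _ _ _ (fun ij : 'I_p * 'I_q => `|A ij.1 ij.2|) (a, b))).
Qed.

Lemma preact_bound r i x : `|preact r i x| <= `|r| * (1 + `|x.1| + `|x.2|).
Proof.
rewrite preactE !mulrDr mulr1; apply: le_trans (ler_normD _ _) _; apply: lerD.
  apply: le_trans (ler_normD _ _) _; apply: lerD; first by rewrite mxE; exact: le_mx_norm.
  by rewrite normrM ler_wpM2r// /omega /= mxE; exact: le_mx_norm.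
by rewrite normrM ler_wpM2r// /omega /= mxE; exact: le_mx_norm.
Qed.

(** Used to bound the weights away from [0] on compact pieces of a line. *)
Lemma omax_line r v i : continuous (fun t : R => weight_max (r + t *: v) i).
Proof.
have h (a b : R) : continuous (fun t : R => `|a + t * b|).
  move=> t; apply: (@cvg_norm R R); apply: cvgD; first exact: cvg_cst.
  by apply: cvgMl; exact: cvg_id.
have -> : (fun t : R => weight_max (r + t *: v) i) = fun t : R =>
    Num.max `|(omega r i).1 + t * (omega v i).1| `|(omega r i).2 + t * (omega v i).2|.
  by apply/funext => t; rewrite /weight_max /omega /= !mxE.
by move=> t; apply: (@continuous_max R R (fun t => `|_|) (fun t => `|_|)); exact: h.
Qed.

Lemma networkB (c : 'cV[R]_n.+1) r v x : network c (r + v) x - network c r x =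
  \sum_(i < n) c (lift ord0 i) 0 * (relu (preact r i x + preact v i x) - relu (preact r i x)).
Proof.
rewrite -[LHS]/((c ord0 0 + \sum_(i < n) c (lift ord0 i) 0 * relu (preact (r + v) i x) : R) -
  (c ord0 0 + \sum_(i < n) c (lift ord0 i) 0 * relu (preact r i x))).
rewrite opprD addrACA subrr add0r -sumrB; apply: eq_bigr => i _.
by rewrite preactD mulrBr.
Qed.

End Preactivation.

Lemma cvg_bigsum {R : realType} (T : Type) (G : set_system T) {FG : Filter G} (I : Type) (t : seq I) 
  (h : I -> T -> R) (a : I -> R) :
  (forall i, h i x @[x --> G] --> a i) -> \sum_(i <- t) h i x @[x --> G] --> \sum_(i <- t) a i.
Proof.
move=> ha; elim: t => [|i t IH].
  by under eq_fun do rewrite big_nil; rewrite big_nil; exact: cvg_cst.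
by under eq_fun do rewrite big_cons; rewrite big_cons; exact: cvgD.
Qed.

(** * Bounds on compact sets of reals *)

Section Compact.
Context {R : realType}.
Implicit Types (f : R -> R) (K : set R).

Lemma compact_bound f K :
  compact K -> {in K, continuous f} -> exists2 C, 0 <= C & forall t, K t -> `|f t| <= C.
Proof.
move=> cK cf.
have cfK : {within K, continuous f} by apply: continuous_in_subspaceT.
have /compact_bounded[C0 [_ h]] := continuous_compact cfK cK.
exists (`|C0| + 1) => // t Kt; apply: (h (`|C0| + 1)); last by exists t.
by have := ler_norm C0; lra.
Qed.

Lemma support_bound K : compact K -> exists2 B, 0 < B & forall t, K t -> `|t| <= B.
Proof.
move=> cK; have [C C0 h] := compact_bound cK (f := id) (fun t _ => @cvg_id _ (nbhs t)).
by exists (C + 1) => [|t /h ?]; lra.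
Qed.

End Compact.

(** What is needed to differentiate twice a functional [T] with first derivative
    [DT] and second derivative [Q]. It is stable under sums, so that the two
    regions can be treated separately. *)
Record smooth_model {R : realType} {n : nat} (U : set 'cV[R]_(n * 3)) (T : 'cV[R]_(n * 3) -> R)
    (DT : 'cV[R]_(n * 3) -> 'cV[R]_(n * 3) -> R) (Q : 'cV[R]_(n * 3) -> 'cV[R]_(n * 3) -> 'cV[R]_(n * 3) -> R) := SmoothModel {
  model_taylor : forall r, U r -> exists C, forall v, `|T (r + v) - T r - DT r v| <= C * `|v| ^+ 2;
  model_linear : forall r v, DT r v = \sum_a DT r (delta_mx a 0) * v a 0;
  model_lip : forall r v e (K : set R), compact K -> (forall t, K t -> U (r + t *: v)) ->
    exists C, forall t w, K t -> `|DT (r + t *: v + w) e - DT (r + t *: v) e| <= C * `|w|;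
  model_central : forall r v e, U r ->
    (2 * s)^-1 * (DT (r + s *: v) e - DT (r - s *: v) e) @[s --> 0^'+] --> Q r v e }.

(** * The quadratic functional of one region *)

Section Region.
Context {R : realType} {n : nat}.
Variables (S : set (plane R)) (c : 'cV[R]_n.+1).
Variables (alpha : bool -> plane R -> R) (psi : bool -> plane R -> plane R) (F : plane R -> R).
Variables (Ba Y CF A : R).
Implicit Types (r v e : 'cV[R]_(n * 3)) (x : plane R) (i : 'I_n) (l : bool).
Hypotheses (mS : measurable (S : set (mplane R))) (fS : (area_meas (S : set (mplane R)) < +oo)%E).
Hypothesis malpha : forall l, measurable_fun (S : set (mplane R)) (alpha l).
Hypothesis balpha : forall l x, S x -> `|alpha l x| <= Ba.
Hypothesis mpsi1 : forall l, measurable_fun (S : set (mplane R)) (fun x => (psi l x).1).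
Hypothesis mpsi2 : forall l, measurable_fun (S : set (mplane R)) (fun x => (psi l x).2).
Hypothesis bpsi : forall l x, S x -> 1 + `|(psi l x).1| + `|(psi l x).2| <= Y.
Hypotheses (mF : measurable_fun (S : set (mplane R)) F) (bF : forall x, S x -> `|F x| <= CF).
Hypotheses (Ba0 : 0 <= Ba) (Y0 : 0 <= Y) (CF0 : 0 <= CF) (A0 : 0 <= A).

Notation cf i := (c (lift ord0 i) 0).

Definition pre l r i x : R := preact r i (psi l x).

Hypothesis band : forall l r i (g : plane R -> R) (C t : R), omega r i <> 0 -> 0 <= C -> 0 <= t ->
  measurable_fun (S : set (mplane R)) g -> (forall x, S x -> `|g x| <= C) ->
  (forall x, S x -> t < `|pre l r i x| -> g x = 0) ->
  `|\int[area_meas]_(x in S) g x| <= C * t * (A / weight_max r i).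

(** The shape shared by all first-order variations of the residual. *)
Definition channel_sum (a : bool -> 'I_n -> R) x : R := \sum_l alpha l x * (\sum_i cf i * a l i).

Definition residual r x : R := \sum_l alpha l x * network c r (psi l x) - F x.

(** The derivative of the residual in the direction [e]. *)
Definition residual_diff r e x : R := channel_sum (fun l i => heaviside (pre l r i x) * pre l e i x) x.

(** The number of pairs (channel, neuron) that are within [t] of their kink at
    [x]; the error terms are supported where it is positive. *)
Definition crossings r t x : R := \sum_l \sum_i (`|pre l r i x| <= t)%R%:R.

Definition energy r : R := 2^-1 * Int S (fun x => residual r x ^+ 2).

Definition energy_diff r e : R := Int S (fun x => residual r x * residual_diff r e x).

Lemma pre_bm l r i : bounded_meas S (pre l r i).
Proof.
split; last by exists (`|r| * Y) => x Sx; apply: le_trans (preact_bound _ _ _) _; rewrite ler_wpM2l//; exact: bpsi.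
rewrite /pre; under eq_fun do rewrite preactE.
apply: measurable_funD; last exact: measurable_funM.
by apply: measurable_funD => //; exact: measurable_funM.
Qed.

Lemma pre_bound l r i x : S x -> `|pre l r i x| <= Y * `|r|.
Proof. by move=> Sx; apply: le_trans (preact_bound _ _ _) _; rewrite mulrC ler_wpM2r//; exact: bpsi. Qed.

Lemma alpha_bm l : bounded_meas S (alpha l).
Proof. by split => //; exists Ba; exact: balpha. Qed.

Lemma F_bm : bounded_meas S F.
Proof. by split => //; exists CF. Qed.

Lemma heaviside_bm l r i : bounded_meas S (fun x => heaviside (pre l r i x)).
Proof.
apply: (bm_comp (C := 1) (pre_bm l r i)); first exact: measurable_heaviside.
move=> t; have /andP[? ?] := heaviside_itv t; rewrite ger0_norm//.
by have := normr_ge0 t; lra.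
Qed.

Lemma network_bm l r : bounded_meas S (fun x => network c r (psi l x)).
Proof.
apply: bmD; first exact: bm_cst.
apply: bm_sum => i; apply: bmZ; apply: (bm_comp (C := 0) (pre_bm l r i)).
  exact: measurable_relu.
by move=> t; rewrite addr0 norm_relu.
Qed.

Lemma residual_bm r : bounded_meas S (residual r).
Proof.
by apply: bmB; [apply: bm_sum => l; apply: bmM; [exact: alpha_bm|exact: network_bm]|exact: F_bm].
Qed.

Lemma channel_sum_bm (a : plane R -> bool -> 'I_n -> R) :
  (forall l i, bounded_meas S (fun x => a x l i)) -> bounded_meas S (fun x => channel_sum (a x) x).
Proof.
move=> ba; apply: bm_sum => l; apply: bmM; first exact: alpha_bm.
by apply: bm_sum => i; exact: bmZ.
Qed.

Lemma residual_diff_bm r e : bounded_meas S (residual_diff r e).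
Proof. by apply: channel_sum_bm => l i; apply: bmM; [exact: heaviside_bm|exact: pre_bm]. Qed.

Lemma indic_bm l r i t : bounded_meas S (fun x => (`|pre l r i x| <= t)%R%:R).
Proof.
split; last by exists 1 => x _; rewrite normr_nat; case: (`|pre l r i x| <= t).
have [mp _] := bm_norm (pre_bm l r i).
move=> mD; have mb : measurable_fun (S : set (mplane R)) (fun x => `|pre l r i x| <= t) by exact: measurable_fun_ler.
have mn : measurable_fun [set: bool] (fun b : bool => b%:R : R) by [].
exact: (measurableT_comp mn mb).
Qed.

Lemma crossings_bm r t : bounded_meas S (crossings r t).
Proof. by apply: bm_sum => l; apply: bm_sum => i; exact: indic_bm. Qed.

Definition gain0 : R := Ba * \sum_i `|cf i|.

Lemma gain0_ge0 : 0 <= gain0.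
Proof. by rewrite mulr_ge0// sumr_ge0. Qed.

Lemma channel_sum_le (a b : bool -> 'I_n -> R) (M : R) x : S x -> 0 <= M ->
  (forall l i, `|a l i| <= M * b l i) -> (forall l i, 0 <= b l i) ->
  `|channel_sum a x| <= gain0 * M * \sum_l \sum_i b l i.
Proof.
move=> Sx M0 ab b0; rewrite mulr_sumr; apply: le_trans (ler_norm_sum _ _ _) _.
apply: ler_sum => l _; rewrite normrM /gain0 -mulrA -mulrA; apply: ler_pM => //.
  exact: balpha.
rewrite mulrA mulr_sumr; apply: le_trans (ler_norm_sum _ _ _) _; apply: ler_sum => i _.
rewrite normrM -mulrA; apply: ler_pM => //.
by rewrite (bigD1 i)//= lerDl sumr_ge0.
Qed.

Lemma channel_sumB (a b : bool -> 'I_n -> R) x :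
  channel_sum a x - channel_sum b x = channel_sum (fun l i => a l i - b l i) x.
Proof.
rewrite /channel_sum -sumrB; apply: eq_bigr => l _; rewrite -mulrBr -sumrB.
by congr (_ * _); apply: eq_bigr => i _; rewrite mulrBr.
Qed.

Lemma residualB r v x : residual (r + v) x - residual r x =
  channel_sum (fun l i => relu (pre l r i x + pre l v i x) - relu (pre l r i x)) x.
Proof.
rewrite /residual opprB addrA subrK -sumrB; apply: eq_bigr => l _.
by rewrite -mulrBr networkB.
Qed.

Definition num_terms : R := \sum_(l : bool) \sum_(i < n) 1.

Lemma num_terms_ge0 : 0 <= num_terms.
Proof. by apply: sumr_ge0 => l _; exact: sumr_ge0. Qed.

Definition gain : R := gain0 * Y.

Lemma gain_ge0 : 0 <= gain. Proof. by rewrite mulr_ge0// gain0_ge0. Qed.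

Lemma residual_lip r v x : S x -> `|residual (r + v) x - residual r x| <= gain * `|v| * num_terms.
Proof.
move=> Sx; rewrite residualB /gain -(mulrA gain0); apply: channel_sum_le => //; first exact: mulr_ge0.
by move=> l i; rewrite mulr1; apply: le_trans (relu_lip _ _) _; exact: pre_bound.
Qed.

Lemma indic_mono (a t t' : R) : t <= t' -> (a <= t)%R%:R <= (a <= t')%R%:R :> R.
Proof. by move=> tt; case: (leP a t) => // h; rewrite (le_trans h tt). Qed.

(** Channelwise [relu_taylor], since a preactivation moves by at most [Y * |v|]. *)
Lemma residual_taylor r v x : S x ->
  `|residual (r + v) x - residual r x - residual_diff r v x| <= gain * `|v| * crossings r (Y * `|v|) x.
Proof.
move=> Sx; rewrite residualB /residual_diff channel_sumB /gain -(mulrA gain0); apply: channel_sum_le => //; first exact: mulr_ge0.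
move=> l i; apply: le_trans (relu_taylor _ _) _; apply: ler_pM => //.
  exact: pre_bound.
by apply: indic_mono; exact: pre_bound.
Qed.

Lemma residual_diff_bound r e x : S x -> `|residual_diff r e x| <= gain * `|e| * num_terms.
Proof.
move=> Sx; rewrite /gain -(mulrA gain0); apply: channel_sum_le => //; first exact: mulr_ge0.
move=> l i; rewrite mulr1 normrM -[leRHS]mul1r; apply: ler_pM => //; last exact: pre_bound.
by have /andP[? ?] := heaviside_itv (pre l r i x); rewrite ger0_norm.
Qed.

(** Channelwise [heaviside_shift]. *)
Lemma residual_diff_jump r v e x : S x ->
  `|residual_diff (r + v) e x - residual_diff r e x| <= gain * `|e| * crossings r (Y * `|v|) x.
Proof.
move=> Sx; rewrite /residual_diff channel_sumB /gain -(mulrA gain0); apply: channel_sum_le => //; first exact: mulr_ge0.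
move=> l i; rewrite -mulrBl normrM mulrC; apply: ler_pM => //; first exact: pre_bound.
rewrite {1}/pre preactD; apply: le_trans (heaviside_shift _ _) _.
by apply: indic_mono; exact: pre_bound.
Qed.

Definition offset_bound : R := \sum_(l : bool) Ba * `|c ord0 0| + CF.

Lemma residual_bound_ge0 r : 0 <= gain * `|r| * num_terms + offset_bound.
Proof.
apply: addr_ge0.
  by apply: mulr_ge0; [apply: mulr_ge0; [exact: gain_ge0|]|exact: num_terms_ge0].
by apply: addr_ge0 => //; apply: sumr_ge0 => l _; exact: mulr_ge0.
Qed.

Lemma residual_bound r x : S x -> `|residual r x| <= gain * `|r| * num_terms + offset_bound.
Proof.
move=> Sx; have := residual_lip 0 r Sx; rewrite add0r => h.
have -> : residual r x = (residual r x - residual 0 x) + residual 0 x by ring.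
apply: le_trans (ler_normD _ _) _; apply: lerD => //.
apply: le_trans (ler_normB _ _) _; apply: lerD; last exact: bF.
apply: le_trans (ler_norm_sum _ _ _) _; apply: ler_sum => l _.
rewrite normrM; apply: ler_pM => //; first exact: balpha.
rewrite /network big1 ?addr0// => i _.
by rewrite -(scale0r 0) preactZ mul0r relu_ge0 ?mulr0.
Qed.

Definition band_gain r : R := \sum_(l : bool) \sum_i A / weight_max r i.

(** This is the hypothesis [band], summed over the channels and the neurons. *)
Lemma crossings_area r t :
  0 <= t -> (forall i, omega r i <> 0) -> Int S (crossings r t) <= t * band_gain r.
Proof.
move=> t0 w0; rewrite /crossings /band_gain Int_sum//; last by move=> l; apply: bm_sum => i; exact: indic_bm.
rewrite mulr_sumr; apply: ler_sum => l _; rewrite Int_sum//; last by move=> i; exact: indic_bm.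
rewrite mulr_sumr; apply: ler_sum => i _; apply: le_trans (ler_norm _) _.
rewrite -[X in _ <= X]mul1r mulrA.
apply: (@band l r i) => //; first by have [] := indic_bm l r i t.
  by move=> x _; rewrite normr_nat; case: (`|pre l r i x| <= t).
by move=> x _ h; rewrite leNgt h.
Qed.

Definition area_S : R := fine (area_meas (S : set (mplane R))).

Lemma residual_sq_bm r : bounded_meas S (fun x => residual r x ^+ 2).
Proof. by under eq_fun do rewrite expr2; apply: bmM; exact: residual_bm. Qed.

(** The difference is half the square of the increment of the residual, plus the
    residual times the Taylor remainder of the residual; the latter is [O(|v|)]
    on a set of area [O(|v|)]. *)
Lemma energy_taylor r v : (forall i, omega r i <> 0) ->
  `|energy (r + v) - energy r - energy_diff r v| <=
  (2^-1 * (gain * num_terms) ^+ 2 * area_S + (gain * `|r| * num_terms + offset_bound) * gain * Y * band_gain r) * `|v| ^+ 2.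
Proof.
move=> w0; rewrite /energy /energy_diff -mulrBr -IntB//; [|exact: residual_sq_bm|exact: residual_sq_bm].
have b1 : bounded_meas S (fun x => residual (r + v) x ^+ 2 - residual r x ^+ 2) by apply: bmB; exact: residual_sq_bm.
have b2 : bounded_meas S (fun x => residual r x * residual_diff r v x) by apply: bmM; [exact: residual_bm|exact: residual_diff_bm].
rewrite -IntZ// -IntB//; last exact: bmZ.
pose B := gain * `|r| * num_terms + offset_bound.
have B0 : 0 <= B := residual_bound_ge0 r.
have b3 : bounded_meas S (fun x => 2^-1 * (gain * `|v| * num_terms) ^+ 2 + B * (gain * `|v|) * crossings r (Y * `|v|) x).
  by apply: bmD; [exact: bm_cst|apply: bmZ; exact: crossings_bm].
apply: le_trans (Int_abs_le mS fS (g := fun x => 2^-1 * (gain * `|v| * num_terms) ^+ 2 + B * (gain * `|v|) * crossings r (Y * `|v|) x) _ b3 _) _.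
- by apply: bmB => //; exact: bmZ.
- move=> x Sx.
  have -> : 2^-1 * (residual (r + v) x ^+ 2 - residual r x ^+ 2) - residual r x * residual_diff r v x =
     2^-1 * (residual (r + v) x - residual r x) ^+ 2 + residual r x * (residual (r + v) x - residual r x - residual_diff r v x) by field.
  apply: le_trans (ler_normD _ _) _; apply: lerD.
    rewrite normrM normrX ger0_norm ?invr_ge0// ler_pM2l ?invr_gt0//.
    have KvN : 0 <= gain * `|v| * num_terms := mulr_ge0 (mulr_ge0 gain_ge0 (normr_ge0 v)) num_terms_ge0.
    by rewrite !expr2; apply: ler_pM; rewrite ?normr_ge0//; exact: residual_lip.
  rewrite normrM -mulrA; apply: ler_pM => //; [exact: residual_bound|exact: residual_taylor].
rewrite IntD//; [|exact: bm_cst|by apply: bmZ; exact: crossings_bm].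
rewrite Int_cst// IntZ//; last exact: crossings_bm.
have -> : (2^-1 * (gain * num_terms) ^+ 2 * area_S + (gain * `|r| * num_terms + offset_bound) * gain * Y * band_gain r) * `|v| ^+ 2 =
  2^-1 * (gain * `|v| * num_terms) ^+ 2 * area_S + B * (gain * `|v|) * (Y * `|v| * band_gain r) by rewrite /B; ring.
apply: lerD; first by [].
have := crossings_area (mulr_ge0 Y0 (normr_ge0 v)) w0.
by move=> /(ler_wpM2l (mulr_ge0 B0 (mulr_ge0 gain_ge0 (normr_ge0 v)))).
Qed.

Definition energy_diff_lip r e : R := `|e| * (gain ^+ 2 * num_terms ^+ 2 * area_S + (gain * `|r| * num_terms + offset_bound) * gain * Y * band_gain r).

(** The residual changes by [O(|v|)]; its derivative changes by a bounded amount,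
    but only on a set of area [O(|v|)]. *)
Lemma energy_diff_lipschitz r v e : (forall i, omega r i <> 0) ->
  `|energy_diff (r + v) e - energy_diff r e| <= energy_diff_lip r e * `|v|.
Proof.
move=> w0; rewrite /energy_diff.
have b r' : bounded_meas S (fun x => residual r' x * residual_diff r' e x) by apply: bmM; [exact: residual_bm|exact: residual_diff_bm].
rewrite -IntB//.
pose B := gain * `|r| * num_terms + offset_bound.
have B0 : 0 <= B := residual_bound_ge0 r.
have b3 : bounded_meas S (fun x => (gain * `|v| * num_terms) * (gain * `|e| * num_terms) + B * (gain * `|e|) * crossings r (Y * `|v|) x).
  by apply: bmD; [exact: bm_cst|apply: bmZ; exact: crossings_bm].
apply: le_trans (Int_abs_le mS fS (g := fun x => (gain * `|v| * num_terms) * (gain * `|e| * num_terms) + B * (gain * `|e|) * crossings r (Y * `|v|) x) _ b3 _) _.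
- exact: bmB.
- move=> x Sx.
  have -> : residual (r + v) x * residual_diff (r + v) e x - residual r x * residual_diff r e x =
     (residual (r + v) x - residual r x) * residual_diff (r + v) e x + residual r x * (residual_diff (r + v) e x - residual_diff r e x) by ring.
  apply: le_trans (ler_normD _ _) _; apply: lerD; rewrite normrM.
    by apply: ler_pM => //; [exact: residual_lip|exact: residual_diff_bound].
  by rewrite -mulrA; apply: ler_pM => //; [exact: residual_bound|exact: residual_diff_jump].
rewrite IntD//; [|exact: bm_cst|by apply: bmZ; exact: crossings_bm].
rewrite Int_cst// IntZ//; last exact: crossings_bm.
have -> : energy_diff_lip r e * `|v| = (gain * `|v| * num_terms) * (gain * `|e| * num_terms) * area_S + B * (gain * `|e|) * (Y * `|v| * band_gain r).
  by rewrite /energy_diff_lip /B; ring.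
apply: lerD.
  by [].
have := crossings_area (mulr_ge0 Y0 (normr_ge0 v)) w0.
by move=> /(ler_wpM2l (mulr_ge0 B0 (mulr_ge0 gain_ge0 (normr_ge0 e)))).
Qed.

Variable E : set (plane R).
Hypothesis talpha : forall l, tame S E (alpha l).
Hypothesis tpsi1 : forall l, tame S E (fun x => (psi l x).1).
Hypothesis tpsi2 : forall l, tame S E (fun x => (psi l x).2).
Hypothesis tF : tame S E F.
Hypothesis layer : forall l r i p, omega r i <> 0 -> bounded_meas S p -> tame S E p ->
  exists v : R, forall q w kern, jump_kernel kern -> bounded_meas S q -> bounded_meas S w -> tame S E q -> tame S E w ->
   (forall x, S x -> q x * w x = p x) ->
   \int[area_meas]_(x in S) ((2 * s)^-1 * (q x * kern (pre l r i x) (s * w x))) @[s --> 0^'+] --> v.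

Lemma pre_tame l r i : tame S E (pre l r i).
Proof.
apply: (eq_tame (k := fun x => neuron r i (inord 0) 0 + (omega r i).1 * (psi l x).1 + (omega r i).2 * (psi l x).2)).
  by move=> x _; rewrite /pre preactE.
by apply: tameD; [apply: tameD; [exact: tame_cst|]|]; apply: tameM => //; exact: tame_cst.
Qed.

Lemma residual_tame r : tame S E (residual r).
Proof.
apply: tameD; last exact: tameN.
apply: tame_sum => l; apply: tameM => //; apply: tameD; first exact: tame_cst.
apply: tame_sum => i; apply: tameM; first exact: tame_cst.
by apply: tame_comp; [exact: continuous_relu|exact: pre_tame].
Qed.

Lemma residual_diffZ s r v x : residual_diff r (s *: v) x = s * residual_diff r v x.
Proof.
rewrite /residual_diff /channel_sum mulr_sumr; apply: eq_bigr => l _; rewrite mulrCA; congr (_ * _).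
by rewrite mulr_sumr; apply: eq_bigr => i _; rewrite /pre preactZ; ring.
Qed.

Lemma residual_diffN r v x : residual_diff r (- v) x = - residual_diff r v x.
Proof. by rewrite -scaleN1r residual_diffZ mulN1r. Qed.

(** The second derivative of the residual in the directions [e] and [v], with the
    delta function replaced by its approximation and without the output
    weights. *)
Definition shell (s : R) r e v x : R :=
  \sum_l alpha l x * (\sum_i delta_approx s (pre l r i x) * pre l e i x * pre l v i x).

Definition weight_scale v : 'cV[R]_(n * 3) := (Dhat c *t (1%:M : 'M[R]_3)) *m v.

Lemma scaleE v i (k : 'I_3) : weight_scale v (mxtens_index (i, k)) 0 = cf i * v (mxtens_index (i, k)) 0.
Proof.
rewrite mxE (bigD1 (mxtens_index (i, k)))//= big1 ?addr0.
  by rewrite tensmxE !mxE !eqxx mulr1n mulr1.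
move=> b bik; case: (mxtens_indexP b) bik => j k' jk.
rewrite tensmxE !mxE; have [ij|ij] := eqVneq i j; last by rewrite mulr0n mul0r mul0r.
have [kk|kk] := eqVneq k k'; last by rewrite mulr0 mul0r.
by rewrite ij kk eqxx in jk.
Qed.

Lemma pre_scale l v i x : pre l (weight_scale v) i x = cf i * pre l v i x.
Proof.
rewrite /pre /preact.
suff -> : neuron (weight_scale v) i = cf i *: neuron v i by rewrite linearZ/= -scalemxAl mxE.
by apply/colP => k; rewrite mxE scaleE !mxE.
Qed.

Definition central_quot r v e s : R := (2 * s)^-1 * (energy_diff (r + s *: v) e - energy_diff (r - s *: v) e).

Definition diff_jump r v e s x : R := residual_diff (r + s *: v) e x - residual_diff (r - s *: v) e x.

Lemma jumpsE r v e s x : diff_jump r v e s x =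
  \sum_l \sum_i cf i * (alpha l x * pre l e i x * heaviside_jump (pre l r i x) (s * pre l v i x)).
Proof.
rewrite /diff_jump channel_sumB /channel_sum; apply: eq_bigr => l _; rewrite mulr_sumr; apply: eq_bigr => i _.
by rewrite /heaviside_jump {1 3}/pre !preactD preactN preactZ; ring.
Qed.

(** The jumps of [residual_diff] are bounded and supported on a set of area
    [O(s)]; so whatever is multiplied by them may be replaced by its value up
    to [O(s)]. *)
Lemma central_error r v e s : 0 < s -> (forall i, omega r i <> 0) ->
  `|central_quot r v e s - Int S (fun x => residual_diff r v x * residual_diff r e x) -
    Int S (fun x => (2 * s)^-1 * (residual r x * diff_jump r v e s x))| <=
  s * (3 * gain ^+ 2 * `|v| ^+ 2 * `|e| * num_terms * Y * band_gain r).
Proof.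
move=> s0 w0; rewrite /central_quot /energy_diff.
have b r' : bounded_meas S (fun x => residual r' x * residual_diff r' e x) by apply: bmM; [exact: residual_bm|exact: residual_diff_bm].
have bj : bounded_meas S (diff_jump r v e s) by apply: bmB; exact: residual_diff_bm.
have bl : bounded_meas S (fun x => residual_diff r v x * residual_diff r e x) by apply: bmM; exact: residual_diff_bm.
have brj : bounded_meas S (fun x => residual r x * diff_jump r v e s x) by apply: bmM => //; exact: residual_bm.
rewrite -IntB// -IntZ//; last exact: bmB.
rewrite -IntB//; last by apply: bmZ; exact: bmB.
rewrite -IntB//; [|by apply: bmB => //; apply: bmZ; exact: bmB|exact: bmZ].
pose g x := (2 * s)^-1 * (6 * gain ^+ 2 * s * `|v| * `|e| * num_terms) * crossings r (Y * (s * `|v|)) x.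
have bg : bounded_meas S g by apply: bmZ; exact: crossings_bm.
apply: le_trans (Int_abs_le mS fS (g := g) _ bg _) _.
- by apply: bmB; [apply: bmB => //; apply: bmZ; exact: bmB|exact: bmZ].
- move=> x Sx; rewrite /g.
  set rp := residual (r + s *: v) x; set rm := residual (r - s *: v) x.
  set pp := residual_diff (r + s *: v) e x; set pm := residual_diff (r - s *: v) e x.
  set r0 := residual r x; set p0 := residual_diff r e x; set lv := residual_diff r v x; set B := crossings _ _ _.
  have nsv : `|s *: v| = s * `|v| by rewrite normrZ gtr0_norm.
  have s2 : 0 < 2 * s by rewrite mulr_gt0.
  have KN : 0 <= gain * `|e| * num_terms := mulr_ge0 (mulr_ge0 gain_ge0 (normr_ge0 e)) num_terms_ge0.
  have h1 : `|rp - r0 - s * lv| <= gain * (s * `|v|) * B.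
    by have := residual_taylor r (s *: v) Sx; rewrite residual_diffZ nsv.
  have h2 : `|rm - r0 + s * lv| <= gain * (s * `|v|) * B.
    by have := residual_taylor r (- (s *: v)) Sx; rewrite residual_diffN residual_diffZ normrN nsv opprK.
  have h3 : `|pp| <= gain * `|e| * num_terms by exact: residual_diff_bound.
  have h4 : `|pm| <= gain * `|e| * num_terms by exact: residual_diff_bound.
  have h5 : `|lv| <= gain * `|v| * num_terms by exact: residual_diff_bound.
  have h6 : `|pp - p0| <= gain * `|e| * B.
    by have := residual_diff_jump r (s *: v) e Sx; rewrite nsv.
  have h7 : `|pm - p0| <= gain * `|e| * B.
    by have := residual_diff_jump r (- (s *: v)) e Sx; rewrite normrN nsv.
  have h8 : `|rp - r0| <= gain * (s * `|v|) * num_terms.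
    by have := residual_lip r (s *: v) Sx; rewrite nsv.
  have h9 : `|rm - r0| <= gain * (s * `|v|) * num_terms.
    by have := residual_lip r (- (s *: v)) Sx; rewrite normrN nsv.
  (* A difference of products, symmetrised; every term on the right contains a
     factor that is controlled by [B]. *)
  have -> : (2 * s)^-1 * (rp * pp - rm * pm) - lv * p0 - (2 * s)^-1 * (r0 * (pp - pm)) =
    (2 * s)^-1 * ((rp - r0 - s * lv - (rm - r0 + s * lv)) * ((pp + pm) / 2) +
      s * lv * ((pp - p0) + (pm - p0)) + ((rp - r0) + (rm - r0)) / 2 * ((pp - p0) - (pm - p0))).
    by field; rewrite gt_eqF.
  rewrite normrM (ger0_norm (_ : 0 <= (2 * s)^-1)) ?invr_ge0 ?(ltW s2)// -[leRHS]mulrA ler_pM2l ?invr_gt0//.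
  have B0 : 0 <= B by apply: sumr_ge0 => l _; apply: sumr_ge0.
  have a1 : `|rp - r0 - s * lv - (rm - r0 + s * lv)| <= 2 * (gain * (s * `|v|) * B).
    by apply: le_trans (ler_normB _ _) _; rewrite mulr_natl mulr2n lerD.
  have a2 : `|(pp + pm) / 2| <= gain * `|e| * num_terms.
    rewrite normrM normfV (ger0_norm (ler0n R 2)) ler_pdivrMr//.
    by apply: le_trans (ler_normD _ _) _; rewrite mulr_natr mulr2n lerD.
  have a3 : `|s * lv| <= s * (gain * `|v| * num_terms) by rewrite normrM gtr0_norm// ler_pM2l.
  have a4 : `|(pp - p0) + (pm - p0)| <= 2 * (gain * `|e| * B).
    by apply: le_trans (ler_normD _ _) _; rewrite mulr_natl mulr2n lerD.
  have a5 : `|(pp - p0) - (pm - p0)| <= 2 * (gain * `|e| * B).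
    by apply: le_trans (ler_normB _ _) _; rewrite mulr_natl mulr2n lerD.
  have a6 : `|((rp - r0) + (rm - r0)) / 2| <= gain * (s * `|v|) * num_terms.
    rewrite normrM normfV (ger0_norm (ler0n R 2)) ler_pdivrMr//.
    by apply: le_trans (ler_normD _ _) _; rewrite mulr_natr mulr2n lerD.
  apply: (@le_trans _ _ (2 * (gain * (s * `|v|) * B) * (gain * `|e| * num_terms) + s * (gain * `|v| * num_terms) * (2 * (gain * `|e| * B))
     + gain * (s * `|v|) * num_terms * (2 * (gain * `|e| * B)))).
    apply: le_trans (ler_normD _ _) _; apply: lerD; last by rewrite normrM; exact: ler_pM.
    by apply: le_trans (ler_normD _ _) _; apply: lerD; rewrite normrM; exact: ler_pM.
  by rewrite le_eqVlt; apply/orP; left; apply/eqP; ring.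
rewrite IntZ//; last exact: crossings_bm.
have D0 : 0 <= (2 * s)^-1 * (6 * gain ^+ 2 * s * `|v| * `|e| * num_terms).
  apply: mulr_ge0; first by rewrite invr_ge0 mulr_ge0// ltW.
  apply: (mulr_ge0 (mulr_ge0 (mulr_ge0 (mulr_ge0 (mulr_ge0 _ _) (ltW s0)) _) _) num_terms_ge0) => //.
  by rewrite exprn_ge0// gain_ge0.
have := crossings_area (mulr_ge0 Y0 (mulr_ge0 (ltW s0) (normr_ge0 v))) w0.
move=> /(ler_wpM2l D0) h; apply: (le_trans h).
by rewrite le_eqVlt; apply/orP; left; apply/eqP; field; rewrite gt_eqF.
Qed.

(** The jump term and the shell term are integrals with two jump kernels and the
    same product [q * w]; by [layer] they have the same limit. *)
Lemma central_limit r : (forall i, omega r i <> 0) ->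
  (forall e v, cvg (Int S (fun x => residual r x * shell s r e v x) @[s --> 0^'+])) /\
  forall v e, central_quot r v e s @[s --> 0^'+] --> Int S (fun x => residual_diff r v x * residual_diff r e x) +
    lim (Int S (fun x => residual r x * shell s r e (weight_scale v) x) @[s --> 0^'+]).
Proof.
move=> w0.
pose q l i e x := residual r x * alpha l x * pre l e i x.
have bq l i e : bounded_meas S (q l i e).
  by apply: bmM; [apply: bmM; [exact: residual_bm|exact: alpha_bm]|exact: pre_bm].
have tq l i e : tame S E (q l i e).
  by apply: tameM; [apply: tameM => //; exact: residual_tame|exact: pre_tame].
have bj s l i v : bounded_meas S (fun x => heaviside_jump (pre l r i x) (s * pre l v i x)).
  split; last first.
    by exists 1 => x _; have [h _ _ _ _] := @heaviside_jump_kernel R; exact: h.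
  have [m _] := pre_bm l r i; have [m' _] := bmZ s (pre_bm l v i).
  exact: (measurable_fun_kernel (@heaviside_jump_kernel R) m m').
have bd s l i : bounded_meas S (fun x => delta_jump (pre l r i x) (s * 1)).
  split; last first.
    by exists 1 => x _; have [h _ _ _ _] := @delta_jump_kernel R; exact: h.
  have [m _] := pre_bm l r i; have [m' _] := bm_cst S (s * 1).
  exact: (measurable_fun_kernel (@delta_jump_kernel R) m m').
pose J l i e v s := Int S (fun x => (2 * s)^-1 * (q l i e x * heaviside_jump (pre l r i x) (s * pre l v i x))).
pose D l i e v s := Int S (fun x => (2 * s)^-1 * (q l i e x * pre l v i x * delta_jump (pre l r i x) (s * 1))).
have [W hW] : exists W : bool * 'I_n * 'cV[R]_(n * 3) * 'cV[R]_(n * 3) -> R, forall z,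
    J z.1.1.1 z.1.1.2 z.1.2 z.2 s @[s --> 0^'+] --> W z /\ D z.1.1.1 z.1.1.2 z.1.2 z.2 s @[s --> 0^'+] --> W z.
  suff /choice_fun[W hW] : forall z : bool * 'I_n * 'cV[R]_(n * 3) * 'cV[R]_(n * 3), exists W : R,
    J z.1.1.1 z.1.1.2 z.1.2 z.2 s @[s --> 0^'+] --> W /\ D z.1.1.1 z.1.1.2 z.1.2 z.2 s @[s --> 0^'+] --> W.
    by exists W.
  move=> [[[l i] e] v] /=.
  have [W hW] := @layer l r i (fun x => q l i e x * pre l v i x) (w0 i) (bmM (bq _ _ _) (pre_bm l v i)) (tameM (tq _ _ _) (pre_tame l v i)).
  exists W; split.
    by apply: hW => //; [exact: heaviside_jump_kernel|exact: pre_bm|exact: pre_tame].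
  apply: hW => //; [exact: delta_jump_kernel|by apply: bmM => //; exact: pre_bm|exact: bm_cst| |exact: tame_cst|].
    by apply: tameM => //; exact: pre_tame.
  by move=> x _; rewrite mulr1.
have shellE e v s : 0 < s -> Int S (fun x => residual r x * shell s r e v x) = \sum_l \sum_i D l i e v s.
  move=> s0; rewrite /D.
  have b l i : bounded_meas S (fun x => (2 * s)^-1 * (q l i e x * pre l v i x * delta_jump (pre l r i x) (s * 1))).
    by apply: bmZ; apply: bmM => //; apply: bmM => //; exact: pre_bm.
  under eq_bigr do rewrite -Int_sum//.
  rewrite -Int_sum//; last by move=> l; exact: bm_sum.
  apply: eq_Int => x _; rewrite /shell mulr_sumr; apply: eq_bigr => l _.
  rewrite !mulr_sumr; apply: eq_bigr => i _; rewrite delta_jumpE// mulr1 /q; ring.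
have jumpsI e v s : Int S (fun x => (2 * s)^-1 * (residual r x * diff_jump r v e s x)) = \sum_l \sum_i cf i * J l i e v s.
  rewrite /J.
  have b l i : bounded_meas S (fun x => (2 * s)^-1 * (q l i e x * heaviside_jump (pre l r i x) (s * pre l v i x))).
    by apply: bmZ; apply: bmM.
  under eq_bigr do under eq_bigr do rewrite -IntZ//.
  under eq_bigr do (rewrite -Int_sum//; last by move=> i; exact: bmZ).
  rewrite -Int_sum//; last by move=> l; apply: bm_sum => i; exact: bmZ.
  apply: eq_Int => x _; rewrite jumpsE !mulr_sumr; apply: eq_bigr => l _.
  rewrite !mulr_sumr; apply: eq_bigr => i _; rewrite /q; ring.
have shellcv e v : Int S (fun x => residual r x * shell s r e v x) @[s --> 0^'+] --> \sum_l \sum_i W (l, i, e, v).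
  apply: (@cvg_trans _ ((fun s => \sum_l \sum_i D l i e v s) @ 0^'+)).
    by apply: near_eq_cvg; near=> s; rewrite shellE//; near: s; exact: nbhs_right_gt.
  by apply: cvg_bigsum => l; apply: cvg_bigsum => i; exact: (hW (l, i, e, v)).2.
split => [e v|v e]; first by apply/cvg_ex; exists (\sum_l \sum_i W (l, i, e, v)); exact: shellcv.
have scv : Int S (fun x => residual r x * shell s r e (weight_scale v) x) @[s --> 0^'+] --> \sum_l \sum_i cf i * W (l, i, e, v).
  apply: (@cvg_trans _ ((fun s => \sum_l \sum_i cf i * D l i e v s) @ 0^'+)).
    apply: near_eq_cvg; near=> s; rewrite shellE//.
    apply: eq_bigr => l _; apply: eq_bigr => i _; rewrite /D -IntZ//; last first.
      by apply: bmZ; apply: bmM => //; apply: bmM => //; exact: pre_bm.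
    by apply: eq_Int => x _; rewrite pre_scale; ring.
  by apply: cvg_bigsum => l; apply: cvg_bigsum => i; apply: cvgMr; exact: (hW (l, i, e, v)).2.
rewrite (cvg_lim _ scv)//.
have jcv : \sum_l \sum_i cf i * J l i e v s @[s --> 0^'+] --> \sum_l \sum_i cf i * W (l, i, e, v).
  by apply: cvg_bigsum => l; apply: cvg_bigsum => i; apply: cvgMr; exact: (hW (l, i, e, v)).1.
set I0 := Int S _.
pose C := 3 * gain ^+ 2 * `|v| ^+ 2 * `|e| * num_terms * Y * band_gain r.
have errcv : central_quot r v e s - I0 - \sum_l \sum_i cf i * J l i e v s @[s --> 0^'+] --> (0 : R).
  apply/cvgr0Pnorm_le => d d0; near=> s.
  have s0 : 0 < s by near: s; exact: nbhs_right_gt.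
  rewrite -jumpsI; apply: le_trans (central_error _ _ s0 w0) _.
  apply: (@le_trans _ _ (s * (`|C| + 1))).
    by rewrite ler_pM2l// -/C; have := ler_norm C; lra.
  rewrite -ler_pdivlMr ?ltr_pwDr//; near: s; apply: nbhs_right_le.
  by rewrite divr_gt0// ltr_pwDr.
have -> : central_quot r v e = fun s => I0 + ((central_quot r v e s - I0 - \sum_l \sum_i cf i * J l i e v s) +
    \sum_l \sum_i cf i * J l i e v s) by apply/funext => s; ring.
rewrite -[X in _ --> I0 + X]add0r; apply: cvgD; first exact: cvg_cst.
exact: (cvgD errcv jcv).
Unshelve. all: by end_near.
Qed.

Lemma residual_diffD r u v x : residual_diff r (u + v) x = residual_diff r u x + residual_diff r v x.
Proof.
rewrite /residual_diff /channel_sum -big_split; apply: eq_bigr => l _ /=; rewrite -mulrDr; congr (_ * _).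
by rewrite -big_split; apply: eq_bigr => i _ /=; rewrite /pre preactD; ring.
Qed.

Lemma residual_diff_expand r v x : residual_diff r v x = \sum_a v a 0 * residual_diff r (delta_mx a 0) x.
Proof.
rewrite [in LHS](matrix_sum_delta v).
rewrite (@big_morph _ _ (fun w => residual_diff r w x) 0 +%R); last first.
- by rewrite -(scale0r 0) residual_diffZ mul0r.
- by move=> u w; exact: residual_diffD.
by apply: eq_bigr => a _; rewrite big_ord1 residual_diffZ.
Qed.

Lemma energy_diff_expand r v : energy_diff r v = \sum_a energy_diff r (delta_mx a 0) * v a 0.
Proof.
have b a : bounded_meas S (fun x => residual r x * residual_diff r (delta_mx a 0) x) by apply: bmM; [exact: residual_bm|exact: residual_diff_bm].
under eq_bigr do rewrite mulrC -IntZ//.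
rewrite -Int_sum//; last by move=> a; exact: bmZ.
apply: eq_Int => x _; rewrite residual_diff_expand mulr_sumr; apply: eq_bigr => a _; ring.
Qed.

(** The constant depends on the weights through [1 / weight_max], which is
    bounded on compact sets of nonzero weights. *)
Lemma energy_diff_lip_line r v e (Z : set R) :
  compact Z -> (forall t, Z t -> forall i, omega (r + t *: v) i <> 0) ->
  exists C, forall t, Z t -> energy_diff_lip (r + t *: v) e <= C.
Proof.
move=> cZ w0; have [B B0 hB] := support_bound cZ.
have /choice_fun[D hD] : forall i, exists D, forall t, Z t -> A / weight_max (r + t *: v) i <= D.
  move=> i; have [|D D0 hD] := @compact_bound R (fun t => A / weight_max (r + t *: v) i) Z cZ.
    move=> t /[1!inE] Zt; apply: cvgMr; apply: cvgV; last exact: omax_line.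
    by rewrite gt_eqF// omax_gt0//; exact: w0.
  by exists D => t /hD; apply: le_trans; exact: ler_norm.
exists (`|e| * (gain ^+ 2 * num_terms ^+ 2 * area_S + (gain * (`|r| + B * `|v|) * num_terms + offset_bound) * gain * Y * \sum_(l : bool) \sum_i D i)) => t Zt.
rewrite /energy_diff_lip ler_wpM2l// lerD2l.
have k0 : 0 <= band_gain (r + t *: v).
  apply: sumr_ge0 => l _; apply: sumr_ge0 => i _; rewrite divr_ge0// ltW// omax_gt0//; exact: w0.
apply: ler_pM => //.
- by apply: mulr_ge0 => //; apply: mulr_ge0; [exact: residual_bound_ge0|exact: gain_ge0].
- rewrite ler_wpM2r// ler_wpM2r ?gain_ge0// lerD2r ler_wpM2r ?num_terms_ge0// ler_wpM2l ?gain_ge0//.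
  apply: le_trans (ler_normD _ _) _; rewrite lerD2l normrZ ler_wpM2r//; exact: hB.
by apply: ler_sum => l _; apply: ler_sum => i _; exact: hD.
Qed.

Theorem region_model : smooth_model [set r | forall i, omega r i <> 0] energy energy_diff
  (fun r v e => Int S (fun x => residual_diff r v x * residual_diff r e x) +
     lim (Int S (fun x => residual r x * shell s r e (weight_scale v) x) @[s --> 0^'+])).
Proof.
split.
- by move=> r w0; eexists => v; exact: energy_taylor.
- exact: energy_diff_expand.
- move=> r v e Z cZ w0; have [C hC] := energy_diff_lip_line e cZ w0.
  exists C => t w Zt; apply: (le_trans (energy_diff_lipschitz w e (w0 t Zt))); rewrite ler_wpM2r//; exact: hC.
- by move=> r v e w0; have [_ h] := central_limit w0; exact: h.
Qed.

Lemma preact_delta i j (k : 'I_3) (y : plane R) :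
  preact (delta_mx (mxtens_index (i, k)) 0 : 'cV[R]_(n * 3)) j y = (i == j)%:R * yvec y k 0.
Proof.
rewrite /preact.
have -> : neuron (delta_mx (mxtens_index (i, k)) 0 : 'cV[R]_(n * 3)) j = (i == j)%:R *: delta_mx k 0.
  apply/colP => k'; rewrite !mxE eqxx !andbT (inj_eq (can_inj (@mxtens_indexK n 3))) xpair_eqE.
  by rewrite [j == i]eq_sym; case: (i == j); rewrite ?mul1r ?mul0r.
rewrite linearZ/= -scalemxAl mxE; congr (_ * _).
rewrite trmx_delta mxE (bigD1 k)//= big1 ?addr0 => [|k' kk].
  by rewrite [X in X * _]mxE !eqxx mul1r.
by rewrite mxE (negbTE kk) andbF mul0r.
Qed.

(** The discrete operators, applied to vector- and matrix-valued functions. *)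
Definition combine p q (V : plane R -> 'M[R]_(p, q)) x : 'M[R]_(p, q) := \sum_l alpha l x *: V (psi l x).

Definition feature r x : 'cV[R]_(n * 3) := combine (fun y => Hvec r y *t yvec y) x.

Definition feature_grad s r x : 'M[R]_(n * 3) :=
  combine (fun y => Lambda s r y *t (yvec y *m (yvec y)^T)) x.

Lemma featureE r i (k : 'I_3) x : feature r x (mxtens_index (i, k)) 0 =
  \sum_l alpha l x * (heaviside (pre l r i x) * yvec (psi l x) k 0).
Proof.
rewrite /feature /combine summxE; apply: eq_bigr => l _; by rewrite !mxE mxtens_indexK.
Qed.

(** The partial derivatives of the residual are the entries of the vector called
    [G] in the Hessian formula, up to the output weights. *)
Lemma residual_diff_delta r i (k : 'I_3) x :
  residual_diff r (delta_mx (mxtens_index (i, k)) 0) x = cf i * feature r x (mxtens_index (i, k)) 0.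
Proof.
rewrite featureE /residual_diff /channel_sum mulr_sumr; apply: eq_bigr => l _; rewrite mulrCA; congr (_ * _).
rewrite (bigD1 i)//= big1 ?addr0 => [|j ji].
  by rewrite /pre preact_delta eqxx mul1r.
by rewrite {2}/pre preact_delta eq_sym (negbTE ji) mul0r !mulr0.
Qed.

Lemma shell_delta s r a b x :
  feature_grad s r x a b = shell s r (delta_mx a 0) (delta_mx b 0) x.
Proof.
case: (mxtens_indexP a) => i k; case: (mxtens_indexP b) => j k'.
rewrite /feature_grad /combine summxE /shell; apply: eq_bigr => l _.
rewrite [LHS]mxE tensmxE; congr (_ * _).
rewrite (bigD1 i)//= big1 ?addr0 => [|i' ii].
  rewrite /pre !preact_delta eqxx mul1r mxE eq_sym [X in _ * X]mxE big_ord1 !mxE -/(pre _ _ _ _).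
  by case: (j == i); rewrite ?mulr1n ?mulr0n ?mul0r ?mulr0 ?mul1r// mulrA.
by rewrite /pre preact_delta eq_sym (negbTE ii) mul0r mulr0 mul0r.
Qed.

Lemma pre_expand l v i x : pre l v i x = \sum_b v b 0 * pre l (delta_mx b 0) i x.
Proof.
rewrite [in LHS](matrix_sum_delta v).
rewrite (@big_morph _ _ (fun w => pre l w i x) 0 +%R); last first.
- by rewrite /pre -(scale0r 0) preactZ mul0r.
- by move=> u w; rewrite /pre preactD.
by apply: eq_bigr => a _; rewrite big_ord1 /pre preactZ.
Qed.

Lemma shell_expand s r e v x : shell s r e v x = \sum_b v b 0 * shell s r e (delta_mx b 0) x.
Proof.
rewrite /shell; under [RHS]eq_bigr do rewrite mulr_sumr.
rewrite exchange_big; apply: eq_bigr => l _ /=.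
under [RHS]eq_bigr do rewrite mulrCA.
rewrite -mulr_sumr; congr (_ * _); under [RHS]eq_bigr do rewrite mulr_sumr.
rewrite exchange_big; apply: eq_bigr => i _ /=.
by rewrite [X in _ * X]pre_expand mulr_sumr; apply: eq_bigr => b _; ring.
Qed.

Lemma shell_bm s r e v : 0 < s -> bounded_meas S (shell s r e v).
Proof.
move=> s0; apply: bm_sum => l; apply: bmM; first exact: alpha_bm.
apply: bm_sum => i; apply: bmM; last exact: pre_bm.
apply: bmM; last exact: pre_bm.
rewrite (_ : (fun x => _) = (fun x => (2 * s)^-1 * delta_jump (pre l r i x) s)); last first.
  by apply/funext => x; exact: delta_jumpE.
apply: bmZ; split; last first.
  by exists 1 => x _; have [h _ _ _ _] := @delta_jump_kernel R; exact: h.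
have [m _] := pre_bm l r i; have [m' _] := bm_cst S s.
exact: (measurable_fun_kernel (@delta_jump_kernel R) m m').
Qed.

Definition limit_hess r : 'M[R]_(n * 3) :=
  \matrix_(a, b) lim (mx_int S (fun x => residual r x *: feature_grad s r x) a b @[s --> 0^'+]).

Lemma feature_grad_cvg r a b : (forall i, omega r i <> 0) ->
  cvg (mx_int S (fun x => residual r x *: feature_grad s r x) a b @[s --> 0^'+]).
Proof.
move=> w0; have [/(_ (delta_mx a 0) (delta_mx b 0)) h _] := central_limit w0.
rewrite (_ : (fun s => _) = (fun s => Int S (fun x => residual r x * shell s r (delta_mx a 0) (delta_mx b 0) x)))//.
apply/funext => s; rewrite mxE; apply: eq_Int => x _; rewrite mxE shell_delta//.
Qed.

(** Matrix form of the second derivative found in [region_model]. *)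
Theorem region_matrix r v a : (forall i, omega r i <> 0) ->
  (((Dhat c *t (1%:M : 'M[R]_3)) *m mx_int S (fun x => feature r x *m (feature r x)^T) *m (Dhat c *t (1%:M : 'M[R]_3))
    + limit_hess r *m (Dhat c *t (1%:M : 'M[R]_3))) *m v) a 0 =
  Int S (fun x => residual_diff r v x * residual_diff r (delta_mx a 0) x) +
     lim (Int S (fun x => residual r x * shell s r (delta_mx a 0) (weight_scale v) x) @[s --> 0^'+]).
Proof.
move=> w0; rewrite mulmxDl mxE -!mulmxA -/(weight_scale v); congr (_ + _).
  have bf b : bounded_meas S (fun x => feature r x b 0).
    case: (mxtens_indexP b) => j k'.
    rewrite (_ : (fun x => _) = (fun x => \sum_l alpha l x * (heaviside (pre l r j x) * yvec (psi l x) k' 0))); last first.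
      by apply/funext => x; exact: featureE.
    apply: bm_sum => l; apply: bmM; first exact: alpha_bm.
    apply: bmM; first exact: heaviside_bm.
    rewrite (_ : (fun x => _) = pre l (delta_mx (mxtens_index (j, k')) 0) j); first exact: pre_bm.
    by apply/funext => x; rewrite /pre preact_delta eqxx mul1r.
  rewrite -/(weight_scale _); case: (mxtens_indexP a) => i k.
  rewrite scaleE mxE mulr_sumr.
  have HE b : mx_int S (fun x => feature r x *m (feature r x)^T) (mxtens_index (i, k)) b =
      Int S (fun x => feature r x (mxtens_index (i, k)) 0 * feature r x b 0).
    by rewrite mxE; apply: eq_Int => x _; rewrite mxE big_ord1 [X in _ * X]mxE.
  under eq_bigr => b _.
    rewrite HE mulrCA mulrC -IntZ; [|by []|by []|exact: bmM].
    over.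
  rewrite -Int_sum//; last by move=> b; apply: bmZ; exact: bmM.
  apply: eq_Int => x _; rewrite residual_diff_delta residual_diff_expand mulr_suml; apply: eq_bigr => b _.
  case: (mxtens_indexP b) => j k'; rewrite scaleE residual_diff_delta; ring.
rewrite mxE; apply/esym/cvg_lim => //.
have scv b : mx_int S (fun x => residual r x *: feature_grad s r x) a b @[s --> 0^'+] --> limit_hess r a b.
  by rewrite [X in _ --> X]mxE; exact: feature_grad_cvg.
have : \sum_b mx_int S (fun x => residual r x *: feature_grad s r x) a b * weight_scale v b 0 @[s --> 0^'+] --> \sum_b limit_hess r a b * weight_scale v b 0.
  by apply: cvg_bigsum => b; apply: cvgMl; exact: scv.
apply: cvg_trans; apply: near_eq_cvg; near=> s.
have s0 : 0 < s by [].
under eq_bigr => b _.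
  rewrite mxE mulrC [X in _ * X](_ : _ = Int S (fun x => residual r x * shell s r (delta_mx a 0) (delta_mx b 0) x)); last first.
    by apply: eq_Int => x _; rewrite mxE shell_delta.
  rewrite -IntZ; [|by []|by []|by apply: bmM; [exact: residual_bm|exact: shell_bm]].
  over.
rewrite -Int_sum//; last by move=> b; apply: bmZ; apply: bmM; [exact: residual_bm|exact: shell_bm].
apply: eq_Int => x _; rewrite shell_expand mulr_sumr; apply: eq_bigr => b _; ring.
Unshelve. all: by end_near.
Qed.

End Region.

(** * Gradients from quadratic remainders *)

Section Gradient.
Context {R : realType} {N : nat}.
Implicit Types (g r v : 'cV[R]_N).

Definition gdot g v : R^o := \sum_a g a 0 * v a 0.

Lemma gdot_is_linear g : linear (gdot g).
Proof.
move=> k u v; rewrite /gdot scaler_sumr -big_split; apply: eq_bigr => a _ /=.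
by rewrite !mxE mulrDr mulrCA.
Qed.

HB.instance Definition _ g := GRing.isLinear.Build R 'cV[R]_N R^o _ (gdot g) (gdot_is_linear g).

Lemma gdot_continuous g : continuous (gdot g).
Proof.
move=> v; rewrite /gdot; apply: (@cvg_bigsum R _ (nbhs v)) => a.
by apply: cvgMr; exact: coord_continuous.
Qed.

Lemma gdot_delta g a : gdot g (delta_mx a 0) = g a 0.
Proof.
rewrite /gdot (bigD1 a)//= big1 ?addr0 => [|b ba]; rewrite mxE eqxx ?andbT.
  by rewrite /= mulr1.
by rewrite (negbTE ba) /= mulr0.
Qed.

(** A quadratic remainder is little-o of the increment. *)
Lemma quadratic_gradient (L : 'cV[R]_N -> R) g r C :
  (forall v, `|L (r + v) - L r - gdot g v| <= C * `|v| ^+ 2) ->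
  differentiable (L : 'cV[R]_N -> R^o) r /\ grad L r = g.
Proof.
move=> h.
have small (d : R) : 0 < d -> \forall v \near nbhs (0 : 'cV[R]_N), `|v| <= d.
  by move=> d0; exact: (@nbhs0_le R 'cV[R]_N d d0).
have exp : (L : 'cV[R]_N -> R^o) \o shift r = cst (L r : R^o) + gdot g +o_ (0 : 'cV[R]_N) id.
  have C1 : 0 < `|C| + 1 by rewrite ltr_pwDr.
  apply/eqaddoP => _/posnumP[e]; near=> v.
  rewrite /= !fctE /cst /shift /= opprD addrA addrC [v + r]addrC.
  rewrite addrC; apply: (le_trans (h v)); rewrite expr2 mulrA ler_wpM2r//.
  apply: (@le_trans _ _ ((`|C| + 1) * `|v|)).
    by rewrite ler_wpM2r//; have := ler_norm C; lra.
  rewrite mulrC -(ler_pdivlMr _ _ C1).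
  by near: v; exact: (small _ (divr_gt0 (gt0 e) C1)).
have dE := diff_unique (@gdot_continuous g) exp.
have df : differentiable (L : 'cV[R]_N -> R^o) r.
  by apply/diff_locallyP; rewrite dE; split => //; exact: gdot_continuous.
split=> //; apply/colP => a; rewrite mxE.
by rewrite (deriveE (delta_mx a 0) df) dE; exact: gdot_delta.
Unshelve. all: by end_near.
Qed.

End Gradient.

(** * Distributional derivatives from central difference quotients *)

Section Weak.
Context {R : realType}.
Local Notation leb := (@lebesgue_measure R).
Implicit Types (f G phi m : R -> R) (A K : set R).

(** Translations preserve the length of intervals. *)
Lemma lebesgue_shift (s : R) (X : set (measurableTypeR R)) : measurable X ->
  pushforward leb (fun t : measurableTypeR R => t - s : measurableTypeR R) X = leb X.
Proof.
move=> mX; apply/esym/lebesgue_measure_unique => //=; first exact: measurable_funB.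
move=> _ _ [[a b]] _ <-; rewrite /pushforward /=.
have -> : (fun t : R => t - s) @^-1` `]a, b] = `]a + s, b + s]%classic.
  by apply/seteqP; split => t /=; rewrite !in_itv/= ltrBrDr lerBlDr.
by rewrite !lebesgue_measure_itv/= !lte_fin ltrD2r; case: ifPn => // _; rewrite -!EFinB; congr (_%:E); ring.
Qed.

Lemma Rintegral_shift (s : R) f : measurable_fun [set: measurableTypeR R] f ->
  leb.-integrable setT (EFin \o (fun t => f (t - s))) ->
  \int[leb]_t f (t - s) = \int[leb]_t f t.
Proof.
move=> mf i; congr fine.
have ms : measurable_fun [set: measurableTypeR R] (fun t : measurableTypeR R => t - s : measurableTypeR R) by exact: measurable_funB.
have mE : measurable_fun [set: measurableTypeR R] (EFin \o f) by exact/measurable_EFinP.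
transitivity (\int[pushforward leb (fun t : measurableTypeR R => (t - s)%R : measurableTypeR R)]_t (f t)%:E)%E.
  by rewrite (integral_pushforward ms mE (mu := leb) (D := setT) i measurableT).
by apply: eq_measure_integral => //= X mX _; exact: lebesgue_shift.
Qed.

Lemma Rintegral_bounded_support (B C : R) f : measurable_fun [set: measurableTypeR R] f ->
  (forall t, `|f t| <= C) -> (forall t, B <= `|t| -> f t = 0) ->
  leb.-integrable setT (EFin \o f) /\ \int[leb]_(t in `]-B, B[%classic) f t = \int[leb]_t f t.
Proof.
move=> mf fC f0.
have fE : f \_ `]-B, B[%classic = f.
  apply/funext => t; rewrite patchE; case: ifPn => // /negP tB; rewrite f0//.
  rewrite leNgt; apply/negP => tB'; apply: tB; rewrite inE /= in_itv/=.
  by rewrite -ltr_norml.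
split; last by rewrite Rintegral_mkcond fE.
have i : leb.-integrable `]-B, B[%classic (EFin \o f).
  by apply: (@itv_integrable _ _ _ _ C) => //; exact: measurable_funTS.
by move: i; rewrite (integrable_mkcond)// restrict_EFin fE.
Qed.

(** Dominated convergence with an interval as common support. *)
Lemma Rintegral_limit (B C : R) (F : nat -> R -> R) f :
  (forall n, measurable_fun [set: measurableTypeR R] (F n)) ->
  (forall n t, `|F n t| <= C) -> (forall n t, B <= `|t| -> F n t = 0) ->
  (forall t, F n t @[n --> \oo] --> f t) ->
  \int[leb]_t F n t @[n --> \oo] --> \int[leb]_t f t.
Proof.
move=> mF FC F0 Ff.
have mf : measurable_fun [set: measurableTypeR R] f.
  by apply: (@measurable_fun_cvg _ _ _ _ F) => // t _; exact: Ff.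
have fC t : `|f t| <= C.
  rewrite leNgt; apply/negP => fC.
  have [n _ /(_ n (leqnn n))] := cvgr_gt _ (cvg_norm (Ff t)) _ fC.
  by rewrite /= ltNge FC.
have f0 t : B <= `|t| -> f t = 0.
  move=> tB; have := Ff t; under eq_fun do rewrite F0//.
  by move=> h; exact: (cvg_unique _ h (cvg_cst _)).
have [_ <-] := Rintegral_bounded_support mf fC f0.
have FE n : \int[leb]_t F n t = \int[leb]_(t in `]-B, B[%classic) F n t.
  by have [_ <-] := Rintegral_bounded_support (mF n) (FC n) (F0 n).
under eq_fun do rewrite FE.
have [] := @dominated_convergence _ _ _ leb `]-B, B[%classic (measurable_itv _) (fun n => EFin \o F n) (EFin \o f) (fun=> C%:E).
- by move=> n; apply/measurable_EFinP; exact: measurable_funTS.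
- by apply/measurable_EFinP; exact: measurable_funTS.
- by apply/aeW => t _; apply/fine_cvgP; split; [near=> n|exact: Ff].
- by apply: (@itv_integrable _ _ _ (fun=> C) `|C|) => //; exact: measurable_cst.
- by apply/aeW => t k _ /=; rewrite lee_fin.
move=> ilam _ cv; have fl := integrable_fin_num (mu := leb) (measurable_itv _) ilam.
have /fine_cvgP[_] : (\int[leb]_(t in `](-B)%R, B[%classic) (F n t)%:E)%E @[n --> \oo] --> (fine (\int[leb]_(t in `](-B)%R, B[%classic) (f t)%:E)%E)%:E.
  by rewrite fineK//; exact: cv.
by [].
Unshelve. all: by end_near.
Qed.

Lemma derive1_out K phi t : closed K -> (forall t, ~ K t -> phi t = 0) -> ~ K t -> phi^`()%classic t = 0.
Proof.
move=> cK phi0 nK; rewrite derive1E (@near_eq_derive _ _ _ _ (cst 0)) ?derive_cst//.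
have : nbhs t (~` K) by apply: open_nbhs_nbhs; split; [exact: closed_openC|].
by apply: filterS => z; exact: phi0.
Qed.

(** Mean value theorem. *)
Lemma central_mean phi t s : (forall t, derivable phi t 1) -> 0 < s ->
  exists2 c, t - s <= c <= t + s & (2 * s)^-1 * (phi (t + s) - phi (t - s)) = phi^`()%classic c.
Proof.
move=> dphi s0; have ab : t - s <= t + s by lra.
have [||z] := @MVT_segment R phi phi^`()%classic _ _ ab.
- by move=> x _; apply: DeriveDef => //; rewrite derive1E.
- apply: continuous_subspaceT => x; apply: differentiable_continuous.
  exact/derivable1_diffP.
rewrite in_itv/= => zts E; exists z => //; rewrite E.
have s_neq0 : s != 0 by rewrite gt_eqF.
by field.
Qed.

(** Discrete integration by parts is exact by translation invariance; both of its
    sides converge. The Lipschitz bound dominates the quotients of [G]. *)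
Theorem weak_derivative A G m phi : open A -> measurable_fun [set: measurableTypeR R] G ->
  (forall K, compact K -> K `<=` A -> exists C d : R, 0 < d /\
     forall t s, K t -> `|s| <= d -> `|G (t + s) - G t| <= C * `|s|) ->
  (forall t, A t -> (2 * s)^-1 * (G (t + s) - G (t - s)) @[s --> 0^'+] --> m t) ->
  test_function A phi ->
  \int[leb]_t (G t * phi^`()%classic t) = - \int[leb]_t (m t * phi t).
Proof.
move=> oA mG lipG cG [dphi cdphi [K [cK KA phi0]]].
have [C0 [d [d0 lip0]]] := lipG K cK KA.
pose C := `|C0|.
have lip t s : K t -> `|s| <= d -> `|G (t + s) - G t| <= C * `|s|.
  by move=> Kt sd; apply: le_trans (lip0 _ _ Kt sd) _; rewrite ler_wpM2r// ler_norm.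
have C_ge0 : 0 <= C := normr_ge0 C0.
have cphi : continuous phi.
  by move=> x; apply: differentiable_continuous; exact/derivable1_diffP.
have closedK : closed K by exact: compact_closed.
have dphi0 t : ~ K t -> phi^`()%classic t = 0 by exact: derive1_out.
have [Pm Pm0 hP] : exists2 C, 0 <= C & forall t, `|phi t| <= C.
  have [P P0 hP] := compact_bound cK (fun t _ => cphi t).
  by exists P => // t; have [/hP|/phi0 ->] := pselect (K t); rewrite ?normr0.
have [Dm Dm0 hD] : exists2 C, 0 <= C & forall t, `|phi^`()%classic t| <= C.
  have [P P0 hP'] := compact_bound cK (fun t _ => cdphi t).
  by exists P => // t; have [/hP'|/dphi0 ->] := pselect (K t); rewrite ?normr0.
have cGK : {in K, continuous G}.
  move=> t /[1!inE] Kt; apply/cvgrPdist_lt => e e0.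
  apply/nbhs_ballP; exists (Num.min d (e / (C + 1))) => /=.
    by rewrite lt_min d0 divr_gt0// ltr_pwDr.
  move=> z; rewrite /ball /= lt_min => /andP[zd ze]; rewrite distrC in zd.
  have := lip t (z - t) Kt (ltW zd); rewrite (addrC t) subrK [`|G z - _|]distrC => h; apply: (le_lt_trans h).
  apply: (@le_lt_trans _ _ ((C + 1) * `|z - t|)); first by rewrite ler_wpM2r// lerDl.
  by rewrite mulrC -ltr_pdivlMr ?ltr_pwDr// distrC.
have [Gm Gm0 hG] := compact_bound cK cGK.
have [B B0 hB] := support_bound cK.
have Gnear t u : K t -> `|u| <= d -> `|G (t + u)| <= Gm + C * d.
  move=> Kt ud; rewrite -[X in `|X|](subrK (G t)) addrC; apply: le_trans (ler_normD _ _) _.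
  apply: lerD; first exact: hG.
  by apply: (le_trans (lip _ _ Kt ud)); rewrite ler_wpM2l.
have GC0 : 0 <= Gm + C * d by rewrite addr_ge0// mulr_ge0// ltW.
have out t u : `|u| <= d -> B + d + 1 <= `|t| -> phi (t + u) = 0.
  move=> ud tB; apply: phi0 => /hB h.
  have : `|t| <= `|t + u| + `|u| by rewrite -[X in `|X| <= _](addrK u); exact: ler_normB.
  lra.
pose sn (n : nat) : R := d / n.+1%:R.
have sn0 n : 0 < sn n by rewrite divr_gt0.
have snd n : sn n <= d by rewrite ler_pdivrMr// ler_peMr ?ler1n// ltW.
have sncv : sn n @[n --> \oo] --> 0.
  by rewrite -[0](mulr0 d); apply: cvgMr; exact: cvg_harmonic.
pose F n t := G t * ((2 * sn n)^-1 * (phi (t + sn n) - phi (t - sn n))).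
pose H n t := (2 * sn n)^-1 * (G (t + sn n) - G (t - sn n)) * phi t.
have mphi : measurable_fun [set: measurableTypeR R] phi by exact: continuous_measurable_fun.
have mshift (s : R) : measurable_fun [set: measurableTypeR R] (fun t : measurableTypeR R => t + s : measurableTypeR R) by exact: measurable_funD.
have mGs (s : R) : measurable_fun [set: measurableTypeR R] (fun t => G (t + s)) by exact: (measurableT_comp mG (mshift s)).
have mps (s : R) : measurable_fun [set: measurableTypeR R] (fun t => phi (t + s)) by exact: (measurableT_comp mphi (mshift s)).
have prodB t u : `|u| <= d -> `|G (t + u) * phi t| <= (Gm + C * d) * Pm.
  move=> ud; rewrite normrM; have [Kt|/phi0 ->] := pselect (K t).
    by apply: ler_pM => //; exact: Gnear.
  by rewrite normr0 mulr0 mulr_ge0.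
(* Summation by parts: shift the variable in each of the two terms. *)
have parts n : \int[leb]_t F n t = - \int[leb]_t H n t.
  set s := sn n.
  have sd : `|s| <= d by rewrite (gtr0_norm (sn0 n)).
  have sd' : `|- s| <= d by rewrite normrN.
  have ib f : measurable_fun [set: measurableTypeR R] f -> (forall t, `|f t| <= (Gm + C * d) * Pm) ->
     (forall t, B + d + 1 <= `|t| -> f t = 0) -> leb.-integrable setT (EFin \o f).
    by move=> mf fb f0; have [] := Rintegral_bounded_support mf fb f0.
  have i1 (u : R) : `|u| <= d -> leb.-integrable setT (EFin \o (fun t => G t * phi (t + u))).
    move=> ud; apply: ib => [|t|t tB]; first exact: measurable_funM.
      by have := prodB (t + u) (- u); rewrite normrN addrK; exact.
    by rewrite out// mulr0.
  have i2 (u : R) : `|u| <= d -> leb.-integrable setT (EFin \o (fun t => G (t + u) * phi t)).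
    move=> ud; apply: ib => [|t|t tB]; first exact: measurable_funM.
      exact: prodB.
    by have := out t 0; rewrite addr0 => ->; rewrite ?mulr0 ?normr0 ?(ltW d0).
  have sh (u : R) : `|u| <= d -> \int[leb]_t (G t * phi (t + u)) = \int[leb]_t (G (t - u) * phi t).
    move=> ud; rewrite -(@Rintegral_shift u (fun t => G t * phi (t + u))).
    - by apply: eq_Rintegral => t _; rewrite subrK.
    - exact: measurable_funM.
    by have := i2 (- u); rewrite normrN => /(_ ud); under [X in _ -> _.-integrable _ (_ \o X)]eq_fun do rewrite subrK.
  have -> : \int[leb]_t F n t = \int[leb]_t ((2 * s)^-1 * (G t * phi (t + s) - G t * phi (t - s))).
    by apply: eq_Rintegral => t _; rewrite /F -/s; ring.
  have -> : \int[leb]_t H n t = \int[leb]_t ((2 * s)^-1 * (G (t - (- s)) * phi t - G (t - s) * phi t)).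
    by apply: eq_Rintegral => t _; rewrite /H -/s opprK; ring.
  have j1 := i1 _ sd; have j2 := i1 _ sd'; have j3 := i2 _ sd'.
  have j4 : leb.-integrable setT (EFin \o (fun t => G (t - (- s)) * phi t)) by apply: i2; rewrite opprK.
  have e1 := integrableB measurableT j1 j2; have e2 := integrableB measurableT j4 j3.
  have q1 : \int[leb]_t ((2 * s)^-1 * (G t * phi (t + s) - G t * phi (t - s))) =
    (2 * s)^-1 * (\int[leb]_t (G t * phi (t + s)) - \int[leb]_t (G t * phi (t - s))).
    by rewrite RintegralZl ?RintegralB//; exact: e1.
  have q2 : \int[leb]_t ((2 * s)^-1 * (G (t - - s) * phi t - G (t - s) * phi t)) =
    (2 * s)^-1 * (\int[leb]_t (G (t - - s) * phi t) - \int[leb]_t (G (t - s) * phi t)).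
    by rewrite RintegralZl ?RintegralB//; exact: e2.
  by rewrite q1 q2 !sh//; ring.
have Fcv : \int[leb]_t F n t @[n --> \oo] --> \int[leb]_t (G t * phi^`()%classic t).
  apply: (@Rintegral_limit (B + d + 1) ((Gm + C * d) * Dm)).
  - by move=> n; apply: measurable_funM => //; apply: measurable_funM => //; exact: measurable_funB.
  - move=> n t; rewrite /F; have [[Kt|nK1]|/not_orP[nK1 nK2]] := pselect (K (t + sn n) \/ K (t - sn n)); last first.
      by rewrite !phi0// subrr !mulr0 normr0 mulr_ge0.
    + rewrite normrM; apply: ler_pM => //; last first.
        by have [c _ ->] := central_mean t dphi (sn0 n).
      by rewrite -[X in `|G X|](subrK (sn n)); apply: Gnear => //; rewrite (gtr0_norm (sn0 n)).
    + rewrite normrM; apply: ler_pM => //; last first.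
        by have [c _ ->] := central_mean t dphi (sn0 n).
      by rewrite -[X in `|G X|](addrK (sn n)); apply: Gnear => //; rewrite normrN (gtr0_norm (sn0 n)).
  - by move=> n t tB; rewrite /F !out ?subrr ?mulr0// ?normrN (gtr0_norm (sn0 n)).
  - move=> t; apply: cvgMr; apply/cvgrPdist_lt => e e0.
    have /cvgrPdist_lt /(_ e e0) := cdphi t.
    move=> /nbhs_ballP[r /= r0 hr]; near=> n.
    have [c /andP[c1 c2] ->] := central_mean t dphi (sn0 n).
    apply: hr; rewrite /ball /=; apply: (@le_lt_trans _ _ (sn n)).
      by rewrite ler_norml; apply/andP; split; lra.
    near: n; exact: (cvgr_lt _ sncv _ r0).
have Hcv : \int[leb]_t H n t @[n --> \oo] --> \int[leb]_t (m t * phi t).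
  apply: (@Rintegral_limit (B + d + 1) (C * Pm)).
  - move=> n; rewrite /H; apply: measurable_funM => //; apply: measurable_funM => //; exact: measurable_funB.
  - move=> n t; rewrite /H; have [Kt|nK1] := pselect (K t); last first.
      by rewrite phi0// mulr0 normr0 mulr_ge0.
    rewrite normrM; apply: ler_pM => //; rewrite normrM ger0_norm ?invr_ge0 ?mulr_ge0 ?(ltW (sn0 n))//.
    rewrite mulrC ler_pdivrMr ?mulr_gt0//.
    have -> : G (t + sn n) - G (t - sn n) = (G (t + sn n) - G t) - (G (t + (- sn n)) - G t) by ring.
    apply: le_trans (ler_normB _ _) _.
    have h1 : `|sn n| <= d by rewrite (gtr0_norm (sn0 n)).
    have h2 : `|- sn n| <= d by rewrite normrN.
    have := lip _ _ Kt h1; have := lip _ _ Kt h2; rewrite normrN (gtr0_norm (sn0 n))// => ? ?; lra.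
    exact: ltW.
  - by move=> n t tB; have := out t 0; rewrite addr0 /H => ->; rewrite ?mulr0 ?normr0 ?(ltW d0).
  - move=> t; have [Kt|nK] := pselect (K t); last first.
      by rewrite /H phi0// mulr0; under eq_fun do rewrite mulr0; exact: cvg_cst.
    by apply: cvgMl; have /cvg_at_rightP := cG t (KA _ Kt); apply; split => //.
have FE : (fun n => \int[leb]_t F n t) = (fun n => - \int[leb]_t H n t) by exact/funext.
have Ncv : (fun n => \int[leb]_t F n t) @ \oo --> - \int[leb]_t (m t * phi t).
  by rewrite FE; exact: (cvgN Hcv).
exact: (cvg_unique _ Fcv Ncv).
Unshelve. all: by end_near.
Qed.

End Weak.

Lemma near_right {R : realType} (P : R -> Prop) :
  (\forall s \near nbhs (0 : R), P s) -> \forall s \near (0 : R)^'+, P s.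
Proof. by move=> h; apply: (@cvg_within R (nbhs (0 : R)) _ _ P h). Qed.

(** * Sums of two functionals *)

Section Assembly.
Context {R : realType} {n : nat}.
Implicit Types (r v e : 'cV[R]_(n * 3)).

(** On this open set the kinks of the neurons are lines that move smoothly. *)
Definition nonzero_weights : set 'cV[R]_(n * 3) := [set r | forall i, omega r i <> 0].

Lemma omax_nonzero_weights r : (forall i, 0 < weight_max r i) -> nonzero_weights r.
Proof.
move=> h i w0; have := h i; rewrite /weight_max w0 /= normr0 => /lt_eqF.
by rewrite maxxx eqxx.
Qed.

Lemma nonzero_weights_near r v (t : R) : nonzero_weights (r + t *: v) ->
  \forall z \near nbhs t, nonzero_weights (r + z *: v).
Proof.
move=> w0; have : \forall z \near nbhs t, forall i : 'I_n, 0 < weight_max (r + z *: v) i.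
  apply: filter_forall => i; have := @omax_line R n r v i t.
  move=> /(cvgr_gt _) h; exact: (h _ (omax_gt0 (w0 i))).
by apply: filterS => z; exact: omax_nonzero_weights.
Qed.

Lemma open_nonzero_weights r v : open [set t : R | nonzero_weights (r + t *: v)].
Proof. by rewrite openE => t; exact: nonzero_weights_near. Qed.

Variables (T1 T2 : 'cV[R]_(n * 3) -> R) (D1 D2 : 'cV[R]_(n * 3) -> 'cV[R]_(n * 3) -> R).
Variables (Q1 Q2 : 'cV[R]_(n * 3) -> 'cV[R]_(n * 3) -> 'cV[R]_(n * 3) -> R).
Hypotheses (m1 : smooth_model nonzero_weights T1 D1 Q1) (m2 : smooth_model nonzero_weights T2 D2 Q2).

Let L r : R := T1 r + T2 r.
Let DL r e : R := D1 r e + D2 r e.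
Let Q r v e : R := Q1 r v e + Q2 r v e.

Lemma sum_gradient r : nonzero_weights r ->
  differentiable (L : 'cV[R]_(n * 3) -> R^o) r /\ grad L r = \col_a DL r (delta_mx a 0).
Proof.
move=> w0; have [C1 h1] := model_taylor m1 w0; have [C2 h2] := model_taylor m2 w0.
apply: (@quadratic_gradient R _ L _ r (C1 + C2)) => v.
have -> : gdot (\col_a DL r (delta_mx a 0)) v = D1 r v + D2 r v :> R.
  rewrite (model_linear m1) (model_linear m2) -big_split; apply: eq_bigr => a _ /=.
  by rewrite mxE mulrDl.
have -> : L (r + v) - L r - (D1 r v + D2 r v) =
  (T1 (r + v) - T1 r - D1 r v) + (T2 (r + v) - T2 r - D2 r v) by rewrite /L; ring.
by apply: le_trans (ler_normD _ _) _; rewrite mulrDl lerD.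
Qed.

Lemma gradE r a : nonzero_weights r -> grad L r a 0 = DL r (delta_mx a 0).
Proof. by move=> w0; have [_ ->] := sum_gradient w0; rewrite mxE. Qed.

Lemma DL_central r v e : nonzero_weights r ->
  (2 * s)^-1 * (DL (r + s *: v) e - DL (r - s *: v) e) @[s --> 0^'+] --> Q r v e.
Proof.
move=> w0; have h := cvgD (@model_central _ _ _ _ _ _ m1 r v e w0) (@model_central _ _ _ _ _ _ m2 r v e w0).
have -> : (fun s : R => (2 * s)^-1 * (DL (r + s *: v) e - DL (r - s *: v) e)) =
  (fun s : R => (2 * s)^-1 * (D1 (r + s *: v) e - D1 (r - s *: v) e)) +
  (fun s : R => (2 * s)^-1 * (D2 (r + s *: v) e - D2 (r - s *: v) e)).
  by apply/funext => s; rewrite fctE /DL; ring.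
exact: h.
Qed.

Theorem sum_central_hessian r M : nonzero_weights r ->
  (forall v a, (M *m v) a 0 = Q r v (delta_mx a 0)) -> central_hessian L r M.
Proof.
move=> w0 hM v a; rewrite hM; apply: cvg_trans (@DL_central r v (delta_mx a 0) w0).
have w0' : nonzero_weights (r + (0 : R) *: v) by rewrite scale0r addr0.
have w0'' : nonzero_weights (r + (0 : R) *: - v) by rewrite scale0r addr0.
apply: near_eq_cvg; near=> s; rewrite !gradE//.
  by rewrite -scalerN; near: s; exact: (near_right (nonzero_weights_near w0'')).
by near: s; exact: (near_right (nonzero_weights_near w0')).
Unshelve. all: by end_near.
Qed.

(** Apply [weak_derivative] along each line. Only the values of the gradient on
    the open set of nonzero weights enter, so that it may be set to [0]
    elsewhere, which makes it measurable. *)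
Theorem sum_weak_hessian (M : 'cV[R]_(n * 3) -> 'M[R]_(n * 3)) :
  (forall r, nonzero_weights r -> forall v a, (M r *m v) a 0 = Q r v (delta_mx a 0)) ->
  weak_hessian nonzero_weights L M.
Proof.
move=> hM; split => [r w0|r v phi tphi a]; first by have [] := sum_gradient w0.
set A := [set t | _] in tphi.
have oA : open A := @open_nonzero_weights r v.
pose DLt t := DL (r + t *: v) (delta_mx a 0).
have lipA K : compact K -> K `<=` A -> exists C, forall t s, K t -> `|DLt (t + s) - DLt t| <= C * `|s|.
  move=> cK KA; have [C1 h1] := model_lip m1 (delta_mx a 0) cK KA.
  have [C2 h2] := model_lip m2 (delta_mx a 0) cK KA.
  exists ((C1 + C2) * `|v|) => t s Kt; rewrite /DLt scalerDl addrA.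
  have := h1 t (s *: v) Kt; have := h2 t (s *: v) Kt; rewrite normrZ => k2 k1.
  rewrite /DL opprD addrACA; apply: le_trans (ler_normD _ _) _.
  apply: le_trans (lerD k1 k2) _; rewrite le_eqVlt; apply/orP; left; apply/eqP; ring.
have cA : {in A, continuous DLt}.
  move=> t /[1!inE] At; have [C hC] := lipA [set t] (@compact_set1 _ t) (fun z zt => eq_ind_r A At zt).
  apply/cvgrPdist_lt => e e0; apply/nbhs_ballP; exists (e / (`|C| + 1)) => /=.
    by rewrite divr_gt0// ltr_pwDr.
  move=> z; rewrite /ball /= => ze.
  have := hC t (z - t) erefl; rewrite (addrC t) subrK [`|DLt z - _|]distrC => h; apply: (le_lt_trans h).
  apply: (@le_lt_trans _ _ ((`|C| + 1) * `|z - t|)).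
    by rewrite ler_wpM2r//; have := ler_norm C; lra.
  by rewrite mulrC -ltr_pdivlMr ?ltr_pwDr// distrC.
(* The gradient on the open set [A], extended by [0]. *)
pose G := DLt \_ A.
have GE t : A t -> G t = DLt t by move=> At; rewrite /G patchE mem_set.
have Anear K : compact K -> K `<=` A -> \forall s \near nbhs (0 : R), forall t, K t -> A (t + s).
  move=> /compact_near_coveringP cK KA; apply: cK => t Kt.
  have : nbhs (t + 0) A by rewrite addr0; apply: open_nbhs_nbhs; split => //; exact: KA.
  by move=> h; have := (@add_continuous R (t, 0) A); exact.
transitivity (\int[lebesgue_measure]_t (G t * phi^`()%classic t)).
  apply: eq_Rintegral => t _; have [At|nA] := pselect (A t); first by rewrite gradE// GE.
  have [_ _ [K [cK KA phi0]]] := tphi.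
  by rewrite (derive1_out (compact_closed (@Rhausdorff R) cK) phi0) ?mulr0//; move/KA.
rewrite (@weak_derivative R A G (fun t => (M (r + t *: v) *m v) a 0) phi)//.
- apply/(measurable_restrictT _ _).1 => //.
  + exact: open_measurable.
  + exact: open_continuous_measurable_fun.
- move=> K cK KA; have [C hC] := lipA K cK KA.
  have /nbhs_ballP[d /= d0 hd] := Anear K cK KA.
  exists C, (d / 2); split => [|t s Kt sd]; first by rewrite divr_gt0.
  rewrite !GE ?hC//; [exact: KA|apply: hd => //].
  rewrite /ball /= sub0r normrN; apply: (le_lt_trans sd).
  by rewrite ltr_pdivrMr// mulr_natr mulr2n ltrDl.
- move=> t At; rewrite hM//.
  have [d d0 hd] : exists2 d : R, 0 < d & forall s, `|s| < d -> A (t + s).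
    have /nbhs_ballP[d /= d0 hd] := Anear [set t] (@compact_set1 _ t) (fun z zt => eq_ind_r A At zt).
    by exists d => // s sd; apply: hd => //; rewrite /ball /= sub0r normrN.
  apply: cvg_trans (@DL_central (r + t *: v) v (delta_mx a 0) At).
  apply: near_eq_cvg; near=> s; rewrite !GE.
  + by rewrite /DLt scalerDl scalerBl !addrA.
  + by near: s; apply: near_right; apply/nbhs_ballP; exists d => // s; rewrite /ball /= sub0r => sd; exact: hd.
  + by near: s; apply: near_right; apply/nbhs_ballP; exists d => // s; rewrite /ball /= sub0r normrN => sd; exact: hd.
Unshelve. all: by end_near.
Qed.

End Assembly.

(** * Bounded plane sets *)

Section BoundedSets.
Context {R : realType}.
Implicit Types (S : set (plane R)).

Lemma bounded_in_box S : bounded_set S -> exists2 M : R, 0 < M & forall x, S x -> in_box M x.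
Proof.
move=> [M0 [_ hM]]; exists (`|M0| + 2); first by rewrite ltr_pwDr.
move=> x Sx; have /= := hM (`|M0| + 1) _ x Sx.
have -> : M0 < `|M0| + 1 by apply: le_lt_trans (ler_norm _) _; rewrite ltrDl.
move=> /(_ isT) h; rewrite /in_box; move: h; rewrite prod_normE ge_max => /andP[h1 h2].
by split; [apply: le_lt_trans h1 _|apply: le_lt_trans h2 _]; rewrite ltrD2l ltr1n.
Qed.

Lemma bounded_closure_compact S : bounded_set S -> compact (closure S).
Proof.
move=> /bounded_in_box[M M0 hM].
pose Q : set (plane R) := `[-M, M]%classic `*` `[-M, M]%classic.
have cQ : compact Q by apply: compact_setX; exact: segment_compact.
apply: (@subclosed_compact _ _ Q) => //; first exact: closed_closure.
have clQ : closed Q by apply: compact_closed => //; exact: norm_hausdorff.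
rewrite (closure_id Q).1//; apply: closureS => x /hM[h1 h2].
by split => /=; rewrite in_itv/= -ler_norml ltW.
Qed.

Lemma compact_within_bound (A : set (plane R)) (f : plane R -> R) :
  compact A -> {within A, continuous f} -> exists M : R, forall x, A x -> `|f x| <= M.
Proof.
move=> cA cf; have /compact_bounded[C0 [_ h]] := continuous_compact cf cA.
exists (`|C0| + 1) => x Ax; apply: (h (`|C0| + 1)); last by exists x.
by apply: le_lt_trans (ler_norm _) _; rewrite ltrDl.
Qed.

(** The closures of the pieces are compact. *)
Lemma bounded_piecewise (thin : set (plane R) -> Prop) S k :
  bounded_set S -> piecewise_continuous thin S k ->
  exists M : R, forall x, S x -> `|k x| <= M.
Proof.
move=> bS [m [P [kappa [SE hP]]]].
have /choice_fun[M hM] : forall i, exists M : R, forall x, P i x -> `|k x| <= M.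
  move=> i; have [_ ck kE] := hP i.
  have cP : compact (closure (P i)).
    apply: bounded_closure_compact; have PS : P i `<=` S by rewrite SE => x Px; exists i.
    move: bS => [M0 [rM hM]]; exists M0; split => // z zM x /PS; exact: hM.
  have [M hM] := compact_within_bound cP ck; exists M => x Px; rewrite kE//.
  by apply: hM; exact: subset_closure.
exists (\sum_i `|M i|) => x; rewrite SE => -[i _ /hM h]; apply: (le_trans h).
by rewrite (bigD1 i)//=; apply: (le_trans (ler_norm _)); rewrite lerDl sumr_ge0.
Qed.

Lemma bounded_area_finite S :
  measurable (S : set (mplane R)) -> bounded_set S -> (area_meas (S : set (mplane R)) < +oo)%E.
Proof.
move=> mS /bounded_in_box[M M0 hM].
apply: (@le_lt_trans _ _ (area_meas (`]-M, M[%classic `*` `]-M, M[%classic : set (mplane R)))).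
  apply: le_measure; rewrite ?inE//; first exact: measurableX.
  by move=> x /hM[h1 h2]; split => /=; rewrite in_itv/= -ltr_norml.
rewrite /area_meas /= product_measure1E//= lebesgue_measure_itv/= lte_fin.
by case: ifP => _; rewrite ?mule0 ?ltry// -EFinB -EFinM ltry.
Qed.

End BoundedSets.

(** * Steepness of the preactivations along the characteristics *)

Section Steep.
Context {R : realType}.
Variables (Omega : set (plane R)) (beta : plane R -> plane R).
Hypotheses (oO : open Omega) (bO : bounded_set Omega) (bC : C1_closure Omega beta).

Lemma beta_in_continuous : {in Omega, continuous beta}.
Proof.
move=> x /[1!inE] Ox; apply: differentiable_continuous.
by have [_ h _] := bC; exact: h.
Qed.

Lemma within_fst (A : set (plane R)) (f : plane R -> plane R) :
  {within A, continuous f} -> {within A, continuous (fun x => (f x).1)}.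
Proof. by move=> cf x; apply: cvg_comp (cf x) _; exact: cvg_fst. Qed.

Lemma within_snd (A : set (plane R)) (f : plane R -> plane R) :
  {within A, continuous f} -> {within A, continuous (fun x => (f x).2)}.
Proof. by move=> cf x; apply: cvg_comp (cf x) _; exact: cvg_snd. Qed.

(** Avoids the scaling by [1] in the definition of the directional derivative. *)
Lemma is_derive_limit (f : R -> R) (x l : R) :
  h^-1 * (f (x + h) - f x) @[h --> 0^'] --> l -> is_derive x 1 f l.
Proof.
move=> h.
have h' : (fun k : R => k^-1 *: ((f \o shift x) (k *: 1) - f x)) @ 0^' --> (l : R).
  apply: cvg_trans h; apply: near_eq_cvg; apply: nearW => k /=.
  by rewrite [k%:A]mulr1 [x + k]addrC.
apply: DeriveDef; first by apply/cvg_ex; exists l.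
exact: cvg_lim h'.
Qed.

(** The derivative of [x - t * beta x] in direction [j] differs from the unit
    vector by at most [t * M] in each coordinate, [M] being a bound for the derivatives of [beta]
    on the compact closure of the region. So for small [t] the larger of the
    two weights keeps at least half of its influence. *)
Lemma steep_preact : exists2 tau0 : R, 0 < tau0 & forall (n : nat) (t : R), 0 <= t < tau0 ->
  forall (r : 'cV[R]_(n * 3)) i, omega r i <> 0 -> exists j : bool, forall S E, S `<=` Omega ->
  steep S E j (weight_max r i / 2) (fun x => preact r i (x - t *: beta x)).
Proof.
have [cb db Bb] := bC.
have [B hB] : exists B : bool -> plane R -> plane R, forall j, {within closure Omega, continuous B j} /\
    (forall x, Omega x -> 'D_(pt j 1 0) beta x = B j x).
  have /choice_fun[B hB] : forall j : bool, exists B : plane R -> plane R, {within closure Omega, continuous B} /\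
    (forall x, Omega x -> 'D_(pt j 1 0) beta x = B x).
    by move=> j; have [B cB BE] := Bb (pt j 1 0); exists B.
  by exists B.
have cO := bounded_closure_compact bO.
have [M M0 hM] : exists2 M : R, 0 <= M & forall j x, closure Omega x -> `|(B j x).1| <= M /\ `|(B j x).2| <= M.
  have b1 j := compact_within_bound cO (within_fst (hB j).1).
  have b2 j := compact_within_bound cO (within_snd (hB j).1).
  have [[M1 h1] [M2 h2]] := (b1 true, b1 false); have [[M3 h3] [M4 h4]] := (b2 true, b2 false).
  have p x := normr_ge0 (x : R); have l x := ler_norm (x : R).
  have p1 := p M1; have p2 := p M2; have p3 := p M3; have p4 := p M4.
  have l1 := l M1; have l2 := l M2; have l3 := l M3; have l4 := l M4.
  exists (`|M1| + `|M2| + `|M3| + `|M4|); first by rewrite !addr_ge0.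
  by move=> [] x cx; [have a1 := h1 x cx; have a2 := h3 x cx|have a1 := h2 x cx; have a2 := h4 x cx]; split; lra.
(* Then [t * 2 * M <= 1 / 2]. *)
exists (4 * (M + 1))^-1; first by rewrite invr_gt0 mulr_gt0// ltr_pwDr.
move=> n t /andP[t0 tM] r i w0.
have om0 := omax_gt0 w0.
pose comp (j : bool) (p : plane R) := if j then p.1 else p.2.
have [j hj] : exists j, `|comp j (omega r i)| = weight_max r i.
  rewrite /weight_max; case: (leP `|(omega r i).1| `|(omega r i).2|) => _; [by exists false|by exists true].
exists j => S E SO a b y ab nE hS.
have hO : on_seg Omega j a b y by move=> x /hS /SO.
pose P x := pt j (clip a b x) y.
have cP : continuous P.
  by move=> x; apply: (continuous_comp (f := clip a b) (g := pt j ^~ y)); [exact: clip_continuous|exact: pt_continuous].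
have PO x : closure Omega (P x) by exact: closure_seg.
have comp_beta (f : plane R -> R) : {within closure Omega, continuous f} -> continuous (f \o P).
  by move=> cf; apply: (within_comp cf cP PO).
exists (fun x => preact r i (P x - t *: beta (P x))).
exists (fun x => comp j (omega r i) - t * ((omega r i).1 * (B j (P x)).1 + (omega r i).2 * (B j (P x)).2)).
split.
- have -> : (fun x => preact r i (P x - t *: beta (P x))) = (fun x => neuron r i (inord 0) 0 +
    (omega r i).1 * ((P x).1 - t * (beta (P x)).1) + (omega r i).2 * ((P x).2 - t * (beta (P x)).2)).
    by apply/funext => x; rewrite preactE.
  move=> x; apply: cvgD.
    apply: cvgD; first exact: cvg_cst.
    apply: cvgMr; apply: cvgB; first by apply: cvg_comp (cP x) _; exact: cvg_fst.
    by apply: cvgMr; exact: (comp_beta _ (within_fst cb)).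
  apply: cvgMr; apply: cvgB; first by apply: cvg_comp (cP x) _; exact: cvg_snd.
  by apply: cvgMr; exact: (comp_beta _ (within_snd cb)).
- move=> x; apply: cvgB; first exact: cvg_cst.
  apply: cvgMr; apply: cvgD; apply: cvgMr.
    exact: (comp_beta _ (within_fst (hB j).1)).
  exact: (comp_beta _ (within_snd (hB j).1)).
- by move=> x /andP[? ?]; rewrite /P clip_id// !ltW.
- move=> x xab; apply: is_derive_limit; set p := pt j x y.
  have Op : Omega p by exact: hO.
  have Px : P x = p by rewrite /P clip_id//; case/andP: xab => /ltW -> /ltW ->.
  have qcv : h^-1 *: (beta (h *: pt j 1 0 + p) - beta p) @[h --> 0^'] --> B j p.
    by rewrite -(hB j).2//; exact: (diff_derivable (db _ Op)).
  have nearxab : \forall h \near (0 : R)^', `|h| < Num.min (x - a) (b - x).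
    case/andP: xab => ax xb; have m0 : 0 < Num.min (x - a) (b - x) by rewrite lt_min !subr_gt0 ax.
    by exists (Num.min (x - a) (b - x)) => //= h; rewrite /ball_ /= sub0r normrN.
  rewrite Px.
  apply: (@cvg_trans _ ((fun h => comp j (omega r i) - t * ((omega r i).1 * (h^-1 *: (beta (h *: pt j 1 0 + p) - beta p)).1 +
     (omega r i).2 * (h^-1 *: (beta (h *: pt j 1 0 + p) - beta p)).2)) @ 0^')).
    apply: near_eq_cvg; near=> h.
    have h0 : h != 0 by near: h; exact: nbhs_dnbhs_neq.
    have Ph : P (x + h) = h *: pt j 1 0 + p.
      rewrite /P clip_id; last first.
        have : `|h| < Num.min (x - a) (b - x) by near: h; exact: nearxab.
        rewrite lt_min !ltr_norml => /andP[/andP[? ?] /andP[? ?]]; apply/andP; split; lra.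
      have hh : h *: 1 = h :> R by exact: mulr1.
      have h00 : h *: 0 = 0 :> R by exact: mulr0.
      by rewrite /p /pt; case: (j); congr pair => /=; rewrite ?hh ?h00 ?add0r// addrC.
    rewrite Ph !preactE /=.
    set b1 := (beta _).1; set b2 := (beta _).2; set b3 := (beta p).1; set b4 := (beta p).2.
    have sc (k z : R) : k *: z = k * z :> R by [].
    by rewrite !sc /comp /p /pt /omega /=; case: (j) => /=; field.
  apply: cvgB; first exact: cvg_cst.
  apply: cvgMr; apply: cvgD; apply: cvgMr.
    by apply: cvg_comp qcv _; exact: cvg_fst.
  by apply: cvg_comp qcv _; exact: cvg_snd.
- move=> x; have [h1 h2] := hM j _ (PO x); set b1 := (B j (P x)).1 in h1 *; set b2 := (B j (P x)).2 in h2 *.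
  apply: le_trans (lerB_dist _ _); rewrite hj.
  have o1 : `|(omega r i).1| <= weight_max r i by rewrite /weight_max le_max lexx.
  have o2 : `|(omega r i).2| <= weight_max r i by rewrite /weight_max le_max lexx orbT.
  have z : `|(omega r i).1 * b1 + (omega r i).2 * b2| <= weight_max r i * (2 * M).
    apply: le_trans (ler_normD _ _) _; rewrite !normrM.
    have -> : weight_max r i * (2 * M) = weight_max r i * M + weight_max r i * M by ring.
    by apply: lerD; apply: ler_pM.
  have t2 : `|t * ((omega r i).1 * b1 + (omega r i).2 * b2)| <= weight_max r i / 2.
    rewrite normrM (ger0_norm t0); apply: (le_trans (ler_wpM2l t0 z)).
    have : t * (4 * (M + 1)) <= 1.
      by rewrite -ler_pdivlMr ?mulr_gt0 ?ltr_pwDr// div1r ltW.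
    move=> tM4; have tM2 : t * (2 * M) <= 2^-1 by lra.
    by rewrite mulrCA ler_pM2l.
  lra.
Unshelve. all: by end_near.
Qed.

Lemma tame_fst E : tame Omega E (fun x : plane R => x.1).
Proof. by apply: tame_within; apply: continuous_subspaceT => x; exact: cvg_fst. Qed.

Lemma tame_snd E : tame Omega E (fun x : plane R => x.2).
Proof. by apply: tame_within; apply: continuous_subspaceT => x; exact: cvg_snd. Qed.

Lemma tame_beta E : tame Omega E (fun x => (beta x).1) /\ tame Omega E (fun x => (beta x).2).
Proof.
by have [cb _ _] := bC; split; apply: tame_within; [exact: within_fst|exact: within_snd].
Qed.

Lemma bm_coordinates :
  bounded_meas Omega (fun x : plane R => x.1) /\ bounded_meas Omega (fun x : plane R => x.2).
Proof.
have [M M0 hM] := bounded_in_box bO.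
split; (split; [apply: (open_measurable_fun oO) => x _|exists M => x /hM[h1 h2]; exact: ltW]).
  exact: cvg_fst.
exact: cvg_snd.
Qed.

Lemma bm_beta : bounded_meas Omega (fun x => (beta x).1) /\ bounded_meas Omega (fun x => (beta x).2).
Proof.
have [cb _ _] := bC; have cO := bounded_closure_compact bO.
have [M1 h1] := compact_within_bound cO (within_fst cb).
have [M2 h2] := compact_within_bound cO (within_snd cb).
split; split.
- apply: (open_measurable_fun oO) => x Ox.
  by apply: cvg_comp (beta_in_continuous Ox) _; exact: cvg_fst.
- by exists M1 => x Ox; apply: h1; exact: subset_closure.
- apply: (open_measurable_fun oO) => x Ox.
  by apply: cvg_comp (beta_in_continuous Ox) _; exact: cvg_snd.
- by exists M2 => x Ox; apply: h2; exact: subset_closure.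
Qed.

Lemma bm_sub (S S' : set (plane R)) f :
  measurable (S' : set (mplane R)) -> S `<=` S' -> bounded_meas S' f -> bounded_meas S f.
Proof.
by move=> mS' SS [mf [C hC]]; split; [exact: measurable_funS mf|exists C => x /SS; exact: hC].
Qed.

Lemma bm_bool_bound (S : set (plane R)) (f : bool -> plane R -> R) : (forall l, bounded_meas S (f l)) ->
  exists2 C : R, 0 <= C & forall l x, S x -> `|f l x| <= C.
Proof.
move=> bf; have [_ [C1 h1]] := bf true; have [_ [C2 h2]] := bf false.
exists (`|C1| + `|C2|); first by rewrite addr_ge0.
have := ler_norm C1; have := ler_norm C2; have := normr_ge0 C1; have := normr_ge0 C2.
by move=> ? ? ? ? [] x Sx; [have := h1 x Sx|have := h2 x Sx]; lra.
Qed.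

(** Collects the analytic estimates for a subregion [S] of [Omega] with channel
    maps [x - t l * beta x]. *)
Theorem geometric_model n (c : 'cV[R]_n.+1) (t : bool -> R) (S E : set (plane R))
    (alpha : bool -> plane R -> R) (F : plane R -> R) :
  let psi l x := x - t l *: beta x in
  S `<=` Omega -> measurable (S : set (mplane R)) -> cuts E S -> rectifiable E ->
  (forall l (r : 'cV[R]_(n * 3)) i, omega r i <> 0 ->
     exists j, steep S E j (weight_max r i / 2) (fun x => preact r i (psi l x))) ->
  (forall l, bounded_meas S (alpha l)) -> (forall l, tame S E (alpha l)) -> bounded_meas S F -> tame S E F ->
  [/\ smooth_model (@nonzero_weights R n) (energy S c alpha psi F) (energy_diff S c alpha psi F)
        (fun r v e => Int S (fun x => residual_diff c alpha psi r v x * residual_diff c alpha psi r e x) +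
          lim (Int S (fun x => residual c alpha psi F r x * shell alpha psi s r e (weight_scale c v) x) @[s --> 0^'+])),
      forall r a b, nonzero_weights r ->
        cvg (mx_int S (fun x => residual c alpha psi F r x *: feature_grad alpha psi s r x) a b @[s --> 0^'+]) &
      forall r v a, nonzero_weights r ->
        (((Dhat c *t (1%:M : 'M[R]_3)) *m mx_int S (fun x => feature alpha psi r x *m (feature alpha psi r x)^T)
            *m (Dhat c *t (1%:M : 'M[R]_3))
          + limit_hess S c alpha psi F r *m (Dhat c *t (1%:M : 'M[R]_3))) *m v) a 0 =
        Int S (fun x => residual_diff c alpha psi r v x * residual_diff c alpha psi r (delta_mx a 0) x) +
          lim (Int S (fun x => residual c alpha psi F r x * shell alpha psi s r (delta_mx a 0) (weight_scale c v) x) @[s --> 0^'+])].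
Proof.
move=> psi SO mS cS rE hsteep balpha talpha bF tF.
have mO := open_plane_measurable oO.
have [M M0 hM] := bounded_in_box bO.
have SM x : S x -> in_box M x by move=> /SO /hM.
have bS : bounded_set S by move: bO => [M0' [rM hM']]; exists M0'; split => // z zM x /SO; exact: hM'.
have fS := bounded_area_finite mS bS.
have [b1 b2] := bm_coordinates; have [b3 b4] := bm_beta.
have bp1 l : bounded_meas S (fun x => (psi l x).1) by apply: bm_sub mO SO _; exact: bmB b1 (bmZ (t l) b3).
have bp2 l : bounded_meas S (fun x => (psi l x).2) by apply: bm_sub mO SO _; exact: bmB b2 (bmZ (t l) b4).
have [tb1 tb2] := tame_beta E.
have tp1 l : tame S E (fun x => (psi l x).1).
  apply: tame_sub SO (@subset_refl _ E) _.
  apply: (eq_tame (k := fun x => x.1 + - (t l * (beta x).1))) => //.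
  by apply: tameD; [exact: tame_fst|apply: tameN; apply: tameM => //; exact: tame_cst].
have tp2 l : tame S E (fun x => (psi l x).2).
  apply: tame_sub SO (@subset_refl _ E) _.
  apply: (eq_tame (k := fun x => x.2 + - (t l * (beta x).2))) => //.
  by apply: tameD; [exact: tame_snd|apply: tameN; apply: tameM => //; exact: tame_cst].
have [Ba Ba0 hBa] := bm_bool_bound balpha.
have [Y Y0 hY0] : exists2 Y : R, 0 <= Y & forall l x, S x -> 1 + `|(psi l x).1| + `|(psi l x).2| <= Y.
  have [|Y Y0 hY] := @bm_bool_bound S (fun l x => 1 + `|(psi l x).1| + `|(psi l x).2|).
    by move=> l; apply: bmD (bm_norm (bp2 l)); apply: bmD (bm_norm (bp1 l)); exact: bm_cst.
  by exists Y => // l x Sx; apply: le_trans (hY l x Sx); exact: ler_norm.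
have [CF CF0 hCF] : exists2 CF : R, 0 <= CF & forall x, S x -> `|F x| <= CF.
  have [_ [C hC]] := bF; exists `|C| => // x /hC h; exact: le_trans h (ler_norm C).
have [A A0 hA] := layer_band mS SM cS rE M0.
have mpsi1 l := (bp1 l).1; have mpsi2 l := (bp2 l).1; have malpha l := (balpha l).1.
have band l (r : 'cV[R]_(n * 3)) i (g : plane R -> R) (C t0 : R) : omega r i <> 0 -> 0 <= C -> 0 <= t0 ->
  measurable_fun (S : set (mplane R)) g -> (forall x, S x -> `|g x| <= C) ->
  (forall x, S x -> t0 < `|pre psi l r i x| -> g x = 0) ->
  `|\int[area_meas]_(x in S) g x| <= C * t0 * (8 * A / weight_max r i).
  move=> w0 C0 t00 mg gC g0; have om := omax_gt0 w0.
  have [j hj] := hsteep l r i w0.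
  have := hA j (weight_max r i / 2) _ g C t0 (divr_gt0 om (ltr0n _ 2)) hj C0 t00 mg gC g0.
  move=> h; apply: (le_trans h); rewrite le_eqVlt; apply/orP; left; apply/eqP; field; rewrite gt_eqF//.
have layer l (r : 'cV[R]_(n * 3)) i p : omega r i <> 0 -> bounded_meas S p -> tame S E p ->
  exists v : R, forall q w K, jump_kernel K -> bounded_meas S q -> bounded_meas S w -> tame S E q -> tame S E w ->
   (forall x, S x -> q x * w x = p x) ->
   \int[area_meas]_(x in S) ((2 * s)^-1 * (q x * K (pre psi l r i x) (s * w x))) @[s --> 0^'+] --> v.
  move=> w0 bp tp; have om := omax_gt0 w0; have [j hj] := hsteep l r i w0.
  have mh : measurable_fun (S : set (mplane R)) (pre psi l r i).
    by have [] := pre_bm mpsi1 mpsi2 hY0 l r i.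
  exact: (layer_limit mS SM cS (divr_gt0 om (ltr0n _ 2)) hj mh rE M0 bp tp).
have A80 : 0 <= 8 * A by rewrite mulr_ge0.
have [mF _] := bF.
split.
- exact: (region_model c mS fS malpha hBa mpsi1 mpsi2 hY0 mF hCF Ba0 Y0 CF0 A80 band talpha tp1 tp2 tF layer).
- move=> r a b w0.
  exact: (feature_grad_cvg mS fS malpha hBa mpsi1 mpsi2 hY0 mF hCF Ba0 Y0 band talpha tp1 tp2 tF layer).
- move=> r v a w0.
  exact: (region_matrix c mS fS malpha hBa mpsi1 mpsi2 hY0 mF hCF Ba0 Y0 band talpha tp1 tp2 tF layer).
Qed.

End Steep.

(** * The interior region and the boundary region *)

Section Layer.
Context {R : realType}.
Implicit Types (A S Omega : set (plane R)).

Lemma enorm_continuous (p : plane R) : continuous (fun x : plane R => enorm (x - p)).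
Proof.
move=> x; rewrite /enorm /dot /=.
have c1 : {for x, continuous (fun z : plane R => z.1 - p.1)} by apply: cvgB; [exact: cvg_fst|exact: cvg_cst].
have c2 : {for x, continuous (fun z : plane R => z.2 - p.2)} by apply: cvgB; [exact: cvg_snd|exact: cvg_cst].
apply: (@continuous_comp _ _ _ (fun z : plane R => (z.1 - p.1) * (z.1 - p.1) + (z.2 - p.2) * (z.2 - p.2)) (@Num.sqrt R)).
  by apply: cvgD; apply: cvgM.
exact: sqrt_continuous.
Qed.

(** The infimum need not be attained. *)
Lemma edistance_leP A (x : plane R) (eps : R) : (edistance x A <= eps%:E)%E <->
  forall n : nat, exists2 p, A p & enorm (x - p) < eps + n.+1%:R^-1.
Proof.
split=> [h n|h].
  have : (edistance x A < (eps + n.+1%:R^-1)%:E)%E.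
    by apply: (le_lt_trans h); rewrite lte_fin ltrDl.
  by move=> /ereal_inf_lt[_ [p Ap <-]]; rewrite lte_fin; exists p.
apply/lee_addgt0Pr => e e0.
have [n ne] : exists n, n.+1%:R^-1 < e.
  by have [n hn] := ltr_add_invr e0; exists n; rewrite add0r in hn.
have [p Ap hp] := h n.
apply: (@le_trans _ _ (enorm (x - p))%:E); first by apply: ereal_inf_lbound; exists p.
by rewrite -EFinD lee_fin; apply/ltW/(lt_trans hp); rewrite ltrD2l.
Qed.

(** By [edistance_leP] a countable intersection of open sets. *)
Lemma measurable_edistance A (eps : R) :
  measurable ([set x | (edistance x A <= eps%:E)%E] : set (mplane R)).
Proof.
have -> : [set x | (edistance x A <= eps%:E)%E] =
    \bigcap_n \bigcup_(p in A) [set x | enorm (x - p) < eps + n.+1%:R^-1].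
  apply/seteqP; split => x /=.
    by move=> /edistance_leP h n _; have [p Ap hp] := h n; exists p.
  by move=> h; apply/edistance_leP => n; have [p Ap hp] := h n I; exists p.
apply: bigcapT_measurable => n; apply: open_plane_measurable.
apply: bigcup_open => p _.
rewrite -[X in open X]/((fun x => enorm (x - p)) @^-1` [set t | t < eps + n.+1%:R^-1]).
by apply: open_comp; [move=> x _; exact: enorm_continuous|exact: open_lt].
Qed.

(** One piece; the set of interfaces is empty. *)
Lemma curve_pc_continuous A (h : plane R -> R) : continuous h -> curve_pc A h.
Proof.
move=> ch; exists 1, (fun=> A), (fun=> h); split.
  by apply/seteqP; split => x; [exists ord0|case].
move=> i; split => //; last exact: continuous_subspaceT.
by rewrite setDv closure0 setI0; exact: finite_set0.
Qed.

Lemma tame_region_pc S k : region_pc S k -> exists2 E, rectifiable E & tame S E k.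
Proof. by case=> _; exact: tame_piecewise. Qed.

Variables (Omega : set (plane R)) (beta : plane R -> plane R) (gamma f g : plane R -> R).
Variables (tau : R) (tauB : plane R -> R).

Definition delay (l : bool) : R := if l then tau else 0.

Definition weightI (l : bool) x : R := if l then - tau^-1 else tau^-1 + gamma x.

(** The boundary operator needs a single channel; the other one has weight [0]. *)
Definition weightB (l : bool) x : R := if l then 0 else (tauB x)^-1 + gamma x.

(** On the boundary region the inflow data join the source term. *)
Definition dataB x : R := (tauB x)^-1 * g (x - tauB x *: beta x) + f x.

Lemma opI_combine p q (V : plane R -> 'M[R]_(p, q)) x :
  opI beta gamma tau V x = combine weightI (fun l x => x - delay l *: beta x) V x.
Proof.
rewrite /opI /back_diff /combine big_bool /= scale0r subr0 scalerBr scalerDl scaleNr.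
by rewrite [RHS]addrC addrAC.
Qed.

Lemma opB_combine p q (V : plane R -> 'M[R]_(p, q)) x :
  opB gamma tauB V x = combine weightB (fun (l : bool) x => x - (0 : R) *: beta x) V x.
Proof. by rewrite /opB /combine big_bool /= !scale0r subr0 add0r. Qed.

Lemma resI_rho n (c : 'cV[R]_n.+1) r x :
  resI beta gamma f tau (network c r) x = residual c weightI (fun l x => x - delay l *: beta x) f r x.
Proof.
rewrite /resI /opI /back_diff /residual big_bool /= scale0r subr0.
set u := network c r x; set w := network _ _ (x - _).
rewrite -[LHS]/(tau^-1 * ((u : R) - (w : R)) + gamma x * (u : R) - f x); ring.
Qed.

Lemma resB_rho n (c : 'cV[R]_n.+1) r x :
  resB beta gamma f g tauB (network c r) x =
  residual c weightB (fun (l : bool) x => x - (0 : R) *: beta x) dataB r x.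
Proof.
rewrite /resB /opB /residual big_bool /= !scale0r subr0 /dataB.
set u := network c r x.
rewrite -[LHS]/(((tauB x)^-1 + gamma x) * (u : R) - (tauB x)^-1 * g (x - tauB x *: beta x) - f x); ring.
Qed.

Hypotheses (oO : open Omega) (bO : bounded_set Omega) (bC : C1_closure Omega beta).
Hypothesis unitO : forall x, Omega x -> enorm (beta x) = 1.
Hypotheses (pf : region_pc Omega f) (pgamma : region_pc Omega gamma).
Variables (strip : set (plane R)) (eps : R).
Let Gamma_in := inflow Omega beta.
Let OmegaI := Omega `\` strip.
Let OmegaB := strip `\` [set x | (edistance x Gamma_in <= eps%:E)%E].
Hypotheses (sO : strip `<=` Omega) (mstrip : measurable (strip : set (mplane R))).
Hypotheses (rO : rectifiable (boundary Omega)) (rstrip : rectifiable (boundary strip)).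
Hypotheses (eps0 : 0 < eps) (rB : rectifiable (boundary OmegaB)).
Hypothesis foot : forall x, strip x -> 0 < tauB x /\ Gamma_in (x - tauB x *: beta x).
Hypothesis foot_pc : forall h, curve_pc Gamma_in h -> region_pc OmegaB (fun x => h (x - tauB x *: beta x)).
Hypothesis pg : curve_pc Gamma_in g.

Lemma bm_region_pc S k : bounded_set S -> region_pc S k -> bounded_meas S k.
Proof. by move=> bS [mk pk]; split => //; exact: (bounded_piecewise bS pk). Qed.

Lemma unit_dot x : Omega x -> dot (beta x) (beta x) = 1.
Proof.
move=> Ox; have := unitO Ox; rewrite /enorm => h.
have d0 : 0 <= dot (beta x) (beta x) by rewrite /dot addr_ge0// -expr2 sqr_ge0.
by rewrite -(sqr_sqrtr d0) h expr1n.
Qed.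

(** The travel time is recovered from the foot of the characteristic, whose
    coordinates are piecewise continuous by assumption. *)
Lemma tauB_dot x : Omega x -> tauB x =
  (x.1 - (x - tauB x *: beta x).1) * (beta x).1 + (x.2 - (x - tauB x *: beta x).2) * (beta x).2.
Proof.
move=> Ox; rewrite -[LHS]mulr1 -(unit_dot Ox) /dot /=.
rewrite -[_ *: (beta x).1]/(tauB x * (beta x).1) -[_ *: (beta x).2]/(tauB x * (beta x).2); ring.
Qed.

(** A point of the boundary region is further than [eps] from its foot, and
    [beta] is a unit vector. *)
Lemma tauB_gt x : OmegaB x -> eps < tauB x.
Proof.
move=> [Sx /negP h]; have [t0 Gx] := foot Sx.
rewrite -lte_fin; move: h; rewrite -ltNge => /lt_le_trans; apply.
apply: (@le_trans _ _ (enorm (x - (x - tauB x *: beta x)))%:E).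
  by apply: ereal_inf_lbound; exists (x - tauB x *: beta x).
rewrite opprB addrC subrK lee_fin /enorm.
have -> : dot (tauB x *: beta x) (tauB x *: beta x) = tauB x ^+ 2 * dot (beta x) (beta x).
  rewrite /dot /= -[_ *: (beta x).1]/(tauB x * (beta x).1) -[_ *: (beta x).2]/(tauB x * (beta x).2); ring.
by rewrite unit_dot ?mulr1 ?sqrtr_sqr ?gtr0_norm//; exact: sO.
Qed.

Lemma measurable_OmegaI : measurable (OmegaI : set (mplane R)).
Proof. by apply: measurableD => //; exact: open_plane_measurable. Qed.

Lemma measurable_OmegaB : measurable (OmegaB : set (mplane R)).
Proof. by apply: measurableD => //; exact: measurable_edistance. Qed.

Lemma OmegaB_sub : OmegaB `<=` Omega.
Proof. by move=> x [/sO]. Qed.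

Lemma bounded_inflow : bounded_set Gamma_in.
Proof.
have /compact_bounded[M0 [rM hM]] := bounded_closure_compact bO.
exists M0; split => // z zM x [[cx _] _]; exact: hM cx.
Qed.

Lemma curve_pc_bounded h :
  curve_pc Gamma_in h -> exists M : R, forall x, OmegaB x -> `|h (x - tauB x *: beta x)| <= M.
Proof.
move=> ph; have [M hM] := bounded_piecewise bounded_inflow ph.
by exists M => x [Sx _]; apply: hM; have [] := foot Sx.
Qed.

Lemma foot_bm_tame h : curve_pc Gamma_in h -> bounded_meas OmegaB (fun x => h (x - tauB x *: beta x)) /\
  exists2 E, rectifiable E & tame OmegaB E (fun x => h (x - tauB x *: beta x)).
Proof.
move=> ph; have [mh th] := foot_pc ph; split; last exact: tame_piecewise th.
by split => //; exact: curve_pc_bounded.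
Qed.

Lemma dataI_regular : exists E, [/\ rectifiable E, cuts E OmegaI,
  forall l, bounded_meas OmegaI (weightI l), forall l, tame OmegaI E (weightI l) & bounded_meas OmegaI f /\ tame OmegaI E f].
Proof.
have [Ef rEf tf] := tame_region_pc pf; have [Eg rEg tg] := tame_region_pc pgamma.
have IO : OmegaI `<=` Omega by move=> x [].
have mO := open_plane_measurable oO.
pose E := boundary Omega `|` boundary strip `|` Ef `|` Eg; exists E.
have EfE : Ef `<=` E by move=> x ?; left; right.
have EgE : Eg `<=` E by move=> x ?; right.
split.
- by do !apply: rectifiableU.
- apply: cutsI; first by apply: cuts_boundary => x ?; do 3 left.
  by apply: cutsC; apply: cuts_boundary => x ?; left; left; right.
- move=> [] /=; first exact: bm_cst.
  by apply: bmD; [exact: bm_cst|apply: bm_sub mO IO _; exact: bm_region_pc].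
- move=> [] /=; first exact: tame_cst.
  by apply: tameD; [exact: tame_cst|exact: tame_sub tg].
- by split; [apply: bm_sub mO IO _; exact: bm_region_pc|exact: tame_sub tf].
Qed.

(** [tauB] is bounded below by [eps] ([tauB_gt]), so that its inverse is as
    regular as the coordinates of the foot. *)
Lemma dataB_regular : exists E, [/\ rectifiable E, cuts E OmegaB,
  forall l, bounded_meas OmegaB (weightB l), forall l, tame OmegaB E (weightB l) & bounded_meas OmegaB dataB /\ tame OmegaB E dataB].
Proof.
have [Ef rEf tf] := tame_region_pc pf; have [Eg rEg tg] := tame_region_pc pgamma.
have mO := open_plane_measurable oO.
have p1 : curve_pc Gamma_in fst by apply: curve_pc_continuous => x; exact: cvg_fst.
have p2 : curve_pc Gamma_in snd by apply: curve_pc_continuous => x; exact: cvg_snd.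
have [b1 [E1 rE1 t1]] := foot_bm_tame p1.
have [b2 [E2 rE2 t2]] := foot_bm_tame p2.
have [b3 [E3 rE3 t3]] := foot_bm_tame pg.
pose E := boundary OmegaB `|` Ef `|` Eg `|` E1 `|` E2 `|` E3; exists E.
have EfE : Ef `<=` E by move=> x ?; left; left; left; left; right.
have EgE : Eg `<=` E by move=> x ?; left; left; left; right.
have E1E : E1 `<=` E by move=> x ?; left; left; right.
have E2E : E2 `<=` E by move=> x ?; left; right.
have E3E : E3 `<=` E by move=> x ?; right.
have BO := OmegaB_sub.
have [bx1 bx2] := bm_coordinates oO bO; have [bb1 bb2] := bm_beta oO bO bC.
have [tb1 tb2] := tame_beta bC E.
(* The maximum with [eps] makes the inverse continuous on the whole line. *)
have inv_eq x : OmegaB x -> (tauB x)^-1 = (Num.max eps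
   ((x.1 - (x - tauB x *: beta x).1) * (beta x).1 + (x.2 - (x - tauB x *: beta x).2) * (beta x).2))^-1.
  by move=> Bx; rewrite -tauB_dot; [rewrite (max_idPr _)// ltW// tauB_gt|exact: BO].
have cinv : continuous (fun t : R => (Num.max eps t)^-1).
  move=> t; apply: cvgV; last by apply: (@continuous_max R R (cst eps) id); [exact: cvg_cst|exact: cvg_id].
  by rewrite gt_eqF// lt_max eps0.
have binv : bounded_meas OmegaB (fun x => (tauB x)^-1).
  have h : bounded_meas OmegaB (fun x => (Num.max eps ((x.1 - (x - tauB x *: beta x).1) * (beta x).1 +
     (x.2 - (x - tauB x *: beta x).2) * (beta x).2))^-1).
    apply: (bm_comp (phi := fun t => (Num.max eps t)^-1) (C := eps^-1)).
    - apply: bmD; apply: bmM; [apply: bmB => //|..|apply: bmB => //|]; exact: bm_sub mO BO _.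
    - exact: continuous_measurable_fun.
    - move=> t; have m0 : 0 < Num.max eps t by rewrite lt_max eps0.
      rewrite gtr0_norm ?invr_gt0//; apply: (@le_trans _ _ eps^-1); last by rewrite lerDr.
      by rewrite lef_pV2 ?posrE// le_max lexx.
  have [mh [C hC]] := h; split; last by exists C => x Bx; rewrite inv_eq//; exact: hC.
  by apply: eq_measurable_fun mh => x /[1!inE] Bx; rewrite inv_eq.
have tinv : tame OmegaB E (fun x => (tauB x)^-1).
  apply: (eq_tame (fun x Bx => esym (inv_eq x Bx))).
  apply: (tame_comp cinv); apply: tameD; apply: tameM.
  - apply: tameD; first by apply: tame_sub BO (@subset_refl _ E) _; exact: tame_fst.
    by apply: tameN; exact: tame_sub (@subset_refl _ OmegaB) E1E t1.
  - exact: tame_sub BO (@subset_refl _ E) tb1.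
  - apply: tameD; first by apply: tame_sub BO (@subset_refl _ E) _; exact: tame_snd.
    by apply: tameN; exact: tame_sub (@subset_refl _ OmegaB) E2E t2.
  - exact: tame_sub BO (@subset_refl _ E) tb2.
have bf : bounded_meas OmegaB f by apply: bm_sub mO BO _; exact: bm_region_pc.
have bgam : bounded_meas OmegaB gamma by apply: bm_sub mO BO _; exact: bm_region_pc.
have tfE : tame OmegaB E f by exact: tame_sub BO EfE tf.
have tgE : tame OmegaB E gamma by exact: tame_sub BO EgE tg.
split.
- by do !apply: rectifiableU.
- by apply: cuts_boundary => x ?; do 5 left.
- by move=> [] /=; [exact: bm_cst|exact: bmD].
- by move=> [] /=; [exact: tame_cst|exact: tameD].
- split; first by apply: bmD => //; exact: bmM.
  by apply: tameD => //; apply: tameM => //; exact: tame_sub (@subset_refl _ OmegaB) E3E t3.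
Qed.

End Layer.

Theorem lemma4p4 (R : realType) (Omega : set (plane R))
    (beta : plane R -> plane R)
    (Omega_open : open Omega)
    (Omega_bounded : bounded_set Omega)
    (Omega_boundary : rectifiable (boundary Omega))
    (beta_C1 : C1_closure Omega beta)
    (beta_unit : forall x, Omega x -> enorm (beta x) = 1) :
  exists2 tau0 : R, 0 < tau0 & forall tau : R, 0 < tau < tau0 ->
  forall (strip : set (plane R)) (eps : R) (tauB : plane R -> R)
    (gamma f g : plane R -> R) (n : nat) (c : 'cV[R]_n.+1),
  let Gamma_in := inflow Omega beta in
  let OmegaI := Omega `\` strip in
  let OmegaB := strip `\` [set x | (edistance x Gamma_in <= eps%:E)%E] in
  let L r := loss OmegaI OmegaB beta gamma f g tau tauB (network c r) in
  let hess r := hessian_formula OmegaI OmegaB beta gamma f g tau tauB c r in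
  strip `<=` Omega ->
  measurable strip ->
  rectifiable (boundary strip) ->
  Gamma_in `<=` boundary strip ->
  0 < eps ->
  rectifiable (boundary OmegaB) ->
  (forall x, strip x -> 0 < tauB x /\ Gamma_in (x - tauB x *: beta x)) ->
  (forall h, curve_pc Gamma_in h ->
     region_pc OmegaB (fun x => h (x - tauB x *: beta x))) ->
  area.-integrable Omega (fun x => (f x ^+ 2)%:E) ->
  region_pc Omega f ->
  region_pc Omega gamma ->
  curve_pc Gamma_in g ->
  [/\ forall r, (forall i, omega r i <> 0) ->
        Hhat_exists OmegaI OmegaB beta gamma f g tau tauB c r,
      weak_hessian [set r | forall i, omega r i <> 0] L hess &
      forall r, (forall i, enorm (omega r i) = 1) ->
        central_hessian L r (hess r)].
Proof.
have [tau0 tau00 steepO] := steep_preact Omega_bounded beta_C1.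
exists tau0 => // tau /andP[tau_gt0 tau_lt] strip eps tauB gamma f g n c Gamma_in OmegaI OmegaB L hess.
move=> sO mstrip rstrip _ eps0 rB foot foot_pc _ pf pgamma pg.
have [EI [rEI cEI bwI twI [bfI tfI]]] :=
  dataI_regular tau Omega_open Omega_bounded pf pgamma Omega_boundary rstrip.
have [EB [rEB cEB bwB twB [bfB tfB]]] :=
  dataB_regular Omega_open Omega_bounded beta_C1 beta_unit pf pgamma sO eps0 rB foot foot_pc pg.
have delay_range l : 0 <= delay tau l < tau0 by case: l => /=; rewrite ?lexx ?tau00 ?(ltW tau_gt0).
have IO : OmegaI `<=` Omega by move=> x [].
have BO : OmegaB `<=` Omega by move=> x [/sO].
have stI l (r : 'cV[R]_(n * 3)) i : omega r i <> 0 ->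
    exists j, steep OmegaI EI j (weight_max r i / 2) (fun x => preact r i (x - delay tau l *: beta x)).
  by move=> w0; have [j hj] := steepO n _ (delay_range l) r i w0; exists j; exact: hj.
have stB (l : bool) (r : 'cV[R]_(n * 3)) i : omega r i <> 0 ->
    exists j, steep OmegaB EB j (weight_max r i / 2) (fun x => preact r i (x - (0 : R) *: beta x)).
  by move=> w0; have [j hj] := steepO n _ (delay_range false) r i w0; exists j; exact: hj.
have mI := measurable_OmegaI Omega_open mstrip.
have mB := measurable_OmegaB Omega beta eps mstrip.
have [modI cvI matI] := geometric_model Omega_open Omega_bounded beta_C1 c (t := delay tau) IO mI cEI rEI stI bwI twI bfI tfI.
have [modB cvB matB] := geometric_model Omega_open Omega_bounded beta_C1 c (t := fun=> 0) BO mB cEB rEB stB bwB twB bfB tfB.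
set psiI := (fun (l : bool) x => x - delay tau l *: beta x) in modI cvI matI.
set psiB := (fun (l : bool) x => x - (0 : R) *: beta x) in modB cvB matB.
have LE : L = fun r => energy OmegaI c (weightI gamma tau) psiI f r + energy OmegaB c (weightB gamma tauB) psiB (dataB beta f g tauB) r.
  apply/funext => r; rewrite /L /loss /energy; congr (_ * _ + _ * _); apply: eq_Rintegral => x _.
    by rewrite resI_rho.
  by rewrite resB_rho.
have HIE r s : HhatI_approx OmegaI beta gamma f tau c r s =
    mx_int OmegaI (fun x => residual c (weightI gamma tau) psiI f r x *: feature_grad (weightI gamma tau) psiI s r x).
  by congr mx_int; apply/funext => x; rewrite resI_rho /gradGI opI_combine.
have HBE r s : HhatB_approx OmegaB beta gamma f g tauB c r s =
    mx_int OmegaB (fun x => residual c (weightB gamma tauB) psiB (dataB beta f g tauB) r x *: feature_grad (weightB gamma tauB) psiB s r x).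
  by congr mx_int; apply/funext => x; rewrite resB_rho /gradGB (opB_combine beta).
have hessE r v a : nonzero_weights r -> (hess r *m v) a 0 =
   Int OmegaI (fun x => residual_diff c (weightI gamma tau) psiI r v x * residual_diff c (weightI gamma tau) psiI r (delta_mx a 0) x) +
          lim (Int OmegaI (fun x => residual c (weightI gamma tau) psiI f r x * shell (weightI gamma tau) psiI s r (delta_mx a 0) (weight_scale c v) x) @[s --> 0^'+]) +
   (Int OmegaB (fun x => residual_diff c (weightB gamma tauB) psiB r v x * residual_diff c (weightB gamma tauB) psiB r (delta_mx a 0) x) +
          lim (Int OmegaB (fun x => residual c (weightB gamma tauB) psiB (dataB beta f g tauB) r x * shell (weightB gamma tauB) psiB s r (delta_mx a 0) (weight_scale c v) x) @[s --> 0^'+])).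
  move=> w0; apply: etrans _ (congr2 +%R (matI r v a w0) (matB r v a w0)).
  have sumE (X Z : 'M[R]_(n * 3)) : (X *m v) a 0 + (Z *m v) a 0 = ((X + Z) *m v) a 0.
    by rewrite mulmxDl [RHS]mxE.
  rewrite sumE; congr ((_ *m v) a 0).
  have GIE : HmatI OmegaI beta gamma tau r = mx_int OmegaI (fun x =>
      feature (weightI gamma tau) psiI r x *m (feature (weightI gamma tau) psiI r x)^T).
    rewrite /HmatI; congr mx_int; apply/funext => x.
    by rewrite (_ : GI beta gamma tau r x = feature (weightI gamma tau) psiI r x)//; exact: opI_combine.
  have GBE : HmatB OmegaB gamma tauB r = mx_int OmegaB (fun x =>
      feature (weightB gamma tauB) psiB r x *m (feature (weightB gamma tauB) psiB r x)^T).
    rewrite /HmatB; congr mx_int; apply/funext => x.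
    by rewrite (_ : GB gamma tauB r x = feature (weightB gamma tauB) psiB r x)//; exact: opB_combine.
  have DIE : HhatI OmegaI beta gamma f tau c r = limit_hess OmegaI c (weightI gamma tau) psiI f r.
    by apply/matrixP => i k; rewrite mxE [RHS]mxE; under eq_fun do rewrite HIE.
  have DBE : HhatB OmegaB beta gamma f g tauB c r = limit_hess OmegaB c (weightB gamma tauB) psiB (dataB beta f g tauB) r.
    by apply/matrixP => i k; rewrite mxE [RHS]mxE; under eq_fun do rewrite HBE.
  by rewrite /hess /hessian_formula GIE GBE DIE DBE mulmxDr !mulmxDl addrACA.
split.
- move=> r w0 a b; split.
    by under eq_fun do rewrite HIE; exact: cvI.
  by under eq_fun do rewrite HBE; exact: cvB.
- rewrite LE; apply: (sum_weak_hessian modI modB) => r w0 v a; exact: hessE.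
- move=> r w1.
  have w0 : nonzero_weights r.
    move=> i wi; have := w1 i; rewrite wi /enorm /dot /= mulr0 addr0 sqrtr0.
    by move/esym/eqP; rewrite oner_eq0.
  by rewrite LE; apply: (sum_central_hessian modI modB w0) => v a; exact: hessE.
Qed.
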